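(* Let $q\in(0,1)$, let $n\ge1$ be an integer and let $\lambda>2n-1$ be real. Then for every $\mathbf{k}=(k_1,\ldots,k_n)\in\mathbb{Z}^n$ with $k_1\ge k_2\ge\cdots\ge k_n\ge0$, $$(f_1,f_2)_{F}=\frac{\prod_{i=1}^n(q^{2\lambda+2-2i};q^2)_{k_i}}{(1-q^2)^{k_1+k_2+\cdots+k_n}}\cdot(f_1,f_2)_\lambda,\qquad f_1,f_2\in\mathbb{C}[M_n]^{\mathbf{k}}_q,$$ where $(\cdot,\cdot)_F$ is the $q$-Fock inner product and $(\cdot,\cdot)_\lambda$ is the normalized $U_q\mathfrak{su}_{n,n}$-invariant inner product on $\mathcal{P}_\lambda$.
   Context: **Quantum matrices.** $\mathbb{C}[M_n]_q$ is the unital algebra with generators $z_a^\alpha$, $a,\alpha=1,\ldots,n$, and relations: $z_a^\alpha z_b^\beta=q z_b^\beta z_a^\alpha$ if ($a=b$ and $\alpha<\beta$) or ($a<b$ and $\alpha=\beta$); $z_a^\alpha z_b^\beta=z_b^\beta z_a^\alpha$ if $a<b$ and $\alpha>\beta$; $z_a^\alpha z_b^\beta=z_b^\beta z_a^\alpha+(q-q^{-1})z_a^\beta z_b^\alpha$ if $a<b$ and $\alpha<\beta$. The $q$-minors are $(\mathbf{z}^{\wedge k})_{\{a_1<\cdots<a_k\}}^{\{\alpha_1<\cdots<\alpha_k\}}=\sum_{s\in S_k}(-q)^{l(s)}z_{a_1}^{\alpha_{s(1)}}\cdots z_{a_k}^{\alpha_{s(k)}}$, $l(s)$ the length of $s$;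 $\det_q(\mathbf{z})$ is the $q$-minor with $k=n$. **The Hopf algebra $U_q\mathfrak{sl}_{2n}$.** Generators $E_i,F_i,K_i^{\pm1}$, $i=1,\ldots,2n-1$; relations $K_iK_j=K_jK_i$, $K_iK_i^{-1}=K_i^{-1}K_i=1$, $K_iE_j=q^{a_{ij}}E_jK_i$, $K_iF_j=q^{-a_{ij}}F_jK_i$, $E_iF_j-F_jE_i=\delta_{ij}(K_i-K_i^{-1})/(q-q^{-1})$, $E_i^2E_j-(q+q^{-1})E_iE_jE_i+E_jE_i^2=0$ and the same for $F$ if $|i-j|=1$, and $[E_i,E_j]=[F_i,F_j]=0$ if $|i-j|\neq1$, where $(a_{ij})$ is the Cartan matrix of type $A_{2n-1}$. Comultiplication: $\Delta(E_i)=E_i\otimes1+K_i\otimes E_i$, $\Delta(F_i)=F_i\otimes K_i^{-1}+1\otimes F_i$, $\Delta(K_i)=K_i\otimes K_i$; counit $\varepsilon(E_i)=\varepsilon(F_i)=0$, $\varepsilon(K_i)=1$; antipode $S(E_i)=-K_i^{-1}E_i$, $S(F_i)=-F_iK_i$, $S(K_i)=K_i^{-1}$. A module algebra over a Hopf algebra $A$ is a unital algebra that is an $A$-module with $\xi(1)=\varepsilon(\xi)1$ and with multiplication a morphism of $A$-modules. **Involution.** $U_q\mathfrak{su}_{n,n}$ is $U_q\mathfrak{sl}_{2n}$ with the (antilinear, antimultiplicative) involution $*$: $E_n^*=-K_nF_n$, $F_n^*=-E_nK_n^{-1}$, $(K_j^{\pm1})^*=K_j^{\pm1}$ for all $j$,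 and $E_j^*=K_jF_j$, $F_j^*=E_jK_j^{-1}$ for $j\ne n$. $U_q\mathfrak{s}(\mathfrak{gl}_n\times\mathfrak{gl}_n)$ is the Hopf subalgebra generated by $E_j,F_j$ ($j\neq n$) and all $K_j^{\pm1}$; with the restricted involution it is denoted $U_q\mathfrak{s}(\mathfrak{u}_n\times\mathfrak{u}_n)$. For a Hopf $*$-algebra $(A,* )$, an inner product on an $A$-module is invariant if $(\xi v_1,v_2)=(v_1,\xi^*v_2)$ for all $\xi\in A$. **Initial action.** It is known that there is a unique $U_q\mathfrak{sl}_{2n}$-module algebra structure on $\mathbb{C}[M_n]_q$ with the following action on generators. For $1\le i\le n-1$: $K_iz_a^\alpha=qz_a^\alpha$ if $a=i$, $q^{-1}z_a^\alpha$ if $a=i+1$, $z_a^\alpha$ otherwise; $F_iz_a^\alpha=q^{1/2}z_{a+1}^\alpha$ if $a=i$, $0$ otherwise; $E_iz_a^\alpha=q^{-1/2}z_{a-1}^\alpha$ if $a=i+1$, $0$ otherwise. For $1\le j\le n-1$: $K_{n+j}z_a^\alpha=qz_a^\alpha$ if $\alpha=n-j$, $q^{-1}z_a^\alpha$ if $\alpha=n-j+1$, $z_a^\alpha$ otherwise; $F_{n+j}z_a^\alpha=q^{1/2}z_a^{\alpha+1}$ if $\alpha=n-j$, $0$ otherwise; $E_{n+j}z_a^\alpha=q^{-1/2}z_a^{\alpha-1}$ if $\alpha=n-j+1$, $0$ otherwise. Finally $K_nz_a^\alpha=q^2z_a^\alpha$ if $a=\alpha=n$, $qz_a^\alpha$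 if exactly one of $a,\alpha$ equals $n$, $z_a^\alpha$ otherwise; $F_nz_a^\alpha=q^{1/2}$ if $a=\alpha=n$, $0$ otherwise; $E_nz_a^\alpha=-q^{-1/2}z_a^nz_n^\alpha$ if $a\ne n$ and $\alpha\neq n$, $-q^{1/2}(z_n^n)^2$ if $a=\alpha=n$, $-q^{1/2}z_n^nz_a^\alpha$ otherwise. **Twisted actions and $(\cdot,\cdot)_\lambda$.** For $\lambda\in\mathbb{R}$ the $U_q\mathfrak{sl}_{2n}$-action $\pi_\lambda$ on $\mathbb{C}[M_n]_q$ is given in terms of the initial action by $\pi_\lambda(K_j^{\pm1})=K_j^{\pm1}$, $\pi_\lambda(F_j)=F_j$, $\pi_\lambda(E_j)=E_j$ for $j\neq n$, and $\pi_\lambda(K_n^{\pm1})f=q^{\pm\lambda}K_n^{\pm1}f$, $\pi_\lambda(F_n)f=q^{-\lambda}F_nf$, $\pi_\lambda(E_n)f=E_nf-q^{1/2}\frac{1-q^{2\lambda}}{1-q^2}(K_nf)z_n^n$. $\mathcal{P}_\lambda$ denotes $\mathbb{C}[M_n]_q$ with the action $\pi_\lambda$. It is known that for $\lambda>2n-1$ there is a unique inner product $(\cdot,\cdot)_\lambda$ on $\mathcal{P}_\lambda$ with $(\pi_\lambda(\xi)f_1,f_2)_\lambda=(f_1,\pi_\lambda(\xi^* )f_2)_\lambda$ for all $\xi\in U_q\mathfrak{sl}_{2n}$, and $(1,1)_\lambda=1$. **Isotypic components.** As a $U_q\mathfrak{s}(\mathfrak{gl}_n\times\mathfrak{gl}_n)$-module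 (initial action) $\mathbb{C}[M_n]_q$ is the direct sum of simple pairwise non-isomorphic submodules $\mathbb{C}[M_n]_q^{\mathbf{k}}$, $k_1\ge\cdots\ge k_n\ge0$, where $\mathbb{C}[M_n]_q^{\mathbf{k}}$ is generated by its lowest vector $(z_n^n)^{k_1-k_2}\big((\mathbf{z}^{\wedge2})_{\{n-1,n\}}^{\{n-1,n\}}\big)^{k_2-k_3}\cdots(\det_q\mathbf{z})^{k_n}$. **$q$-derivatives and $q$-Fock inner product.** Let $\Omega^1(M_n)_q$ be the $\mathbb{C}[M_n]_q$-bimodule with generators $dz_a^\alpha$ and relations $z_b^\beta\,dz_a^\alpha=\sum_{\alpha',\beta',a',b'=1}^nR_{\beta\alpha}^{\beta'\alpha'}R_{ba}^{b'a'}\,dz_{a'}^{\alpha'}\cdot z_{b'}^{\beta'}$, where $R_{ba}^{b'a'}=q^{-1}$ if $a=b=a'=b'$; $1$ if $a\ne b$, $a=a'$, $b=b'$; $q^{-1}-q$ if $a<b$, $a=b'$, $b=a'$; $0$ otherwise. The map $z_a^\alpha\mapsto dz_a^\alpha$ extends to a linear map $d$ on $\mathbb{C}[M_n]_q$ with $d(f_1f_2)=d(f_1)f_2+f_1d(f_2)$, and $\partial/\partial z_a^\alpha$ is defined by $df=\sum_{a,\alpha}\frac{\partial f}{\partial z_a^\alpha}\cdot dz_a^\alpha$. It is known that there is a unique $U_q\mathfrak{s}(\mathfrak{u}_n\times\mathfrak{u}_n)$-invariant inner product $(\cdot,\cdot)_F$ on $\mathbb{C}[M_n]_q$ with $(1,1)_F=1$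 and $\left(\frac{\partial f_1}{\partial z_a^\alpha},f_2\right)_F=(f_1,f_2\cdot z_a^\alpha)_F$ for all $a,\alpha$. **Pochhammer symbol.** $(x;q^2)_N=\prod_{j=0}^{N-1}(1-xq^{2j})$. *)

(* Defs.v *)
From HB Require Import structures.
From mathcomp Require Import all_boot all_order perm all_algebra.
From mathcomp Require Import boolp reals exp.
From mathcomp Require Import complex.

Set Implicit Arguments.
Unset Strict Implicit.
Unset Printing Implicit Defensive.

Import Order.TTheory GRing.Theory Num.Theory.
Local Open Scope ring_scope.
Local Open Scope quotient_scope.

Inductive aterm (F X : Type) : Type :=
| Var of X
| Const of F
| Add of aterm F X & aterm F X
| Mul of aterm F X & aterm F X.
Arguments Var {F X}.
Arguments Const {F X}.

HB.instance Definition _ (F X : Type) := gen_eqMixin (aterm F X).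
HB.instance Definition _ (F X : Type) := gen_choiceMixin (aterm F X).

Declare Scope aterm_scope.
Delimit Scope aterm_scope with aterm.
Bind Scope aterm_scope with aterm.
Notation "0" := (Const 0%R) : aterm_scope.
Notation "1" := (Const 1%R) : aterm_scope.
Notation "s + t" := (Add s t) : aterm_scope.
Notation "s * t" := (Mul s t) : aterm_scope.
Notation "c *: t" := (Mul (Const c%R) t) : aterm_scope.
Notation "- t" := (Mul (Const (- 1)%R) t) : aterm_scope.
Notation "s - t" := (Add s (- t)%aterm) : aterm_scope.

(* cong rel is the congruence whose quotient is the free unital associative
   F-algebra on X modulo the two-sided ideal generated by the s - t, rel s t. *)
Inductive cong (F : pzRingType) (X : Type) (rel : aterm F X -> aterm F X -> Prop) :
    aterm F X -> aterm F X -> Prop :=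
| cong_refl s : cong rel s s
| cong_sym s t : cong rel s t -> cong rel t s
| cong_trans s t u : cong rel s t -> cong rel t u -> cong rel s u
| cong_add s s' t t' : cong rel s s' -> cong rel t t' -> cong rel (s + t) (s' + t')
| cong_mul s s' t t' : cong rel s s' -> cong rel t t' -> cong rel (s * t) (s' * t')
| cong_addA s t u : cong rel (s + (t + u)) (s + t + u)
| cong_addC s t : cong rel (s + t) (t + s)
| cong_add0 s : cong rel (0 + s) s
| cong_addN s : cong rel (- s + s) 0
| cong_mulA s t u : cong rel (s * (t * u)) (s * t * u)
| cong_mul1 s : cong rel (1 * s) s
| cong_mulDl s t u : cong rel ((s + t) * u) (s * u + t * u)
| cong_mulDr s t u : cong rel (s * (t + u)) (s * t + s * u)
| cong_constD a b : cong rel (Const (a + b)%R) (Const a + Const b)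
| cong_constM a b : cong rel (Const (a * b)%R) (Const a * Const b)
| cong_constC a s : cong rel (Const a * s) (s * Const a)
| cong_rel s t : rel s t -> cong rel s t.

Fixpoint eval (F : pzRingType) (X : Type) (B : algType F) (g : X -> B)
    (t : aterm F X) : B :=
  match t with
  | Var x => g x
  | Const c => c%:A
  | Add s t => eval g s + eval g t
  | Mul s t => eval g s * eval g t
  end.

Lemma eval_cong (F : comPzRingType) (X : Type) (rel : aterm F X -> aterm F X -> Prop)
    (B : algType F) (g : X -> B) :
  (forall s t, rel s t -> eval g s = eval g t) ->
  forall s t, cong rel s t -> eval g s = eval g t.
Proof.
move=> grel s t; elim=> //=.
- by move=> {}s {}t u _ -> _ ->.
- by move=> {}s s' {}t t' _ -> _ ->.
- by move=> {}s s' {}t t' _ -> _ ->.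
- by move=> *; rewrite addrA.
- by move=> *; rewrite addrC.
- by move=> *; rewrite scale0r add0r.
- by move=> *; rewrite scaleN1r mulN1r scale0r addNr.
- by move=> *; rewrite mulrA.
- by move=> *; rewrite scale1r mul1r.
- by move=> *; rewrite mulrDl.
- by move=> *; rewrite mulrDr.
- by move=> *; rewrite scalerDl.
- by move=> *; rewrite -scalerAl mul1r scalerA.
- by move=> *; rewrite mulr_algl mulr_algr.
Qed.

(* The augmentation is what makes the presented algebra a nonzero ring, as
   algType requires. *)
Record presentation (F : comNzRingType) := Presentation {
  gens : Type;
  rels : aterm F gens -> aterm F gens -> Prop;
  aug : gens -> F^o;
  aug_rels : forall s t, rels s t -> eval aug s = eval aug t
}.

Section PresentedAlgebra.
Variables (F : comNzRingType) (P : presentation F).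
Implicit Types s t u : aterm F (gens P).

Definition congb : rel (aterm F (gens P)) := fun s t => `[< cong (@rels F P) s t >].

Let congb_refl : reflexive congb.
Proof. by move=> s; apply/asboolP; apply: cong_refl. Qed.

Let congb_sym : symmetric congb.
Proof. by move=> s t; apply/asboolP/asboolP; apply: cong_sym. Qed.

Let congb_trans : transitive congb.
Proof.
move=> t s u /asboolP st /asboolP tu; apply/asboolP; exact: cong_trans st tu.
Qed.

Canonical congb_equiv := EquivRel congb congb_refl congb_sym congb_trans.

Definition presAlg := {eq_quot congb_equiv}.
HB.instance Definition _ := Choice.on presAlg.
HB.instance Definition _ := EqQuotient.on presAlg.

Definition toAlg (t : aterm F (gens P)) : presAlg := \pi_presAlg t.

Lemma toAlgP s t : toAlg s = toAlg t <-> cong (@rels F P) s t.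
Proof. by split=> [/eqquotP/asboolP | st]; last apply/eqquotP/asboolP. Qed.

Lemma toAlg_repr (x : presAlg) : toAlg (repr x) = x.
Proof. exact: reprK. Qed.

Lemma repr_toAlg t : cong (@rels F P) (repr (toAlg t)) t.
Proof. by apply/toAlgP; rewrite toAlg_repr. Qed.

Let add (x y : presAlg) := toAlg (repr x + repr y).
Let mul (x y : presAlg) := toAlg (repr x * repr y).
Let opp (x : presAlg) := toAlg (- repr x).
Let scale (c : F) (x : presAlg) := toAlg (c *: repr x).

Let addE s t : add (toAlg s) (toAlg t) = toAlg (s + t).
Proof. by apply/toAlgP/cong_add; apply: repr_toAlg. Qed.

Let mulE s t : mul (toAlg s) (toAlg t) = toAlg (s * t).
Proof. by apply/toAlgP/cong_mul; apply: repr_toAlg. Qed.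

Let oppE s : opp (toAlg s) = toAlg (- s).
Proof. by apply/toAlgP/cong_mul; [apply: cong_refl|apply: repr_toAlg]. Qed.

Let scaleE c s : scale c (toAlg s) = toAlg (c *: s).
Proof. by apply/toAlgP/cong_mul; [apply: cong_refl|apply: repr_toAlg]. Qed.

Let toAlgW (Q : presAlg -> Prop) : (forall t, Q (toAlg t)) -> forall x, Q x.
Proof. by move=> Qt x; rewrite -[x]toAlg_repr. Qed.

Let addA : associative add.
Proof.
elim/toAlgW=> s; elim/toAlgW=> t; elim/toAlgW=> u; rewrite !addE.
exact/toAlgP/cong_addA.
Qed.

Let addC : commutative add.
Proof. by elim/toAlgW=> s; elim/toAlgW=> t; rewrite !addE; apply/toAlgP/cong_addC. Qed.

Let add0 : left_id (toAlg 0) add.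
Proof. by elim/toAlgW=> s; rewrite addE; apply/toAlgP/cong_add0. Qed.

Let addN : left_inverse (toAlg 0) opp add.
Proof. by elim/toAlgW=> s; rewrite oppE addE; apply/toAlgP/cong_addN. Qed.

Let mulA : associative mul.
Proof.
elim/toAlgW=> s; elim/toAlgW=> t; elim/toAlgW=> u; rewrite !mulE.
exact/toAlgP/cong_mulA.
Qed.

Let mul1 : left_id (toAlg 1) mul.
Proof. by elim/toAlgW=> s; rewrite mulE; apply/toAlgP/cong_mul1. Qed.

Let constC c s : toAlg (c *: s) = toAlg (s * Const c).
Proof. exact/toAlgP/cong_constC. Qed.

Let mulr1 : right_id (toAlg 1) mul.
Proof. by elim/toAlgW=> s; rewrite mulE -constC -mulE mul1. Qed.

Let mulDl : left_distributive mul add.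
Proof.
elim/toAlgW=> s; elim/toAlgW=> t; elim/toAlgW=> u; rewrite !(addE, mulE).
exact/toAlgP/cong_mulDl.
Qed.

Let mulDr : right_distributive mul add.
Proof.
elim/toAlgW=> s; elim/toAlgW=> t; elim/toAlgW=> u; rewrite !(addE, mulE).
exact/toAlgP/cong_mulDr.
Qed.

Let oner_neq0 : toAlg 1 != toAlg 0.
Proof.
apply/eqP=> /toAlgP /(eval_cong (@aug_rels F P)) /=.
by rewrite scale1r scale0r => /eqP; rewrite oner_eq0.
Qed.

HB.instance Definition _ := GRing.isZmodule.Build presAlg addA addC add0 addN.
HB.instance Definition _ := GRing.Zmodule_isNzRing.Build presAlg
  mulA mul1 mulr1 mulDl mulDr oner_neq0.

Let scaleA a b (x : presAlg) : scale a (scale b x) = scale (a * b) x.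
Proof.
elim/toAlgW: x => s; rewrite !scaleE -mulE -[toAlg (b *: s)]mulE mulA mulE.
rewrite -[RHS]mulE; congr mul; exact/toAlgP/cong_sym/cong_constM.
Qed.

Let scale1 : left_id 1 scale.
Proof. by elim/toAlgW=> s; rewrite scaleE -mulE mul1. Qed.

Let scaleDr : right_distributive scale +%R.
Proof.
move=> c; elim/toAlgW=> s; elim/toAlgW=> t; rewrite [_ + _]addE !scaleE [_ + _]addE.
exact/toAlgP/cong_mulDr.
Qed.

Let scaleDl (x : presAlg) : {morph scale^~ x : a b / a + b}.
Proof.
move=> a b; elim/toAlgW: x => s; rewrite !scaleE [RHS]addE; apply/toAlgP.
apply: cong_trans (cong_mulDl _ _ _ _).
by apply: cong_mul; [apply: cong_constD|apply: cong_refl].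
Qed.

HB.instance Definition _ := GRing.Zmodule_isLmodule.Build F presAlg
  scaleA scale1 scaleDr scaleDl.

Let scaleAl (c : F) (x y : presAlg) : c *: (x * y) = (c *: x) * y.
Proof.
elim/toAlgW: x => s; elim/toAlgW: y => t.
rewrite [_ * _]mulE [LHS]scaleE [_ *: _]scaleE [RHS]mulE.
exact/toAlgP/cong_mulA.
Qed.

HB.instance Definition _ := GRing.Lmodule_isLalgebra.Build F presAlg scaleAl.

Let scaleAr (c : F) (x y : presAlg) : c *: (x * y) = x * (c *: y).
Proof.
elim/toAlgW: x => s; elim/toAlgW: y => t.
rewrite [_ * _]mulE [LHS]scaleE [_ *: _]scaleE [RHS]mulE; apply/toAlgP.
apply: cong_trans (cong_mulA _ _ _ _) _; apply: cong_trans (cong_sym (cong_mulA _ _ _ _)).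
by apply: cong_mul; [apply: cong_constC|apply: cong_refl].
Qed.

HB.instance Definition _ := GRing.Lalgebra_isAlgebra.Build F presAlg scaleAr.

Definition agen (x : gens P) : presAlg := toAlg (Var x).

Lemma toAlg_eval t : toAlg t = eval agen t.
Proof.
elim: t => //= [c|s <- t <-|s <- t <-].
- by rewrite [RHS]scaleE constC -mulE mul1.
- by rewrite [RHS]addE.
- by rewrite [RHS]mulE.
Qed.

Lemma agen_rels s t : rels s t -> eval agen s = eval agen t.
Proof. by move=> st; rewrite -!toAlg_eval; apply/toAlgP/cong_rel. Qed.

End PresentedAlgebra.

Section PresentedBimodule.
Variables (F : comNzRingType) (A : algType F) (X : Type).

Inductive bterm : Type :=
| BZero
| BVar of X
| BAdd of bterm & bterm
| BLmul of A & bterm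
| BRmul of bterm & A.

HB.instance Definition _ := gen_eqMixin bterm.
HB.instance Definition _ := gen_choiceMixin bterm.

Variable rel : bterm -> bterm -> Prop.

(* The quotient by bcong is the A-bimodule (with the two actions of the scalars
   F agreeing) presented by the generators X and the relations rel. *)
Inductive bcong : bterm -> bterm -> Prop :=
| bcong_refl u : bcong u u
| bcong_sym u v : bcong u v -> bcong v u
| bcong_trans u v w : bcong u v -> bcong v w -> bcong u w
| bcong_add u u' v v' : bcong u u' -> bcong v v' -> bcong (BAdd u v) (BAdd u' v')
| bcong_lmul f u u' : bcong u u' -> bcong (BLmul f u) (BLmul f u')
| bcong_rmul f u u' : bcong u u' -> bcong (BRmul u f) (BRmul u' f)
| bcong_addA u v w : bcong (BAdd u (BAdd v w)) (BAdd (BAdd u v) w)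
| bcong_addC u v : bcong (BAdd u v) (BAdd v u)
| bcong_add0 u : bcong (BAdd BZero u) u
| bcong_addN u : bcong (BAdd (BLmul (- 1) u) u) BZero
| bcong_lmulM f g u : bcong (BLmul f (BLmul g u)) (BLmul (f * g) u)
| bcong_lmul1 u : bcong (BLmul 1 u) u
| bcong_lmulDr f u v : bcong (BLmul f (BAdd u v)) (BAdd (BLmul f u) (BLmul f v))
| bcong_lmulDl f g u : bcong (BLmul (f + g) u) (BAdd (BLmul f u) (BLmul g u))
| bcong_rmulM f g u : bcong (BRmul (BRmul u f) g) (BRmul u (f * g))
| bcong_rmul1 u : bcong (BRmul u 1) u
| bcong_rmulDl f u v : bcong (BRmul (BAdd u v) f) (BAdd (BRmul u f) (BRmul v f))
| bcong_rmulDr f g u : bcong (BRmul u (f + g)) (BAdd (BRmul u f) (BRmul u g))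
| bcong_lrmul f g u : bcong (BLmul f (BRmul u g)) (BRmul (BLmul f u) g)
| bcong_scalar (c : F) u : bcong (BLmul c%:A u) (BRmul u c%:A)
| bcong_rel u v : rel u v -> bcong u v.

Definition bcongb : ssrbool.rel bterm := fun u v => `[< bcong u v >].

Let bcongb_refl : reflexive bcongb.
Proof. by move=> u; apply/asboolP; apply: bcong_refl. Qed.

Let bcongb_sym : symmetric bcongb.
Proof. by move=> u v; apply/asboolP/asboolP; apply: bcong_sym. Qed.

Let bcongb_trans : transitive bcongb.
Proof.
move=> v u w /asboolP uv /asboolP vw; apply/asboolP; exact: bcong_trans uv vw.
Qed.

Canonical bcongb_equiv := EquivRel bcongb bcongb_refl bcongb_sym bcongb_trans.

Definition presBimod := {eq_quot bcongb_equiv}.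
HB.instance Definition _ := Choice.on presBimod.
HB.instance Definition _ := EqQuotient.on presBimod.

Definition toBimod (u : bterm) : presBimod := \pi_presBimod u.

Lemma toBimodP u v : toBimod u = toBimod v <-> bcong u v.
Proof. by split=> [/eqquotP/asboolP | uv]; last apply/eqquotP/asboolP. Qed.

Lemma toBimod_repr (x : presBimod) : toBimod (repr x) = x.
Proof. exact: reprK. Qed.

Lemma repr_toBimod u : bcong (repr (toBimod u)) u.
Proof. by apply/toBimodP; rewrite toBimod_repr. Qed.

Let add (x y : presBimod) := toBimod (BAdd (repr x) (repr y)).
Let lmul (f : A) (x : presBimod) := toBimod (BLmul f (repr x)).
Definition rmul (x : presBimod) (f : A) := toBimod (BRmul (repr x) f).
Let opp := lmul (- 1).

Let addE u v : add (toBimod u) (toBimod v) = toBimod (BAdd u v).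
Proof. by apply/toBimodP/bcong_add; apply: repr_toBimod. Qed.

Let lmulE f u : lmul f (toBimod u) = toBimod (BLmul f u).
Proof. by apply/toBimodP/bcong_lmul; apply: repr_toBimod. Qed.

Lemma rmulE f u : rmul (toBimod u) f = toBimod (BRmul u f).
Proof. by apply/toBimodP/bcong_rmul; apply: repr_toBimod. Qed.

Let toBimodW (Q : presBimod -> Prop) : (forall u, Q (toBimod u)) -> forall x, Q x.
Proof. by move=> Qu x; rewrite -[x]toBimod_repr. Qed.

Let addA : associative add.
Proof.
elim/toBimodW=> u; elim/toBimodW=> v; elim/toBimodW=> w; rewrite !addE.
exact/toBimodP/bcong_addA.
Qed.

Let addC : commutative add.
Proof.
by elim/toBimodW=> u; elim/toBimodW=> v; rewrite !addE; apply/toBimodP/bcong_addC.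
Qed.

Let add0 : left_id (toBimod BZero) add.
Proof. by elim/toBimodW=> u; rewrite addE; apply/toBimodP/bcong_add0. Qed.

Let addN : left_inverse (toBimod BZero) opp add.
Proof. by elim/toBimodW=> u; rewrite /opp lmulE addE; apply/toBimodP/bcong_addN. Qed.

HB.instance Definition _ := GRing.isZmodule.Build presBimod addA addC add0 addN.

Let lmulA f g (x : presBimod) : lmul f (lmul g x) = lmul (f * g) x.
Proof. by elim/toBimodW: x => u; rewrite !lmulE; apply/toBimodP/bcong_lmulM. Qed.

Let lmul1 : left_id 1 lmul.
Proof. by elim/toBimodW=> u; rewrite lmulE; apply/toBimodP/bcong_lmul1. Qed.

Let lmulDr : right_distributive lmul +%R.
Proof.
move=> f; elim/toBimodW=> u; elim/toBimodW=> v; rewrite [_ + _]addE !lmulE [RHS]addE.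
exact/toBimodP/bcong_lmulDr.
Qed.

Let lmulDl (x : presBimod) : {morph lmul^~ x : f g / f + g}.
Proof.
move=> f g; elim/toBimodW: x => u; rewrite !lmulE [RHS]addE.
exact/toBimodP/bcong_lmulDl.
Qed.

HB.instance Definition _ := GRing.Zmodule_isLmodule.Build A presBimod
  lmulA lmul1 lmulDr lmulDl.

Definition bgen (x : X) : presBimod := toBimod (BVar x).

Lemma toBimod0 : toBimod BZero = 0. Proof. by []. Qed.

Lemma toBimodD u v : toBimod (BAdd u v) = toBimod u + toBimod v.
Proof. by rewrite [RHS]addE. Qed.

Lemma toBimodZ f u : toBimod (BLmul f u) = f *: toBimod u.
Proof. by rewrite [RHS]lmulE. Qed.

Lemma rmulM (x : presBimod) f g : rmul (rmul x f) g = rmul x (f * g).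
Proof. by elim/toBimodW: x => u; rewrite !rmulE; apply/toBimodP/bcong_rmulM. Qed.

Lemma rmul1 (x : presBimod) : rmul x 1 = x.
Proof. by elim/toBimodW: x => u; rewrite rmulE; apply/toBimodP/bcong_rmul1. Qed.

Lemma rmulDl (x y : presBimod) f : rmul (x + y) f = rmul x f + rmul y f.
Proof.
elim/toBimodW: x => u; elim/toBimodW: y => v; rewrite -toBimodD !rmulE -toBimodD.
exact/toBimodP/bcong_rmulDl.
Qed.

Lemma rmulDr (x : presBimod) f g : rmul x (f + g) = rmul x f + rmul x g.
Proof.
elim/toBimodW: x => u; rewrite !rmulE -toBimodD; exact/toBimodP/bcong_rmulDr.
Qed.

Lemma scale_rmul f (x : presBimod) g : f *: rmul x g = rmul (f *: x) g.
Proof.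
elim/toBimodW: x => u; rewrite rmulE -!toBimodZ rmulE; exact/toBimodP/bcong_lrmul.
Qed.

Lemma scalar_rmul (c : F) (x : presBimod) : c%:A *: x = rmul x c%:A.
Proof.
elim/toBimodW: x => u; rewrite -toBimodZ rmulE; exact/toBimodP/bcong_scalar.
Qed.

Lemma bgen_rel u v : rel u v -> toBimod u = toBimod v.
Proof. by move=> uv; apply/toBimodP/bcong_rel. Qed.

End PresentedBimodule.
Arguments BZero {F A X}.
Arguments BVar {F A X}.

Section QuantumMatrices.
Variables (R : realType) (n : nat) (q : R).
Local Notation C := R[i].
Local Notation qC := (q%:C)%C.

(* Indices run over 0..n-1 instead of 1..n; z a alpha is z_a^alpha. *)
Local Notation Z a alpha := (Var (a, alpha)).

Inductive qmat_rel : aterm C ('I_n * 'I_n) -> aterm C ('I_n * 'I_n) -> Prop :=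
| qmat_q (a b alpha beta : 'I_n) :
    (a = b /\ (alpha < beta)%N) \/ ((a < b)%N /\ alpha = beta) ->
    qmat_rel (Z a alpha * Z b beta) (qC *: (Z b beta * Z a alpha))
| qmat_comm (a b alpha beta : 'I_n) : (a < b)%N -> (beta < alpha)%N ->
    qmat_rel (Z a alpha * Z b beta) (Z b beta * Z a alpha)
| qmat_cross (a b alpha beta : 'I_n) : (a < b)%N -> (alpha < beta)%N ->
    qmat_rel (Z a alpha * Z b beta)
             (Z b beta * Z a alpha + (qC - qC^-1) *: (Z a beta * Z b alpha)).

Let qmat_aug (p : 'I_n * 'I_n) : C^o := 0.

Let qmat_aug_rel s t : qmat_rel s t -> eval qmat_aug s = eval qmat_aug t.
Proof. by case=> *; rewrite /= !(mul0r, mulr0) ?addr0. Qed.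

Definition qmat : algType C := presAlg (Presentation qmat_aug_rel).

Definition z (a alpha : 'I_n) : qmat :=
  @agen _ (Presentation qmat_aug_rel) (a, alpha).

(* The length of a permutation is its number of inversions. *)
Definition inversions k (s : 'S_k) : nat :=
  #|[set p : 'I_k * 'I_k | (p.1 < p.2)%N && (s p.2 < s p.1)%N]|.

(* The q-minor with rows a_0 < a_1 < ... and columns alpha_0 < alpha_1 < ... *)
Definition qminor k (a alpha : 'I_k -> 'I_n) : qmat :=
  \sum_(s : 'S_k) (- qC) ^+ inversions s *: \prod_(i < k) z (a i) (alpha (s i)).

(* i |-> n - j - 1 + i, the increasing enumeration of the j.+1 last indices. *)
Definition last_indices (j : 'I_n) (i : 'I_j.+1) : 'I_n :=
  rev_ord (widen_ord (ltn_ord j) (rev_ord i)).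

(* nth 0 k n = 0, so the exponent of the last factor is k_n. *)
Definition lowest_vector (k : n.-tuple nat) : qmat :=
  \prod_(j < n)
    qminor (@last_indices j) (@last_indices j) ^+ (nth 0%N k j - nth 0%N k j.+1).

(* Rmat b a b' a' is R_{ba}^{b'a'}. *)
Definition Rmat (b a b' a' : 'I_n) : C :=
  if [&& a == b, a == a' & b == b'] then qC^-1
  else if [&& a != b, a == a' & b == b'] then 1
  else if [&& (a < b)%N, a == b' & b == a'] then qC^-1 - qC
  else 0.

Inductive Omega1_rel : bterm qmat ('I_n * 'I_n) -> bterm qmat ('I_n * 'I_n) -> Prop :=
| Omega1_comm (a b alpha beta : 'I_n) :
    Omega1_rel (BLmul (z b beta) (BVar (a, alpha)))
      (\big[@BAdd _ _ _/BZero]_(p : ('I_n * 'I_n) * ('I_n * 'I_n))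
        let: ((a', alpha'), (b', beta')) := p in
        BLmul (Rmat beta alpha beta' alpha' * Rmat b a b' a')%:A
          (BRmul (BVar (a', alpha')) (z b' beta'))).

(* Omega1 carries the left action as lmodType structure over qmat, and the right
   action as rmul. *)
Definition Omega1 : lmodType qmat := presBimod Omega1_rel.

Definition dz (a alpha : 'I_n) : Omega1 := bgen Omega1_rel (a, alpha).

Record is_differential (d : qmat -> Omega1) : Prop := {
  differentialD : forall f g, d (f + g) = d f + d g;
  differentialZ : forall (c : C) f, d (c *: f) = (c%:A : qmat) *: d f;
  differentialM : forall f g, d (f * g) = rmul (d f) g + f *: d g;
  differential_z : forall a alpha, d (z a alpha) = dz a alpha
}.

Definition are_q_derivatives (d : qmat -> Omega1)
    (partial : 'I_n -> 'I_n -> qmat -> qmat) : Prop :=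
  forall f, d f = \sum_a \sum_alpha partial a alpha f *: dz a alpha.

End QuantumMatrices.

Inductive Uq_gen (r : nat) : Type :=
| gE of 'I_r | gF of 'I_r | gK of 'I_r | gKinv of 'I_r.
Arguments gE {r}.
Arguments gF {r}.
Arguments gK {r}.
Arguments gKinv {r}.

Definition adjacent r (i j : 'I_r) : bool := (i.+1 == j) || (j.+1 == i).

Definition cartan_A r (i j : 'I_r) : int :=
  if i == j then 2 else if adjacent i j then -1 else 0.

(* U_q sl_(r+1); the generators are numbered 0..r-1 instead of 1..r. *)
Section QuantumGroup.
Variables (R : realType) (r : nat) (q : R).
Local Notation C := R[i].
Local Notation qC := (q%:C)%C.
Local Notation vE i := (Var (gE i)).
Local Notation vF i := (Var (gF i)).
Local Notation vK i := (Var (gK i)).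
Local Notation vKinv i := (Var (gKinv i)).

Inductive Uq_rel : aterm C (Uq_gen r) -> aterm C (Uq_gen r) -> Prop :=
| Uq_KK i j : Uq_rel (vK i * vK j) (vK j * vK i)
| Uq_KKinv i : Uq_rel (vK i * vKinv i) 1
| Uq_KinvK i : Uq_rel (vKinv i * vK i) 1
| Uq_KE i j : Uq_rel (vK i * vE j) (qC ^ cartan_A i j *: (vE j * vK i))
| Uq_KF i j : Uq_rel (vK i * vF j) (qC ^ (- cartan_A i j) *: (vF j * vK i))
| Uq_EF i j : Uq_rel (vE i * vF j - vF j * vE i)
    (((i == j)%:R / (qC - qC^-1)) *: (vK i - vKinv i))
| Uq_serreE i j : adjacent i j ->
    Uq_rel (vE i * vE i * vE j - (qC + qC^-1) *: (vE i * vE j * vE i)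
            + vE j * vE i * vE i) 0
| Uq_serreF i j : adjacent i j ->
    Uq_rel (vF i * vF i * vF j - (qC + qC^-1) *: (vF i * vF j * vF i)
            + vF j * vF i * vF i) 0
| Uq_EE i j : ~~ adjacent i j -> Uq_rel (vE i * vE j) (vE j * vE i)
| Uq_FF i j : ~~ adjacent i j -> Uq_rel (vF i * vF j) (vF j * vF i).

Definition Uq_counit_gen (x : Uq_gen r) : C^o :=
  match x with gE _ | gF _ => 0 | gK _ | gKinv _ => 1 end.

Lemma Uq_counit_rel s t :
  Uq_rel s t -> eval Uq_counit_gen s = eval Uq_counit_gen t.
Proof.
case=> * /=; rewrite ?scale1r ?scale0r ?(mul0r, mulr0, mul1r, mulr1, addr0) //.
by rewrite scaleN1r subrr [_ * 0]mulr0.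
Qed.

Definition Uq_pres := Presentation Uq_counit_rel.
Definition Uq : algType C := presAlg Uq_pres.

Definition E i : Uq := @agen _ Uq_pres (gE i).
Definition F i : Uq := @agen _ Uq_pres (gF i).
Definition K i : Uq := @agen _ Uq_pres (gK i).
Definition Kinv i : Uq := @agen _ Uq_pres (gKinv i).

Definition counit (xi : Uq) : C := eval Uq_counit_gen (repr (xi : presAlg Uq_pres)).

Lemma counit_toAlg (t : aterm C (gens Uq_pres)) :
  counit (toAlg t) = eval Uq_counit_gen t.
Proof. exact: eval_cong Uq_counit_rel _ _ (repr_toAlg t). Qed.

(* coproduct xi s says that Delta(xi) is the sum of the p.1 (x) p.2, p in s: the
   algebra morphism Delta is given by its values on generators. *)
Inductive coproduct : Uq -> seq (Uq * Uq) -> Prop :=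
| coproduct_E i : coproduct (E i) [:: (E i, 1); (K i, E i)]
| coproduct_F i : coproduct (F i) [:: (F i, Kinv i); (1, F i)]
| coproduct_K i : coproduct (K i) [:: (K i, K i)]
| coproduct_Kinv i : coproduct (Kinv i) [:: (Kinv i, Kinv i)]
| coproduct_1 : coproduct 1 [:: (1, 1)]
| coproduct_D xi eta s t : coproduct xi s -> coproduct eta t ->
    coproduct (xi + eta) (s ++ t)
| coproduct_Z (c : C) xi s : coproduct xi s ->
    coproduct (c *: xi) [seq (c *: p.1, p.2) | p <- s]
| coproduct_M xi eta s t : coproduct xi s -> coproduct eta t ->
    coproduct (xi * eta) [seq (p.1 * p'.1, p.2 * p'.2) | p <- s, p' <- t].

Definition is_action (V : lmodType C) (act : {bilinear Uq -> V -> V}) : Prop :=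
  (forall v, act 1 v = v) /\
  (forall xi eta v, act (xi * eta) v = act xi (act eta v)).

Definition is_module_algebra (A : algType C) (act : {bilinear Uq -> A -> A}) : Prop :=
  [/\ is_action act,
      forall xi, act xi 1 = counit xi *: 1 &
      forall xi s f g, coproduct xi s ->
        act xi (f * g) = \sum_(p <- s) act p.1 f * act p.2 g].

End QuantumGroup.

(* The antilinear antimultiplicative extension of a map on generators. *)
Fixpoint anti_eval (C : numClosedFieldType) (X : Type) (B : algType C) (g : X -> B)
    (t : aterm C X) : B :=
  match t with
  | Var x => g x
  | Const c => (Num.conj c)%:A
  | Add s t => anti_eval g s + anti_eval g t
  | Mul s t => anti_eval g t * anti_eval g s
  end.

Lemma anti_eval_cong (C : numClosedFieldType) (X : Type)
    (rel : aterm C X -> aterm C X -> Prop) (B : algType C) (g : X -> B) :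
  (forall s t, rel s t -> anti_eval g s = anti_eval g t) ->
  forall s t, cong rel s t -> anti_eval g s = anti_eval g t.
Proof.
move=> grel s t; elim=> //=.
- by move=> {}s {}t u _ -> _ ->.
- by move=> {}s s' {}t t' _ -> _ ->.
- by move=> {}s s' {}t t' _ -> _ ->.
- by move=> *; rewrite addrA.
- by move=> *; rewrite addrC.
- by move=> *; rewrite rmorph0 scale0r add0r.
- by move=> *; rewrite rmorphN1 rmorph0 scaleN1r mulrN1 scale0r addNr.
- by move=> *; rewrite mulrA.
- by move=> *; rewrite rmorph1 scale1r mulr1.
- by move=> *; rewrite mulrDr.
- by move=> *; rewrite mulrDl.
- by move=> *; rewrite rmorphD scalerDl.
- by move=> *; rewrite rmorphM mulrC -scalerAl mul1r scalerA.
- by move=> *; rewrite mulr_algl mulr_algr.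
Qed.

(* The generator with number n in 1..2n-1 has index n.-1 in 'I_(2 * n).-1. *)
Section Involution.
Variables (R : realType) (n : nat) (q : R).
Local Notation C := R[i].
Local Notation qC := (q%:C)%C.
Local Notation r := (2 * n).-1.
Local Notation U := (Uq r q).

Definition star_gen (x : Uq_gen r) : U :=
  match x with
  | gE j => if j.+1 == n then - (K q j * F q j) else K q j * F q j
  | gF j => if j.+1 == n then - (E q j * Kinv q j) else E q j * Kinv q j
  | gK j => K q j
  | gKinv j => Kinv q j
  end.

Arguments star_gen : simpl never.

Definition star (xi : U) : U := anti_eval star_gen (repr (xi : presAlg (Uq_pres r q))).

Section StarWellDefined.
Hypothesis q_gt0 : 0 < q.
Local Notation sg j := ((-1) ^+ (j.+1 == n) : C).
Local Notation K := (K q).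
Local Notation F := (F q).
Local Notation E := (E q).
Local Notation Kinv := (Kinv q).
Local Notation a := cartan_A.

Let star_genE j : star_gen (gE j) = sg j *: (K j * F j).
Proof. by rewrite /star_gen; case: ifP; rewrite ?scaleN1r ?scale1r. Qed.

Let star_genF j : star_gen (gF j) = sg j *: (E j * Kinv j).
Proof. by rewrite /star_gen; case: ifP; rewrite ?scaleN1r ?scale1r. Qed.

Let qC_neq0 : qC != 0.
Proof. by rewrite eq_complex /= gt_eqF. Qed.

Let conj_q : Num.conj qC = qC.
Proof. by apply/conj_Creal; rewrite complex_real. Qed.

Let conj_qX (m : int) : Num.conj (qC ^ m) = qC ^ m.
Proof. by have := fmorphXz (Num.conj : {rmorphism C -> C}) m qC; rewrite /= conj_q. Qed.

Let rels (s t : aterm C (Uq_gen r)) (st : Uq_rel q s t) :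
  eval (@agen _ (Uq_pres r q)) s = eval (@agen _ (Uq_pres r q)) t.
Proof. exact: agen_rels. Qed.

Let relKK (i j : 'I_r) : K i * K j = K j * K i. Proof. exact: (rels (Uq_KK q i j)). Qed.

Let relKKinv (i : 'I_r) : K i * Kinv i = 1.
Proof. by have := rels (Uq_KKinv q i); rewrite /= scale1r. Qed.

Let relKinvK (i : 'I_r) : Kinv i * K i = 1.
Proof. by have := rels (Uq_KinvK q i); rewrite /= scale1r. Qed.

Let relKE (i j : 'I_r) : K i * E j = qC ^ a i j *: (E j * K i).
Proof. by have := rels (Uq_KE q i j); rewrite /= mulr_algl. Qed.

Let relFK (i j : 'I_r) : F j * K i = qC ^ a i j *: (K i * F j).
Proof.
have := rels (Uq_KF q i j); rewrite /= mulr_algl -/(K i) -/(F j) => ->.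
by rewrite scalerA -expfzDr // subrr expr0z scale1r.
Qed.

Let relEK (i j : 'I_r) : E j * Kinv i = qC ^ a i j *: (Kinv i * E j).
Proof.
rewrite -[LHS]mul1r -(relKinvK i) -mulrA (mulrA (K i)) relKE -scalerAl -mulrA.
by rewrite relKKinv mulr1 scalerAr.
Qed.

Let relKF (i j : 'I_r) : F j * Kinv i = qC ^ (- a i j) *: (Kinv i * F j).
Proof.
rewrite -[LHS]mul1r -(relKinvK i) -mulrA (mulrA (K i)).
have := rels (Uq_KF q i j); rewrite /= mulr_algl -/(K i) -/(F j) => ->.
by rewrite -scalerAl -mulrA relKKinv mulr1 scalerAr.
Qed.

Let relKinvKinv (i j : 'I_r) : Kinv i * Kinv j = Kinv j * Kinv i.
Proof.
rewrite -[LHS]mulr1 -(relKKinv i) -[X in _ * (X * _)]mulr1 -(relKKinv j).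
by rewrite -!mulrA (mulrA (K i)) relKK !mulrA -(mulrA (Kinv i)) relKinvK mulr1
  relKinvK mul1r.
Qed.

Let relKKinvC (i j : 'I_r) : K i * Kinv j = Kinv j * K i.
Proof.
rewrite -[LHS]mul1r -(relKinvK j) -!mulrA (mulrA (K j)) relKK.
by rewrite -!mulrA relKKinv mulr1.
Qed.

Let aC (i j : 'I_r) : a i j = a j i :> int.
Proof. by rewrite /cartan_A /adjacent eq_sym orbC. Qed.

Let PQ3 (P Q : 'I_r -> U) (c : 'I_r -> 'I_r -> C) :
  (forall i j, Q i * P j = c i j *: (P j * Q i)) ->
  forall i j k, P i * Q i * (P j * Q j) * (P k * Q k) =
    (c i j * c i k * c j k) *: (P i * P j * P k * (Q i * Q j * Q k)).
Proof.
move=> PQ i j k.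
have step x y x' y' j' : (x * Q y) * (P j' * (x' : U)) * (y' : U) =
    c y j' *: (x * P j' * (Q y * x' * y')).
  by rewrite -!mulrA (mulrA (Q y)) PQ -!scalerAl -!scalerAr !mulrA.
rewrite step.
have -> : Q i * Q j * (P k * Q k) = (c i k * c j k) *: (P k * (Q i * Q j * Q k)).
  rewrite -!mulrA (mulrA (Q j)) PQ -!scalerAl -!scalerAr !mulrA PQ.
  by rewrite -!scalerAl scalerA mulrC.
by rewrite -!scalerAr scalerA !mulrA.
Qed.

Let serre_star (P Q : 'I_r -> U) (c : 'I_r -> 'I_r -> C) i j d :
  (forall i j, c i j = c j i) ->
  (forall i j, Q i * P j = c i j *: (P j * Q i)) ->
  P j * P i * P i * (Q j * Q i * Q i) - d *: (P i * P j * P i * (Q i * Q j * Q i))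
    + P i * P i * P j * (Q i * Q i * Q j) = 0 ->
  P j * Q j * (P i * Q i * (P i * Q i)) - d *: (P i * Q i * (P j * Q j * (P i * Q i)))
    + P i * Q i * (P i * Q i * (P j * Q j)) = 0.
Proof.
move=> cC PQ serre.
have PQ3r k l m : P k * Q k * (P l * Q l * (P m * Q m)) =
    (c k l * c k m * c l m) *: (P k * P l * P m * (Q k * Q l * Q m)).
  by rewrite -(PQ3 PQ) mulrA.
rewrite !PQ3r (cC j i) (mulrAC (c i j) (c i i)).
have -> : c i i * c i j * c i j = c i j * c i j * c i i by rewrite -mulrA mulrC.
rewrite [d *: _]scalerA (mulrC d) -[_ *: _ in X in _ - X]scalerA.
by rewrite -scalerBr -scalerDr serre scaler0.
Qed.

Let signed_comm (P Q : 'I_r -> U) (c : 'I_r -> 'I_r -> C) :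
  (forall i j, Q i * P j = c i j *: (P j * Q i)) ->
  forall i j : 'I_r, Q i * (sg j *: P j) = c i j *: ((sg j *: P j) * Q i).
Proof. by move=> PQ i j; rewrite -scalerAl -scalerAr PQ !scalerA mulrC. Qed.

Let comm_star (P Q : 'I_r -> U) (c : 'I_r -> 'I_r -> C) i j :
  c i j = c j i -> (forall i j, Q i * P j = c i j *: (P j * Q i)) ->
  P i * P j = P j * P i -> Q i * Q j = Q j * Q i ->
  P j * Q j * (P i * Q i) = P i * Q i * (P j * Q j).
Proof.
move=> cC PQ PC QC.
have PQ2 k l : P k * Q k * (P l * Q l) = c k l *: (P k * P l * (Q k * Q l)).
  by rewrite -!mulrA (mulrA (Q k)) PQ -!scalerAl -!scalerAr !mulrA.
by rewrite !PQ2 cC PC QC.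
Qed.

Let scaled3 (c d e : C) (x y w : U) :
  (c *: x) * (d *: y) * (e *: w) = (c * d * e) *: (x * y * w).
Proof.
have scaled2 (b b' : C) (u v : U) : (b *: u) * (b' *: v) = (b * b') *: (u * v).
  by rewrite -scalerAl -scalerAr scalerA.
by rewrite !scaled2.
Qed.

Let star_rel s t : Uq_rel q s t -> anti_eval star_gen s = anti_eval star_gen t.
Proof.
have KinvE (i j : 'I_r) : Kinv i * E j = qC ^ (- a i j) *: (E j * Kinv i).
  by rewrite relEK scalerA -expfzDr // addNr expr0z scale1r.
have X2 := signed_comm (fun i j => relFK j i).
have Y2 := signed_comm KinvE.
have KKK (i j k : 'I_r) : K i * K j * K k = K j * K i * K k by rewrite (relKK i).
have KKK' (i j k : 'I_r) : K i * K j * K k = K i * K k * K j.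
  by rewrite -mulrA (relKK j) mulrA.
have LLL (i j k : 'I_r) : Kinv i * Kinv j * Kinv k = Kinv j * Kinv i * Kinv k.
  by rewrite (relKinvKinv i).
have LLL' (i j k : 'I_r) : Kinv i * Kinv j * Kinv k = Kinv i * Kinv k * Kinv j.
  by rewrite -mulrA (relKinvKinv j) mulrA.
have s1 i j : sg i * sg j * sg i = sg j * sg i * sg i by rewrite (mulrC (sg i)).
have s2 i j : sg i * sg i * sg j = sg j * sg i * sg i by rewrite mulrC mulrA.
have finr (w d : C) (k x y v : U) : x - d *: y + v = 0 ->
    w *: k * x - d *: (w *: k * y) + w *: k * v = 0.
  by rewrite [d *: (_ * _)]scalerAr -mulrBr -mulrDr => ->; rewrite mulr0.
have finl (w d : C) (k x y v : U) : x - d *: y + v = 0 ->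
    w *: x * k - d *: (w *: y * k) + w *: v * k = 0.
  rewrite scalerAl (scalerA d) (mulrC d) -scalerA -mulrBl -scalerBr -mulrDl -scalerDr.
  by move=> ->; rewrite scaler0 mul0r.
have swap (x y v : U) : x - y + v = v - y + x by rewrite addrC addrA addrAC.
have conj_a : Num.conj (qC + qC^-1) = qC + qC^-1.
  by rewrite rmorphD /= fmorphV /= conj_q.
case=> [i j|i|i|i j|i j|i j|i j adj|i j adj|i j nadj|i j nadj];
  rewrite [LHS]/= [RHS]/= ?(star_genE, star_genF).
- exact: relKK.
- by rewrite rmorph1 scale1r relKinvK.
- by rewrite rmorph1 scale1r relKKinv.
- rewrite conj_qX mulr_algr -scalerAl -scalerAr scalerA mulrC -scalerA; congr (_ *: _).
  by rewrite -mulrA relFK -scalerAr !mulrA relKK.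
- rewrite conj_qX mulr_algr -scalerAl -scalerAr scalerA mulrC -scalerA; congr (_ *: _).
  by rewrite mulrA relKE -scalerAl scalerA -expfzDr // addNr expr0z scale1r -!mulrA relKKinvC.
- rewrite rmorphN1 scaleN1r !mulrN1 mulr_algr rmorphM rmorph_nat fmorphV rmorphB /=.
  rewrite fmorphV /= conj_q.
  have EF : E j * Kinv j * (K i * F i) - K i * F i * (E j * Kinv j) =
      K i * (E j * F i - F i * E j) * Kinv j.
    rewrite mulrBr mulrBl !mulrA relKE -!scalerAl -[X in _ *: X - _]mulrA relKF.
    rewrite -scalerAr scalerA -expfzDr // aC subrr expr0z scale1r.
    by rewrite -!mulrA (mulrA (Kinv j)) -relKKinvC !mulrA.
  rewrite -!scalerAl -!scalerAr !scalerA [sg j * _]mulrC -scalerBr EF.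
  have := rels (Uq_EF q j i); rewrite /= scaleN1r !mulN1r mulr_algl.
  rewrite -/(E j) -/(F i) -/(K j) -/(Kinv j) eq_sym => ->.
  case: (eqVneq i j) => [<-|_]; last by rewrite mul0r !scale0r mulr0 mul0r scaler0.
  rewrite -expr2 sqrr_sign scale1r -scalerAr -scalerAl mulrBr mulrBl.
  by rewrite -mulrA relKKinv mulr1 (mul1r (Kinv i)).
- rewrite rmorph0 scale0r rmorphN1 scaleN1r mulrN1 mulr_algr conj_a.
  rewrite !(scalerAl (sg j)) !(scalerAl (sg i)).
  apply: (serre_star (P := fun k => sg k *: K k) (Q := F) (c := fun k l => qC ^ a l k)) => [k l||];
    [by rewrite aC|exact: X2|].
  have := rels (Uq_serreF q adj); rewrite /= scale0r scaleN1r mulN1r mulr_algl.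
  rewrite -/(F i) -/(F j) => serreF.
  rewrite !scaled3 (s1 i j) (s2 i j) (KKK i j i) (KKK' i i j) (KKK i j i).
  by apply: finr; rewrite swap.
- rewrite rmorph0 scale0r rmorphN1 scaleN1r mulrN1 mulr_algr conj_a.
  rewrite !(scalerAl (sg j)) !(scalerAl (sg i)).
  apply: (serre_star (P := fun k => sg k *: E k) (Q := Kinv) (c := fun k l => qC ^ (- a k l))) => [k l||];
    [by rewrite aC|exact: Y2|].
  have := rels (Uq_serreE q adj); rewrite /= scale0r scaleN1r mulN1r mulr_algl.
  rewrite -/(E i) -/(E j) => serreE.
  rewrite !scaled3 (s1 i j) (s2 i j) (LLL i j i) (LLL' i i j) (LLL i j i).
  by apply: finl; rewrite swap.
- rewrite !scalerAl; apply: (comm_star (P := fun k => sg k *: K k) (Q := F) (c := fun k l => qC ^ a l k)).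
  + by rewrite aC.
  + exact: X2.
  + by rewrite -!scalerAl -!scalerAr !scalerA relKK mulrC.
  + by have := rels (Uq_FF q nadj).
- rewrite !scalerAl; apply: (comm_star (P := fun k => sg k *: E k) (Q := Kinv) (c := fun k l => qC ^ (- a k l))).
  + by rewrite aC.
  + exact: Y2.
  + rewrite -!scalerAl -!scalerAr !scalerA mulrC; congr (_ *: _).
    by have := rels (Uq_EE q nadj).
  + exact: relKinvKinv.
Qed.

Lemma star_toAlg (t : aterm C (Uq_gen r)) :
  star (toAlg (t : aterm C (gens (Uq_pres r q)))) = anti_eval star_gen t.
Proof. exact: anti_eval_cong star_rel _ _ (repr_toAlg (P := Uq_pres r q) t). Qed.

Let reprK (x : U) : x = eval (@agen _ (Uq_pres r q)) (repr (x : presAlg (Uq_pres r q))).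
Proof. by rewrite -toAlg_eval toAlg_repr. Qed.

Let star_eval (x : U) t : x = eval (@agen _ (Uq_pres r q)) t ->
  star x = anti_eval star_gen t.
Proof. by move=> ->; rewrite -star_toAlg -toAlg_eval. Qed.

Lemma starD (x y : U) : star (x + y) = star x + star y.
Proof.
apply: (star_eval (t := repr x + repr y)%aterm) => /=.
by congr (_ + _); apply: reprK.
Qed.

Lemma starM (x y : U) : star (x * y) = star y * star x.
Proof.
apply: (star_eval (t := repr x * repr y)%aterm) => /=.
by congr (_ * _); apply: reprK.
Qed.

Lemma starZ (c : C) (x : U) : star (c *: x) = Num.conj c *: star x.
Proof.
rewrite -[RHS]mulr_algr; apply: (star_eval (t := c *: repr x)%aterm).
by rewrite /= mulr_algl; congr (_ *: _); apply: reprK.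
Qed.

Lemma star1 : star 1 = 1.
Proof.
by rewrite (star_eval (x := 1) (t := 1%aterm)) /= ?rmorph1 scale1r.
Qed.

Lemma star_agen (x : Uq_gen r) : star (@agen _ (Uq_pres r q) x) = star_gen x.
Proof. exact: (star_toAlg (Var x)). Qed.

End StarWellDefined.
End Involution.

Section Actions.
Variables (R : realType) (n : nat) (n_gt0 : (0 < n)%N) (q : R).
Local Notation C := R[i].
Local Notation qC := (q%:C)%C.
Local Notation A := (qmat n q).
Local Notation U := (Uq (2 * n).-1 q).
Local Notation z := (z q).
Local Notation E := (E q).
Local Notation F := (F q).
Local Notation K := (K q).
Local Notation Kinv := (Kinv q).
Implicit Types (i : 'I_(2 * n).-1) (j : nat) (a alpha : 'I_n) (f : A).

(* q ^ x as a complex number, for a real exponent x *)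
Definition qpow (x : R) : C := (q `^ x)%:C%C.

Definition last_index : 'I_n := Ordinal (etrans (ltn_predL n) n_gt0).
Local Notation nn := last_index.

(* With the numbering from 1 used in the literature, the index i of a generator
   stands for i.+1 and the index a of a row or column for a.+1. In the branches
   where ordS a and ord_pred a occur they are a + 1 and a - 1, without wrapping. *)
Record is_initial_action (act : {bilinear U -> A -> A}) : Prop := {
  initial_module_algebra : is_module_algebra act;

  initial_K_row : forall i a alpha, (i.+1 < n)%N ->
    act (K i) (z a alpha) =
      (if a.+1 == i.+1 then qC else if a.+1 == i.+2 then qC^-1 else 1) *: z a alpha;
  initial_F_row : forall i a alpha, (i.+1 < n)%N ->
    act (F i) (z a alpha) =
      if a.+1 == i.+1 then qpow 2^-1 *: z (ordS a) alpha else 0;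
  initial_E_row : forall i a alpha, (i.+1 < n)%N ->
    act (E i) (z a alpha) =
      if a.+1 == i.+2 then qpow (- 2^-1) *: z (ord_pred a) alpha else 0;

  initial_K_col : forall i j a alpha, (0 < j < n)%N -> i.+1 = (n + j)%N ->
    act (K i) (z a alpha) =
      (if alpha.+1 == (n - j)%N then qC
       else if alpha.+1 == (n - j).+1 then qC^-1 else 1) *: z a alpha;
  initial_F_col : forall i j a alpha, (0 < j < n)%N -> i.+1 = (n + j)%N ->
    act (F i) (z a alpha) =
      if alpha.+1 == (n - j)%N then qpow 2^-1 *: z a (ordS alpha) else 0;
  initial_E_col : forall i j a alpha, (0 < j < n)%N -> i.+1 = (n + j)%N ->
    act (E i) (z a alpha) =
      if alpha.+1 == (n - j).+1 then qpow (- 2^-1) *: z a (ord_pred alpha) else 0;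

  initial_K_n : forall i a alpha, i.+1 = n ->
    act (K i) (z a alpha) =
      (if (a == nn) && (alpha == nn) then qC ^+ 2
       else if (a == nn) || (alpha == nn) then qC else 1) *: z a alpha;
  initial_F_n : forall i a alpha, i.+1 = n ->
    act (F i) (z a alpha) =
      if (a == nn) && (alpha == nn) then (qpow 2^-1)%:A else 0;
  initial_E_n : forall i a alpha, i.+1 = n ->
    act (E i) (z a alpha) =
      if (a != nn) && (alpha != nn) then - qpow (- 2^-1) *: (z a nn * z nn alpha)
      else if (a == nn) && (alpha == nn) then - qpow 2^-1 *: (z nn nn) ^+ 2
      else - qpow 2^-1 *: (z nn nn * z a alpha)
}.

Record is_twisted_action (act : {bilinear U -> A -> A}) (lambda : R)
    (pil : {bilinear U -> A -> A}) : Prop := {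
  twisted_action : is_action pil;
  twisted_other : forall i f, i.+1 <> n ->
    [/\ pil (K i) f = act (K i) f, pil (Kinv i) f = act (Kinv i) f,
        pil (F i) f = act (F i) f & pil (E i) f = act (E i) f];
  twisted_K_n : forall i f, i.+1 = n -> pil (K i) f = qpow lambda *: act (K i) f;
  twisted_Kinv_n : forall i f, i.+1 = n ->
    pil (Kinv i) f = qpow (- lambda) *: act (Kinv i) f;
  twisted_F_n : forall i f, i.+1 = n -> pil (F i) f = qpow (- lambda) *: act (F i) f;
  twisted_E_n : forall i f, i.+1 = n ->
    pil (E i) f = act (E i) f
      - (qpow 2^-1 * ((1 - qpow (2 * lambda)) / (1 - qC ^+ 2)))
          *: (act (K i) f * z nn nn)
}.

(* U_q s(gl_n x gl_n) as a subset of U_q sl_2n *)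
Inductive Uq_compact : U -> Prop :=
| compact_E i : i.+1 <> n -> Uq_compact (E i)
| compact_F i : i.+1 <> n -> Uq_compact (F i)
| compact_K i : Uq_compact (K i)
| compact_Kinv i : Uq_compact (Kinv i)
| compact_1 : Uq_compact 1
| compact_D xi eta : Uq_compact xi -> Uq_compact eta -> Uq_compact (xi + eta)
| compact_Z (c : C) xi : Uq_compact xi -> Uq_compact (c *: xi)
| compact_M xi eta : Uq_compact xi -> Uq_compact eta -> Uq_compact (xi * eta).

Definition component (act : {bilinear U -> A -> A}) (k : n.-tuple nat) (f : A) : Prop :=
  exists2 xi, Uq_compact xi & f = act xi (lowest_vector q k).

(* An inner product is a {dot A for Num.conj}: positive definite, Hermitian,
   linear in the first variable. *)
Definition invariant_form (H : U -> Prop) (act : {bilinear U -> A -> A})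
    (form : {dot A for (Num.conj : C -> C)}) : Prop :=
  forall xi f1 f2, H xi -> form (act xi f1) f2 = form f1 (act (star xi) f2).

Record is_invariant_product (pil : {bilinear U -> A -> A})
    (form : {dot A for (Num.conj : C -> C)}) : Prop := {
  invariant_product_inv : invariant_form (fun=> True) pil form;
  invariant_product_1 : form 1 1 = 1
}.

Record is_Fock_product (act : {bilinear U -> A -> A}) (partial : 'I_n -> 'I_n -> A -> A)
    (form : {dot A for (Num.conj : C -> C)}) : Prop := {
  Fock_inv : invariant_form Uq_compact act form;
  Fock_1 : form 1 1 = 1;
  Fock_partial : forall a alpha f1 f2,
    form (partial a alpha f1) f2 = form f1 (f2 * z a alpha)
}.

End Actions.

(* (x; p)_N *)
Definition qpochhammer (R : pzRingType) (x p : R) (N : nat) : R :=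
  \prod_(j < N) (1 - x * p ^+ j).

(* Main.v *)
From HB Require Import structures.
From mathcomp Require Import fingroup.
From mathcomp Require Import all_boot all_order perm all_algebra.
From mathcomp Require Import boolp reals exp.
From mathcomp Require Import complex.
Require Import Defs.
From mathcomp Require Import ring lra zify.

Import Order.TTheory GRing.Theory Num.Theory.
Local Open Scope ring_scope.

Set Implicit Arguments.
Unset Strict Implicit.
Unset Printing Implicit Defensive.

(** The key is a description of the noncompact generators. The raising operator
    E_n is an inner skew derivation: up to a scalar, E_n g = z g - (K_n g) z with z
    the last generator z_n^n ([E_midE]). Hence in the twisted representation the
    adjoint of F_n is a combination of left and right multiplication by z
    ([twisted_F]), whereas in the Fock form the adjoint of F_n is left
    multiplication by z alone ([Fock_F]), and right multiplication by z_a^alpha is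
    adjoint to the q-derivative by definition.

    Both forms are invariant under the compact subalgebra. A lowest vector is
    determined by its degree, its weight and its value at the identity matrix
    ([lowest_inj]): evaluation at the identity exchanges row and column operators,
    so if it vanishes at a lowest vector, it vanishes on the whole orbit of that
    vector under the compact subalgebra ([compact_eps]); by induction on the degree
    F_n kills this orbit, and the vector is zero ([eps_null_eq0]). Representing one
    form through the other, the two are proportional against every lowest vector
    ([form_proportional]), hence on every component, and only the ratio c(k) has to
    be found.

    Let v be the lowest vector of shape k, let k_m (numbered from 0) be its last
    nonzero row, and let v' be the lowest vector of the shape with one box of that
    row removed. If D_r denotes the lower right minor of size r, this replaces one
    factor D_(m+1) of v by D_m. Two operators send v to explicit multiples of v':
    the lowering word that applies F_n and then shifts the rows and columns of the
    minor back to the lower right corner ([W_v]), and the q-derivative in the upper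
    left entry of the block of D_(m+1) ([partial_v]). Both behave as skew derivations
    on lowest vectors, which makes the multiples q-numbers. For both forms the
    adjoint of the first operator is given by multiplications by z; against a lowest
    vector, right multiplication by z can be carried along the word to the corner of
    the block ([lowest_form_path]), where it is adjoint to the second operator.
    Comparing the two forms gives
      c(k) (1 - q^2) = c(k') (1 - t q^(2 p) / q^(2 m)),   t = q^(2 lambda),
    where k' is the smaller shape and k_m = p + 1 ([ratio_step]). Removing the boxes
    one by one yields the product of Pochhammer symbols ([ratio_shape]). *)

(** * Inversions and sums over permutations *)

Section Inversions.
Local Open Scope group_scope.
Local Open Scope nat_scope.

Definition inv_set m (s : 'S_m) : {set 'I_m * 'I_m} :=
  [set p : 'I_m * 'I_m | (p.1 < p.2)%N && (s p.2 < s p.1)%N].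

Lemma inversionsE m (s : 'S_m) : inversions s = #|inv_set s|.
Proof. by []. Qed.

Lemma inversionsV m (s : 'S_m) : inversions s^-1 = inversions s.
Proof.
pose psi (p : 'I_m * 'I_m) := (s p.2, s p.1).
have psi_inj : injective psi by move=> [i j] [k l] [] /perm_inj -> /perm_inj ->.
rewrite !inversionsE -[RHS](card_imset _ psi_inj); apply: eq_card => -[x y].
rewrite inE /=; apply/idP/imsetP => [/andP[xy H]|[[i j]]].
  by exists (s^-1 y, s^-1 x); rewrite ?inE /psi /= ?permKV ?H.
by rewrite inE /= => /andP[ij H] [-> ->]; rewrite !permK H.
Qed.

(** The transposition creates the inversion at its two adjacent positions and
    carries the other inversions to one another. *)
Lemma inversions_tperm m (s : 'S_m) (P P' : 'I_m) : P' = P.+1 :> nat -> s P < s P' ->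
  inversions (tperm P P' * s) = (inversions s).+1.
Proof.
move=> PP' sP; set t := tperm P P'.
have PnP' : P != P' by apply/eqP => e; move: PP'; rewrite e; lia.
pose phi (p : 'I_m * 'I_m) := (t p.1, t p.2).
have phiK : involutive phi by move=> [i j]; rewrite /phi /= !tpermK.
have tE (k : 'I_m) : t k = (if k == P :> nat then P.+1 else if k == P.+1 :> nat then P : nat else k) :> nat.
  rewrite /t; case: tpermP => [->|->|/eqP kP /eqP kP'].
  - by rewrite eqxx PP'.
  - by rewrite PP' ifF ?eqxx //; apply/eqP; lia.
  - by rewrite -PP' !ifF //; apply/negbTE.
have t_lt (i j : 'I_m) : i < j -> (i, j) != (P, P') -> t i < t j.
  rewrite !tE xpair_eqE negb_and -!val_eqE /= PP' => ij /orP ne.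
  by repeat case: eqP => ?; lia.
have -> : inversions s = #|[set phi p | p in inv_set s]|.
  by rewrite card_imset //; apply: inv_inj.
rewrite inversionsE; have -> : inv_set (t * s) = (P, P') |: [set phi p | p in inv_set s].
  apply/setP => -[i j]; rewrite !inE /= !permM.
  have -> : ((i, j) \in [set phi p | p in inv_set s]) = (t i < t j) && (s (t j) < s (t i)).
    apply/imsetP/idP => [[p]|H].
      by rewrite inE => /andP[H1 H2] [-> ->]; rewrite !tpermK H1.
    by exists (phi (i, j)); rewrite ?phiK // inE.
  have [[-> ->]|ne] := eqVneq (i, j) (P, P').
    by rewrite tpermL tpermR sP PP' ltnS leqnn.
  apply/idP/idP => /andP[H1 H2]; first by rewrite H2 t_lt.
  rewrite H2 andbT -(tpermK P P' i) -(tpermK P P' j); apply: t_lt => //.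
  apply/eqP => -[ti tj]; move: H2; rewrite /t ti tj => H2.
  by move: (ltn_trans sP H2); rewrite ltnn.
rewrite cardsU1; case: imsetP => [[[i j]]|_] //.
rewrite inE /= => /andP[H1 H2] [] /(canLR (tpermK _ _)); rewrite tpermL => iE.
move=> /(canLR (tpermK _ _)); rewrite tpermR => jE.
by move: H1; rewrite -iE -jE PP'; lia.
Qed.

Lemma inversions_tperm_r m (s : 'S_m) (P P' : 'I_m) :
  P' = P.+1 :> nat -> s^-1 P < s^-1 P' ->
  inversions (s * tperm P P') = (inversions s).+1.
Proof.
by move=> PP' sP; rewrite -inversionsV invMg tpermV inversions_tperm // inversionsV.
Qed.

Lemma inversions_lift m (i0 : 'I_m.+1) (s : 'S_m) : (i0 == ord0) || (i0 == ord_max) ->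
  inversions (lift_perm i0 i0 s) = inversions s.
Proof.
move=> i0P; pose phi (p : 'I_m * 'I_m) := (lift i0 p.1, lift i0 p.2).
have phi_inj : injective phi.
  move=> [i j] [k l] e; congr (_, _); apply: (@lift_inj _ i0).
    exact: (congr1 fst e).
  exact: (congr1 snd e).
have lt_lift (i j : 'I_m) : (lift i0 i < lift i0 j) = (i < j).
  by rewrite !ltnNge /= leq_bump2.
rewrite !inversionsE -[RHS](card_imset _ phi_inj); apply: eq_card => -[x y].
rewrite inE /=; apply/idP/imsetP => [|[[i j]]]; last first.
  by rewrite inE /= => H [-> ->]; rewrite !lift_perm_lift !lt_lift.
case: (unliftP i0 x) => [i ->|->]; case: (unliftP i0 y) => [j ->|->].
- by rewrite !lift_perm_lift !lt_lift => H; exists (i, j); rewrite ?inE.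
- rewrite lift_perm_lift lift_perm_id => /andP[H1 H2].
  have := ltn_ord (s i); case/orP: i0P H1 H2 => /eqP -> /=; rewrite /bump; lia.
- rewrite lift_perm_lift lift_perm_id => /andP[H1 H2].
  have := ltn_ord j; case/orP: i0P H1 H2 => /eqP -> /=; rewrite /bump; lia.
- by rewrite ltnn.
Qed.

Lemma inversions1 m : inversions (1 : 'S_m) = 0.
Proof.
apply/eqP; rewrite cards_eq0; apply/eqP/setP => -[i j]; rewrite !inE !perm1 /=.
by apply/negP => /andP[H1 H2]; move: (ltn_trans H1 H2); rewrite ltnn.
Qed.

End Inversions.

Lemma sum_perm_fix (V : zmodType) m (i0 : 'I_m.+1) (G : 'S_m.+1 -> V) :
  \sum_(s : 'S_m.+1 | s i0 == i0) G s = \sum_(s : 'S_m) G (lift_perm i0 i0 s).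
Proof.
rewrite (reindex (lift_perm i0 i0)); last first.
  pose f (s : 'S_m.+1) (k : 'I_m) : 'I_m := odflt k (unlift i0 (s (lift i0 k))).
  have fK (s : 'S_m.+1) k : s i0 = i0 -> lift i0 (f s k) = s (lift i0 k).
    move=> si0; rewrite /f; case: unliftP => [j ->|] //= /esym.
    by rewrite -{1}si0 => /perm_inj /eqP; rewrite (negPf (neq_lift _ _)).
  have f_inj (s : 'S_m.+1) : s i0 = i0 -> injective (f s).
    by move=> si0 k l /(congr1 (lift i0)); rewrite !fK // => /perm_inj /lift_inj.
  exists (fun s : 'S_m.+1 => if s i0 =P i0 is ReflectT si0 then perm (f_inj s si0) else 1%g) => s.
    rewrite inE => _; case: eqP => [si0|[]]; last exact: lift_perm_id.
    by apply/permP => k; apply: (@lift_inj _ i0); rewrite permE fK // lift_perm_lift.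
  rewrite inE => /eqP si; case: eqP => // si0; apply/permP => k.
  case: (unliftP i0 k) => [k'|] ->; last by rewrite lift_perm_id.
  by rewrite lift_perm_lift permE fK.
by apply: eq_bigl => s; rewrite lift_perm_id eqxx.
Qed.

(** The cancellation behind the vanishing of minors with a repeated index. *)
Lemma sum_pairing (I : finType) (V : zmodType) (sigma : I -> I) (p : pred I) (T : I -> V) :
  involutive sigma -> (forall s, p (sigma s) = ~~ p s) ->
  (forall s, p s -> T s + T (sigma s) = 0) -> \sum_s T s = 0.
Proof.
move=> sK ps Ts; rewrite (bigID p) /= [X in _ + X](reindex sigma) /=; last first.
  by exists sigma => s _.
rewrite [X in _ + X](eq_bigl p) => [|s]; last by rewrite ps negbK.
by rewrite -big_split big1.
Qed.

(** * Row, column and root indices *)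

Section Indices.
Variables (n : nat) (n_gt0 : (0 < n)%N).
Local Notation nn := (last_index n_gt0).
Implicit Types (i : 'I_(2 * n).-1) (a b : 'I_n).

Lemma val_ord_pred a c : a = c.+1 :> nat -> ord_pred a = c :> nat.
Proof.
by move=> ac; have := ltn_ord a; rewrite /= ac addSn /= modnDr => /ltnW; exact: modn_small.
Qed.

Fact mid_proof : (n.-1 < (2 * n).-1)%N.
Proof. by lia. Qed.

(** The index of the noncompact simple root. *)
Definition mid : 'I_(2 * n).-1 := Ordinal mid_proof.

Lemma mid_n : mid.+1 = n.
Proof. by rewrite /= prednK. Qed.

(** The compact simple roots form two mirror halves: ix false c moves between the
    rows c and c + 1, and ix true c between the columns c and c + 1. *)
Definition ix (s : bool) (c : nat) : 'I_(2 * n).-1 :=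
  insubd mid (if s then (2 * n).-2 - c else c)%N.

Lemma val_ix s c : (c.+1 < n)%N -> ix s c = (if s then (2 * n).-2 - c else c)%N :> nat.
Proof. by move=> cn; rewrite val_insubd ifT //; case: s; lia. Qed.

Lemma rev_ix s c : (c.+1 < n)%N -> rev_ord (ix s c) = ix (~~ s) c.
Proof. by move=> cn; apply: val_inj; rewrite /= !val_ix //; case: s => /=; lia. Qed.

Lemma ix_neq s c : (c.+1 < n)%N -> (ix s c).+1 <> n.
Proof. by move=> cn; rewrite val_ix //; case: s; lia. Qed.

Lemma ix_neq_mid s c : (c.+1 < n)%N -> ix s c != mid.
Proof. by move=> cn; apply/eqP => /(congr1 val) /=; rewrite val_ix //; case: s; lia. Qed.

Lemma ixP i : i.+1 <> n -> exists s c, (c.+1 < n)%N /\ i = ix s c.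
Proof.
move=> H; have il := ltn_ord i; have [lt_in|le_ni] := ltnP i.+1 n.
  by exists false, i; split=> //; apply: val_inj; rewrite /= val_ix.
exists true, ((2 * n).-2 - i)%N; have cn : (((2 * n).-2 - i).+1 < n)%N by lia.
by split=> //; apply: val_inj; rewrite /= val_ix //; lia.
Qed.

Lemma rev_mid : rev_ord mid = mid.
Proof. by apply: val_inj; rewrite /=; lia. Qed.

Lemma grid_ind (P : 'I_n -> 'I_n -> Prop) :
  (forall o : 'I_n, o = 0%N :> nat -> P o o) ->
  (forall a b, (a.+1 < n)%N -> P a b -> P (ordS a) b) ->
  (forall a b, (b.+1 < n)%N -> P a b -> P a (ordS b)) ->
  forall a b, P a b.
Proof.
move=> P0 Pr Pc.
have o : 'I_n := Ordinal n_gt0.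
have o0 : exists o : 'I_n, o = 0%N :> nat by exists (Ordinal n_gt0).
move: o0 => {o} [o o0].
have Po a : P a o.
  case: a => m; elim: m => [|m IH] mn.
    by rewrite (_ : Ordinal mn = o) //; [apply: P0|apply: val_inj; rewrite /= o0].
  have mn' : (m < n)%N by lia.
  rewrite (_ : Ordinal mn = ordS (Ordinal mn')); first exact: Pr.
  by apply: val_inj; rewrite /= modn_small.
move=> a b; case: b => m; elim: m => [|m IH] mn.
  by rewrite (_ : Ordinal mn = o) //; apply: val_inj; rewrite /= o0.
have mn' : (m < n)%N by lia.
rewrite (_ : Ordinal mn = ordS (Ordinal mn')); first exact: Pc.
by apply: val_inj; rewrite /= modn_small.
Qed.

Lemma grid_ind_rev (P : 'I_n -> 'I_n -> Prop) :
  P nn nn ->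
  (forall a b, (a.+1 < n)%N -> P (ordS a) b -> P a b) ->
  (forall a b, (b.+1 < n)%N -> P a (ordS b) -> P a b) ->
  forall a b, P a b.
Proof.
move=> Pn Pr Pc.
have last (a : 'I_n) : (n.-1 - a = 0)%N -> a = nn.
  by move=> e; apply: val_inj => /=; have := ltn_ord a; lia.
have valS (a : 'I_n) : (a.+1 < n)%N -> ordS a = a.+1 :> nat.
  by move=> an; rewrite /= modn_small.
have Pl a : P a nn.
  move e : (n.-1 - a)%N => m; elim: m a e => [|m IH] a e; first by rewrite (last a).
  have an : (a.+1 < n)%N by lia.
  by apply: Pr => //; apply: IH; rewrite valS //; lia.
move=> a b; move e : (n.-1 - b)%N => m; elim: m b e => [|m IH] b e.
  by rewrite (last b).
have bn : (b.+1 < n)%N by lia.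
by apply: Pc => //; apply: IH; rewrite valS //; lia.
Qed.

(** The interval of k + 1 indices from w on, with the e-th one left out. *)
Definition gap_index (w k e : nat) (i : 'I_k) : 'I_n := insubd nn (w + i + (e <= i))%N.

Lemma val_gap w k e (i : 'I_k) : (w + k < n)%N -> gap_index w e i = (w + i + (e <= i))%N :> nat.
Proof. by move=> jk; rewrite val_insubd ifT //; have := ltn_ord i; case: (e <= i)%N; lia. Qed.

Lemma gap_indexS w k e (i : 'I_k) : (w + k < n)%N -> (e < k)%N ->
  (if i == e :> nat then ordS (gap_index w e.+1 i) else gap_index w e.+1 i) = gap_index w e i.
Proof.
move=> jk ek; apply: val_inj; have ik := ltn_ord i.
case: eqP => ie; rewrite /= ?val_gap //; last by congr (_ + _)%N; lia.
by rewrite modn_small ie ?ltnn ?leqnn; lia.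
Qed.

(** The last m indices; insubd takes its default only when n < m. *)
Definition low_index m (i : 'I_m) : 'I_n := insubd nn (n - m + i)%N.

Lemma val_low m (i : 'I_m) : (m <= n)%N -> low_index i = (n - m + i)%N :> nat.
Proof. by move=> mn; rewrite val_insubd ifT //; have := ltn_ord i; lia. Qed.

Lemma low_inj m : (m <= n)%N -> injective (@low_index m).
Proof. by move=> mn i j /(congr1 (@nat_of_ord n)); rewrite !val_low // => /addnI /val_inj. Qed.

End Indices.
Arguments mid_n {n n_gt0}.
Arguments ixP {n n_gt0 i}.
Arguments ix_neq_mid {n n_gt0} s [c].

(** * The algebra of quantum matrices *)

Section QuantumMatrixAlgebra.
Variables (R : realType) (n : nat) (q : R).
Local Notation C := R[i].
Local Notation qC := (q%:C)%C.
Local Notation A := (qmat n q).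
Local Notation z := (z q).
Implicit Types (f g : A) (a b al be : 'I_n).

Definition qmat_pres : presentation C := Presentation (@Defs.qmat_aug_rel_subproof R n q).
Local Notation presA := (presAlg qmat_pres).

Let rels (s t : aterm C ('I_n * 'I_n)) (st : qmat_rel q s t) :
  eval (@agen _ qmat_pres) s = eval (@agen _ qmat_pres) t.
Proof. exact: agen_rels. Qed.

Lemma z_q a b al be :
  (a = b /\ (al < be)%N) \/ ((a < b)%N /\ al = be) ->
  z a al * z b be = qC *: (z b be * z a al).
Proof. by move=> H; have := rels (qmat_q q H); rewrite /= mulr_algl. Qed.

Lemma z_comm a b al be : (a < b)%N -> (be < al)%N ->
  z a al * z b be = z b be * z a al.
Proof. by move=> H1 H2; have := rels (qmat_comm q H1 H2). Qed.

Lemma z_cross a b al be : (a < b)%N -> (al < be)%N ->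
  z a al * z b be = z b be * z a al + (qC - qC^-1) *: (z a be * z b al).
Proof. by move=> H1 H2; have := rels (qmat_cross q H1 H2); rewrite /= mulr_algl. Qed.

Lemma qmat_ind (P : A -> Prop) :
  P 1 -> (forall f a al, P f -> P (f * z a al)) ->
  (forall f g, P f -> P g -> P (f + g)) -> (forall (c : C) f, P f -> P (c *: f)) ->
  forall f, P f.
Proof.
move=> P1 Pz PD PZ f; have -> : f = toAlg (repr (f : presA)) by rewrite toAlg_repr.
move: (repr _) => t {f}.
suff H : forall f, P f -> P (f * (toAlg t : presA)) by rewrite -[toAlg t]mul1r; exact: H.
rewrite toAlg_eval; elim: t => [[a al]|c|s IHs t IHt|s IHs t IHt] f Pf /=.
- exact: Pz.
- by rewrite mulr_algr; apply: PZ.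
- by rewrite mulrDr; apply: PD; [apply: IHs|apply: IHt].
- by rewrite mulrA; apply: IHt; apply: IHs.
Qed.

Section UniversalProperty.
Variables (B : algType C) (g : 'I_n * 'I_n -> B).

(** The value at a chosen representative term. Once g respects the defining
    relations, every representative gives this value. *)
Definition qhom f : B := eval g (repr (f : presA)).

Hypothesis g_q : forall a b al be, (a = b /\ (al < be)%N) \/ ((a < b)%N /\ al = be) ->
  g (a, al) * g (b, be) = qC *: (g (b, be) * g (a, al)).
Hypothesis g_comm : forall a b al be, (a < b)%N -> (be < al)%N ->
  g (a, al) * g (b, be) = g (b, be) * g (a, al).
Hypothesis g_cross : forall a b al be, (a < b)%N -> (al < be)%N ->
  g (a, al) * g (b, be) =
  g (b, be) * g (a, al) + (qC - qC^-1) *: (g (a, be) * g (b, al)).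

Lemma qhom_eval f t : f = eval (fun p => z p.1 p.2) t -> qhom f = eval g t.
Proof.
have grel s u : qmat_rel q s u -> eval g s = eval g u.
  by case=> *; rewrite /= ?mulr_algl; [apply: g_q|apply: g_comm|apply: g_cross].
move=> ->; have -> : (fun p => z p.1 p.2) = @agen _ qmat_pres by apply/funext=> -[].
have -> : eval (@agen _ qmat_pres) t = toAlg (t : aterm C (gens qmat_pres)).
  by rewrite toAlg_eval.
exact: (@eval_cong _ _ (@qmat_rel R n q) _ _ grel _ _ (repr_toAlg (P := qmat_pres) t)).
Qed.

Let reprE f : f = eval (fun p => z p.1 p.2) (repr (f : presA)).
Proof.
have -> : (fun p => z p.1 p.2) = @agen _ qmat_pres by apply/funext=> -[].
rewrite -[LHS]toAlg_repr; exact: (@toAlg_eval _ qmat_pres).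
Qed.

Lemma qhomD f1 f2 : qhom (f1 + f2) = qhom f1 + qhom f2.
Proof.
by apply: (qhom_eval (t := Add (repr (f1 : presA)) (repr (f2 : presA))));
  rewrite /= -!reprE.
Qed.

Lemma qhomM f1 f2 : qhom (f1 * f2) = qhom f1 * qhom f2.
Proof.
by apply: (qhom_eval (t := Mul (repr (f1 : presA)) (repr (f2 : presA))));
  rewrite /= -!reprE.
Qed.

Lemma qhomZ (c : C) f : qhom (c *: f) = c *: qhom f.
Proof.
rewrite (qhom_eval (t := Mul (Const c) (repr (f : presA)))) /= ?mulr_algl //.
by rewrite -reprE.
Qed.

Lemma qhom1 : qhom 1 = 1.
Proof. by rewrite (qhom_eval (t := Const 1)) /= scale1r. Qed.

Lemma qhom_z a al : qhom (z a al) = g (a, al).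
Proof. exact: (qhom_eval (t := Var (a, al))). Qed.

End UniversalProperty.

(** Rescaling rows and columns is an endomorphism for all scalars, zero included:
    each relation only involves products using the same two rows and columns. *)
Definition scale_hom (c c' : 'I_n -> C) : A -> A :=
  qhom (fun p => (c p.1 * c' p.2) *: z p.1 p.2).

Section ScaleHom.
Variables (c c' : 'I_n -> C).

Let ZM (x y : C) f g : (x *: f) * (y *: g) = (x * y) *: (f * g).
Proof. by rewrite -scalerAl -scalerAr scalerA. Qed.

Let sh_q a b al be : (a = b /\ (al < be)%N) \/ ((a < b)%N /\ al = be) ->
  ((c a * c' al) *: z a al) * ((c b * c' be) *: z b be) =
  qC *: (((c b * c' be) *: z b be) * ((c a * c' al) *: z a al)).
Proof. by move=> H; rewrite !ZM z_q // !scalerA; congr (_ *: _); ring. Qed.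

Let sh_comm a b al be : (a < b)%N -> (be < al)%N ->
  ((c a * c' al) *: z a al) * ((c b * c' be) *: z b be) =
  ((c b * c' be) *: z b be) * ((c a * c' al) *: z a al).
Proof. by move=> H1 H2; rewrite !ZM z_comm //; congr (_ *: _); ring. Qed.

Let sh_cross a b al be : (a < b)%N -> (al < be)%N ->
  ((c a * c' al) *: z a al) * ((c b * c' be) *: z b be) =
  ((c b * c' be) *: z b be) * ((c a * c' al) *: z a al)
  + (qC - qC^-1) *: (((c a * c' be) *: z a be) * ((c b * c' al) *: z b al)).
Proof.
move=> H1 H2; rewrite !ZM z_cross // scalerDr !scalerA.
by congr (_ *: _ + _ *: _); ring.
Qed.

Lemma scale_homD f1 f2 : scale_hom c c' (f1 + f2) = scale_hom c c' f1 + scale_hom c c' f2.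
Proof. exact: (qhomD sh_q sh_comm sh_cross). Qed.

Lemma scale_homM f1 f2 : scale_hom c c' (f1 * f2) = scale_hom c c' f1 * scale_hom c c' f2.
Proof. exact: (qhomM sh_q sh_comm sh_cross). Qed.

Lemma scale_homZ (x : C) f : scale_hom c c' (x *: f) = x *: scale_hom c c' f.
Proof. exact: (qhomZ sh_q sh_comm sh_cross). Qed.

Lemma scale_hom1 : scale_hom c c' 1 = 1.
Proof. exact: (qhom1 sh_q sh_comm sh_cross). Qed.

Lemma scale_hom_z a al : scale_hom c c' (z a al) = (c a * c' al) *: z a al.
Proof. exact: (qhom_z sh_q sh_comm sh_cross). Qed.

Lemma scale_hom0 : scale_hom c c' 0 = 0.
Proof. by rewrite -[0 in LHS](scale0r 0) scale_homZ scale0r. Qed.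

End ScaleHom.

(** Evaluation at the identity matrix, the counit of the bialgebra of quantum
    matrices. *)
Definition eps : A -> C := qhom (fun p => (p.1 == p.2)%:R : C^o).

Section Eps.

Let g (p : 'I_n * 'I_n) : C^o := (p.1 == p.2)%:R.

Let eps_q a b al be : (a = b /\ (al < be)%N) \/ ((a < b)%N /\ al = be) ->
  g (a, al) * g (b, be) = qC *: (g (b, be) * g (a, al)).
Proof.
rewrite /g /= => H.
have E : ((a == al)%:R * (b == be)%:R : C) = 0.
  case: (eqVneq a al) => [aal|]; last by rewrite mul0r.
  case: (eqVneq b be) => [bbe|]; last by rewrite mulr0.
  by case: H => -[]; rewrite -aal -bbe; [move=> ->|move=> ab e; move: ab; rewrite e]; rewrite ltnn.
by rewrite [LHS]E [X in _ *: X]mulrC [X in _ *: X]E scaler0.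
Qed.

Let eps_comm a b al be : (a < b)%N -> (be < al)%N ->
  g (a, al) * g (b, be) = g (b, be) * g (a, al).
Proof. by rewrite mulrC. Qed.

Let eps_cross a b al be : (a < b)%N -> (al < be)%N ->
  g (a, al) * g (b, be) =
  g (b, be) * g (a, al) + (qC - qC^-1) *: (g (a, be) * g (b, al)).
Proof.
move=> ab albe; rewrite mulrC /g /=.
suff -> : ((a == be)%:R * (b == al)%:R : C) = 0 by rewrite scaler0 addr0.
case: eqVneq => [abe|]; last by rewrite mul0r.
case: eqVneq => [bal|]; last by rewrite mulr0.
by move: ab albe; rewrite abe bal => ab /(ltn_trans ab); rewrite ltnn.
Qed.

Lemma epsD f1 f2 : eps (f1 + f2) = eps f1 + eps f2. Proof. exact: (qhomD eps_q eps_comm eps_cross). Qed.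
Lemma epsM f1 f2 : eps (f1 * f2) = eps f1 * eps f2. Proof. exact: (qhomM eps_q eps_comm eps_cross). Qed.
Lemma epsZ (x : C) f : eps (x *: f) = x * eps f. Proof. exact: (qhomZ eps_q eps_comm eps_cross). Qed.
Lemma eps1 : eps 1 = 1. Proof. exact: (qhom1 eps_q eps_comm eps_cross). Qed.
Lemma eps_z a al : eps (z a al) = (a == al)%:R. Proof. exact: (qhom_z eps_q eps_comm eps_cross). Qed.

End Eps.

Lemma eps0 : eps 0 = 0.
Proof. by rewrite -[0 in LHS](scale0r 0) epsZ mul0r. Qed.

(** * Degree *)

Inductive homog : nat -> A -> Prop :=
| homog1 : homog 0 1
| homog_z d f a al : homog d f -> homog d.+1 (z a al * f)
| homog0 d : homog d 0
| homogD d f g : homog d f -> homog d g -> homog d (f + g)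
| homogZ d (c : C) f : homog d f -> homog d (c *: f).

Lemma homogM d e f g : homog d f -> homog e g -> homog (d + e) (f * g).
Proof.
move=> Hf Hg; elim: Hf => [|{}d {}f a al _ IH|{}d|{}d f1 f2 _ IH1 _ IH2|{}d c {}f _ IH].
- by rewrite mul1r.
- by rewrite -mulrA addSn; apply: homog_z.
- by rewrite mul0r; apply: homog0.
- by rewrite mulrDl; apply: homogD.
- by rewrite -scalerAl; apply: homogZ.
Qed.

Lemma homog_gen a al : homog 1 (z a al).
Proof. by rewrite -[z a al]mulr1; apply/homog_z/homog1. Qed.

Lemma homog_sum (I : Type) (r : seq I) (P : pred I) (F : I -> A) d :
  (forall i, P i -> homog d (F i)) -> homog d (\sum_(i <- r | P i) F i).
Proof.
move=> H; elim/big_rec: _ => [|i x Pi Hx]; first exact: homog0.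
by apply: homogD => //; apply: H.
Qed.

Lemma homogX d f m : homog d f -> homog (m * d) (f ^+ m).
Proof.
move=> Hf; elim: m => [|m IH]; first by rewrite expr0; apply: homog1.
by rewrite exprS mulSn; apply: homogM.
Qed.

Lemma homog_prod_ord m (F : 'I_m -> A) (d : 'I_m -> nat) :
  (forall i, homog (d i) (F i)) -> homog (\sum_(i < m) d i) (\prod_(i < m) F i).
Proof.
elim: m F d => [|m IH] F d H; first by rewrite !big_ord0; apply: homog1.
by rewrite !big_ord_recl; apply: homogM => //; apply: IH.
Qed.

(** Membership in a span, phrased so that the vectors can be split off one at a
    time. *)
Fixpoint inspan (s : seq A) (x : A) : Prop :=
  if s is e :: s' then exists c : C, inspan s' (x - c *: e) else x = 0.

Lemma inspan0 s : inspan s 0.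
Proof. by elim: s => //= e s IH; exists 0; rewrite scale0r subr0. Qed.

Lemma inspanD s x y : inspan s x -> inspan s y -> inspan s (x + y).
Proof.
elim: s x y => [|e s IH] x y /=; first by move=> -> ->; rewrite addr0.
move=> [c Hc] [c' Hc']; exists (c + c'); have := IH _ _ Hc Hc'.
by rewrite scalerDl opprD addrACA.
Qed.

Lemma inspanZ s c x : inspan s x -> inspan s (c *: x).
Proof.
elim: s x => [|e s IH] x /=; first by move=> ->; rewrite scaler0.
by move=> [c' Hc']; exists (c * c'); have := IH _ Hc'; rewrite scalerBr scalerA.
Qed.

Lemma inspan_mem s x : x \in s -> inspan s x.
Proof.
elim: s => //= e s IH; rewrite inE => /orP[/eqP ->|/IH H].
  by exists 1; rewrite scale1r subrr; apply: inspan0.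
by exists 0; rewrite scale0r subr0.
Qed.

Lemma inspan_sub s (P : A -> Prop) : P 0 -> (forall x y, P x -> P y -> P (x + y)) ->
  (forall c x, P x -> P (c *: x)) -> (forall x, x \in s -> P x) ->
  forall x, inspan s x -> P x.
Proof.
move=> P0 PD PZ; elim: s => [|e s IH] Ps x /=; first by move=> ->.
move=> [c Hc]; rewrite -[x](subrK (c *: e)); apply: PD.
  by apply: IH => // y ys; apply: Ps; rewrite inE ys orbT.
by apply: PZ; apply: Ps; rewrite mem_head.
Qed.

Fixpoint homog_words (d : nat) : seq A :=
  if d is d'.+1 then
    [seq z p.1 p.2 * x | p <- enum {: 'I_n * 'I_n}, x <- homog_words d']
  else [:: 1].

Lemma homog_words_homog d x : x \in homog_words d -> homog d x.
Proof.
elim: d x => [|d IH] x /=; first by rewrite inE => /eqP ->; apply: homog1.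
by move=> /allpairsP [[p y] [_ /= /IH Hy ->]]; apply: homog_z.
Qed.

Lemma inspan_homog d x : inspan (homog_words d) x -> homog d x.
Proof.
apply: inspan_sub; [exact: homog0|exact: homogD|exact: homogZ|exact: homog_words_homog].
Qed.

Lemma homog_inspan d x : homog d x -> inspan (homog_words d) x.
Proof.
elim=> [|{}d f a al _ IH|{}d|{}d f g _ IH1 _ IH2|{}d c f _ IH].
- by apply: inspan_mem; rewrite mem_head.
- apply: (inspan_sub (P := fun y => inspan (homog_words d.+1) (z a al * y))) IH.
  + by rewrite mulr0; apply: inspan0.
  + by move=> x1 x2; rewrite mulrDr; apply: inspanD.
  + by move=> c x1; rewrite -scalerAr; apply: inspanZ.
  move=> y ys; apply: inspan_mem; apply/allpairsP; exists ((a, al), y).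
  by split; rewrite ?mem_enum.
- exact: inspan0.
- exact: inspanD.
- exact: inspanZ.
Qed.

(** * Positive definite forms *)

Section Forms.
Variable form : {dot A for (Num.conj : C -> C)}.
Implicit Types x y : A.

Lemma formC x y : form x y = Num.conj (form y x).
Proof. by rewrite (hermitian_subproof (s := form)) expr0 mul1r. Qed.

Lemma formDl x y w : form (x + y) w = form x w + form y w.
Proof. exact: linearDl. Qed.
Lemma formZl (c : C) x y : form (c *: x) y = c * form x y.
Proof. exact: linearZl_LR. Qed.
Lemma formDr x y w : form x (y + w) = form x y + form x w.
Proof. exact: linearDr. Qed.
Lemma formZr (c : C) x y : form x (c *: y) = Num.conj c * form x y.
Proof. exact: linearZr_LR. Qed.
Lemma formBl x y w : form (x - y) w = form x w - form y w.
Proof. exact: linearBl. Qed.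
Lemma formBr x y w : form x (y - w) = form x y - form x w.
Proof. exact: linearBr. Qed.
Lemma form0l x : form 0 x = 0. Proof. exact: linear0l. Qed.
Lemma form0r x : form x 0 = 0. Proof. exact: linear0r. Qed.

Lemma form_eq0 x : form x x = 0 -> x = 0.
Proof.
move=> H; apply/eqP; apply: contraT => x0.
by have := dnorm_gt0 form x; rewrite x0 H ltxx.
Qed.

Lemma form_inj x y : (forall w, form x w = form y w) -> x = y.
Proof. by move=> H; apply/eqP; rewrite -subr_eq0; apply/eqP/form_eq0; rewrite formBl H subrr. Qed.

(** One Gram-Schmidt step for each vector of the list. The algebra is infinite
    dimensional, whence the restriction to a finite span. *)
Lemma riesz s (phi : A -> C) : (forall x y, phi (x + y) = phi x + phi y) ->
  (forall c x, phi (c *: x) = c * phi x) ->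
  exists2 u, inspan s u & forall x, inspan s x -> phi x = form x u.
Proof.
elim: s phi => [|e s IH] phi phiD phiZ.
  have phi0 : phi 0 = 0 by rewrite -(scale0r 0) phiZ mul0r.
  by exists 0 => // x /= ->; rewrite phi0 form0l.
have [u0 u0s phi_u0] := IH phi phiD phiZ.
have [p ps form_p] := IH (form^~ e) (fun x y => formDl x y e) (fun c x => formZl c x e).
have [e' e'E] : exists e', e' = e - p by exists (e - p).
have orth x : inspan s x -> form x e' = 0 by move=> xs; rewrite e'E formBr form_p // subrr.
have span_cons x : inspan s x -> inspan (e :: s) x by exists 0; rewrite scale0r subr0.
(* If e' = 0 the quotient is 0 by convention and u0 is already right. *)
exists (u0 + Num.conj (phi e' / form e' e') *: e').
  apply: inspanD; first exact: span_cons.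
  rewrite e'E; apply: inspanZ; apply: inspanD; first by exists 1; rewrite scale1r subrr; apply: inspan0.
  by rewrite -scaleN1r; apply: inspanZ; apply: span_cons.
move=> x [c Hc]; set y := x - c *: e in Hc.
have ->: x = (y + c *: p) + c *: e'.
  by rewrite e'E scalerBr /y addrACA subrK subrr addr0.
have ys : inspan s (y + c *: p) by apply: inspanD => //; apply: inspanZ.
move: (y + c *: p) ys => {x y Hc} y ys.
rewrite phiD phiZ phi_u0 // formDl !formDr !formZl !formZr (orth y) // mulr0 addr0.
rewrite [form e' u0]formC (orth u0) // rmorph0 mulr0 add0r conjCK; congr (_ + c * _).
have [e0|e0] := eqVneq e' 0; last by rewrite divfK // gt_eqF // dnorm_gt0.
by rewrite e0 -[X in phi X](scale0r (0 : A)) phiZ !mul0r.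
Qed.

End Forms.

End QuantumMatrixAlgebra.

(** * Relations of the quantum group *)

Section QuantumGroupRelations.
Variables (R : realType) (r : nat) (q : R).
Local Notation C := R[i].
Local Notation qC := (q%:C)%C.
Local Notation U := (Uq r q).
Implicit Types i j : 'I_r.

Lemma Uq_rels (s t : aterm C (Uq_gen r)) (st : Uq_rel q s t) :
  eval (@agen _ (Uq_pres r q)) s = eval (@agen _ (Uq_pres r q)) t.
Proof. exact: agen_rels. Qed.

Lemma Uq_relKKinv i : K q i * Kinv q i = 1 :> U.
Proof. by have := Uq_rels (Uq_KKinv q i); rewrite /= scale1r. Qed.

Lemma Uq_relKinvK i : Kinv q i * K q i = 1 :> U.
Proof. by have := Uq_rels (Uq_KinvK q i); rewrite /= scale1r. Qed.

Lemma Uq_relKE i j : K q i * E q j = qC ^ cartan_A i j *: (E q j * K q i) :> U.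
Proof. by have := Uq_rels (Uq_KE q i j); rewrite /= mulr_algl. Qed.

Lemma Uq_relKF i j : K q i * F q j = qC ^ (- cartan_A i j) *: (F q j * K q i) :> U.
Proof. by have := Uq_rels (Uq_KF q i j); rewrite /= mulr_algl. Qed.

Lemma Uq_relEF i j : E q i * F q j - F q j * E q i =
  ((i == j)%:R / (qC - qC^-1)) *: (K q i - Kinv q i) :> U.
Proof.
have := Uq_rels (Uq_EF q i j).
by rewrite /= !scaleN1r !mulN1r mulr_algl.
Qed.

End QuantumGroupRelations.

(** * The initial action *)

Section InitialAction.
Variables (R : realType) (n : nat) (n_gt0 : (0 < n)%N) (q : R).
Hypotheses (q_gt0 : 0 < q) (q_lt1 : q < 1).
Local Notation C := R[i].
Local Notation qC := (q%:C)%C.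
Local Notation A := (qmat n q).
Local Notation U := (Uq (2 * n).-1 q).
Variable act : {bilinear U -> A -> A}.
Hypothesis act_initial : is_initial_action n_gt0 act.
Local Notation z := (z q).
Local Notation Eop i := (act (E q i)).
Local Notation Fop i := (act (F q i)).
Local Notation Kop i := (act (K q i)).
Local Notation Kiop i := (act (Kinv q i)).
Local Notation nn := (last_index n_gt0).
Local Notation mid := (mid n_gt0).
Local Notation ix := (ix n_gt0).
Local Notation gap_index := (gap_index n_gt0).
Local Notation low_index := (low_index n_gt0).
Local Notation h := (qpow q 2^-1).
Implicit Types (i j : 'I_(2 * n).-1) (f g : A) (a b al be : 'I_n).

Lemma qC_neq0 : qC != 0.
Proof. by rewrite eq_complex /= gt_eqF. Qed.

Lemma conj_real (x : R) : Num.conj (x%:C)%C = (x%:C)%C.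
Proof. by apply/conj_Creal; rewrite complex_real. Qed.

Lemma h_neq0 : h != 0.
Proof. by rewrite eq_complex /= gt_eqF // powR_gt0. Qed.

Lemma hh : h * h = qC.
Proof.
rewrite /qpow -rmorphM /= -powRD; last by rewrite (gt_eqF q_gt0) implybT.
by have -> : 2^-1 + 2^-1 = 1 :> R by [lra]; rewrite powRr1 // ltW.
Qed.

Lemma qpowN (x : R) : qpow q (- x) = (qpow q x)^-1.
Proof. by rewrite /qpow powRN fmorphV. Qed.

Lemma conj_h : Num.conj h = h. Proof. exact: conj_real. Qed.

Lemma q2_neq1 : 1 - qC ^+ 2 != 0.
Proof.
rewrite -rmorphXn -(rmorph1 (real_complex R)) -rmorphB eq_complex /= negb_and.
by rewrite gt_eqF // subr_gt0 expr_lt1 // ltW.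
Qed.

Let mod_alg := initial_module_algebra act_initial.

Lemma act1 f : act 1 f = f.
Proof. by case: mod_alg => -[]. Qed.

Lemma actM x y f : act (x * y) f = act x (act y f).
Proof. by case: mod_alg => -[]. Qed.

Lemma actD x f g : act x (f + g) = act x f + act x g. Proof. exact: linearDr. Qed.
Lemma actB x f g : act x (f - g) = act x f - act x g. Proof. exact: linearBr. Qed.
Lemma actZ x (c : C) f : act x (c *: f) = c *: act x f. Proof. exact: linearZr_LR. Qed.
Lemma act0 x : act x 0 = 0. Proof. exact: linear0r. Qed.
Lemma actDx x y f : act (x + y) f = act x f + act y f. Proof. exact: linearDl. Qed.
Lemma actBx x y f : act (x - y) f = act x f - act y f. Proof. exact: linearBl. Qed.
Lemma actZx (c : C) x f : act (c *: x) f = c *: act x f. Proof. exact: linearZl_LR. Qed.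

Lemma E_mul i f g : Eop i (f * g) = Eop i f * g + Kop i f * Eop i g.
Proof.
case: mod_alg => _ _ H; rewrite (H _ _ _ _ (coproduct_E q i)) !big_cons big_nil /=.
by rewrite addr0 act1.
Qed.

Lemma F_mul i f g : Fop i (f * g) = Fop i f * Kiop i g + f * Fop i g.
Proof.
case: mod_alg => _ _ H; rewrite (H _ _ _ _ (coproduct_F q i)) !big_cons big_nil /=.
by rewrite addr0 act1.
Qed.

Lemma K_mul i f g : Kop i (f * g) = Kop i f * Kop i g.
Proof.
by case: mod_alg => _ _ H; rewrite (H _ _ _ _ (coproduct_K q i)) big_cons big_nil addr0.
Qed.

Lemma Ki_mul i f g : Kiop i (f * g) = Kiop i f * Kiop i g.
Proof.
by case: mod_alg => _ _ H; rewrite (H _ _ _ _ (coproduct_Kinv q i)) big_cons big_nil addr0.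
Qed.

Let counit_gen x : counit (@agen _ (Uq_pres (2 * n).-1 q) x : U) = Uq_counit_gen R x.
Proof. exact: (counit_toAlg (Var x : aterm C (gens (Uq_pres (2 * n).-1 q)))). Qed.

Let act_gen1 x : act (@agen _ (Uq_pres (2 * n).-1 q) x : U) 1 = Uq_counit_gen R x *: 1.
Proof. by case: mod_alg => _ H _; rewrite H counit_gen. Qed.

Lemma E_1 i : Eop i 1 = 0. Proof. by rewrite [LHS]act_gen1 scale0r. Qed.
Lemma F_1 i : Fop i 1 = 0. Proof. by rewrite [LHS]act_gen1 scale0r. Qed.
Lemma K_1 i : Kop i 1 = 1. Proof. by rewrite [LHS]act_gen1 scale1r. Qed.
Lemma Ki_1 i : Kiop i 1 = 1. Proof. by rewrite [LHS]act_gen1 scale1r. Qed.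

Lemma KKi i f : Kop i (Kiop i f) = f.
Proof. by rewrite -actM Uq_relKKinv act1. Qed.
Lemma KiK i f : Kiop i (Kop i f) = f.
Proof. by rewrite -actM Uq_relKinvK act1. Qed.

Lemma K_E i j f : Kop i (Eop j f) = qC ^ cartan_A i j *: Eop j (Kop i f).
Proof. by rewrite -!actM Uq_relKE actZx. Qed.

Lemma K_F i j f : Kop i (Fop j f) = qC ^ (- cartan_A i j) *: Fop j (Kop i f).
Proof. by rewrite -!actM Uq_relKF actZx. Qed.

Lemma Ki_E i j f : Kiop i (Eop j f) = qC ^ (- cartan_A i j) *: Eop j (Kiop i f).
Proof.
rewrite -{1}(KKi i f).
have -> : Eop j (Kop i (Kiop i f)) = qC ^ (- cartan_A i j) *: Kop i (Eop j (Kiop i f)).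
  by rewrite K_E scalerA -expfzDr ?qC_neq0 // addNr expr0z scale1r.
by rewrite actZ KiK.
Qed.

Lemma Ki_F i j f : Kiop i (Fop j f) = qC ^ (cartan_A i j) *: Fop j (Kiop i f).
Proof.
rewrite -{1}(KKi i f).
have -> : Fop j (Kop i (Kiop i f)) = qC ^ (cartan_A i j) *: Kop i (Fop j (Kiop i f)).
  by rewrite K_F scalerA -expfzDr ?qC_neq0 // subrr expr0z scale1r.
by rewrite actZ KiK.
Qed.

Lemma E_F i j f : Eop i (Fop j f) =
  Fop j (Eop i f) + ((i == j)%:R / (qC - qC^-1)) *: (Kop i f - Kiop i f).
Proof.
rewrite -actBx -actZx -Uq_relEF actBx !actM.
by rewrite addrC subrK.
Qed.

Lemma E_F_neq i j f : i != j -> Eop i (Fop j f) = Fop j (Eop i f).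
Proof. by move=> /negPf ij; rewrite E_F ij mul0r scale0r addr0. Qed.

(** * Action on the generators, rows and columns treated alike *)

(** K_i rescales rows and columns. Its weight on columns is its weight on rows read
    at the mirror image of i in the Dynkin diagram. *)
Definition row_weight (i : 'I_(2 * n).-1) (a : 'I_n) : C :=
  if (i.+1 < n)%N then
    if a == i :> nat then qC else if a == i.+1 :> nat then qC^-1 else 1
  else if (i.+1 == n) && (a == nn) then qC else 1.
Local Notation rw := row_weight.
Local Notation cw i := (row_weight (rev_ord i)).

Lemma rw_neq0 i a : rw i a != 0.
Proof. by rewrite /rw; repeat case: ifP => _; rewrite ?invr_eq0 ?qC_neq0 ?oner_eq0. Qed.

Lemma K_z i a al : Kop i (z a al) = (rw i a * cw i al) *: z a al.
Proof.
have ri : (rev_ord i = (2 * n).-2 - i :> nat)%N by rewrite /=; case: n i => //= *; lia.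
have il := ltn_ord i.
have rlt : ((rev_ord i).+1 < n)%N = (n < i.+1)%N by rewrite ri; lia.
have req : ((rev_ord i).+1 == n)%N = (i.+1 == n)%N by rewrite ri; lia.
rewrite /row_weight rlt req.
have [lt_in|lt_ni|e_in] := ltngtP i.+1 n.
- by rewrite (initial_K_row act_initial) // !eqSS mulr1.
- have ij : i.+1 = (n + (i.+1 - n))%N by lia.
  rewrite (initial_K_col act_initial _ _ _ ij); last by lia.
  have -> : (al.+1 == n - (i.+1 - n))%N = (al == rev_ord i :> nat)%N by rewrite ri; lia.
  have -> : (al.+1 == (n - (i.+1 - n)).+1)%N = (al == (rev_ord i).+1 :> nat)%N by rewrite ri; lia.
  by rewrite mul1r.
- rewrite (initial_K_n act_initial) //=.
  by case: eqP => _; case: eqP => _ //=; rewrite ?mulr1 ?mul1r.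
Qed.

Lemma K_scale i f : Kop i f = scale_hom (rw i) (cw i) f.
Proof.
elim/qmat_ind: f => [|f a al IH|f g IHf IHg|c f IH].
- by rewrite K_1 scale_hom1.
- by rewrite K_mul scale_homM IH K_z scale_hom_z.
- by rewrite actD scale_homD IHf IHg.
- by rewrite actZ scale_homZ IH.
Qed.

Lemma Ki_z i a al : Kiop i (z a al) = (rw i a * cw i al)^-1 *: z a al.
Proof.
rewrite -{2}[z a al](KiK i) K_z actZ scalerA mulVf ?scale1r //.
by rewrite mulf_neq0 ?rw_neq0.
Qed.

(** With the same flag s as in ix, the transposed generators let rows and columns be
    treated by one formula. *)
Definition zs (s : bool) a b : A := if s then z b a else z a b.

Lemma zsN s a b : zs (~~ s) a b = zs s b a.
Proof. by case: s. Qed.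

Lemma K_zs s c a b : (c.+1 < n)%N -> Kop (ix s c) (zs s a b) =
  (if a == c :> nat then qC else if a == c.+1 :> nat then qC^-1 else 1) *: zs s a b.
Proof.
move=> cn; have H1 s' : ((ix s' c).+1 < n)%N = ~~ s'.
  by rewrite val_ix //; case: s' => /=; lia.
have H2 s' : ((ix s' c).+1 == n)%N = false.
  by apply/eqP; exact: ix_neq.
have H3 : ix false c = c :> nat by rewrite val_ix.
by case: s; rewrite K_z rev_ix // /row_weight !H1 !H2 /= H3 ?mulr1 ?mul1r.
Qed.

Lemma F_zs s c a b : (c.+1 < n)%N -> Fop (ix s c) (zs s a b) =
  if a == c :> nat then h *: zs s (ordS a) b else 0.
Proof.
move=> cn; case: s => /=.
  have e : (ix true c).+1 = (n + (n.-1 - c))%N by rewrite val_ix //; lia.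
  rewrite (initial_F_col act_initial _ _ _ e); last by lia.
  by rewrite (_ : (_ == _ - _)%N = (a == c :> nat)) //; lia.
rewrite (initial_F_row act_initial) ?val_ix //.
Qed.

Lemma E_zs s c a b : (c.+1 < n)%N -> Eop (ix s c) (zs s a b) =
  if a == c.+1 :> nat then h^-1 *: zs s (ord_pred a) b else 0.
Proof.
rewrite -qpowN; move=> cn; case: s => /=.
  have e : (ix true c).+1 = (n + (n.-1 - c))%N by rewrite val_ix //; lia.
  rewrite (initial_E_col act_initial _ _ _ e); last by lia.
  by rewrite (_ : (_ == (_ - _).+1)%N = (a == c.+1 :> nat)) //; lia.
rewrite (initial_E_row act_initial) ?val_ix //.
Qed.

Lemma F_mid_z a al : Fop mid (z a al) = if (a == nn) && (al == nn) then h%:A else 0.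
Proof. exact: (initial_F_n act_initial) mid_n. Qed.

Lemma K_mid_rw a : rw mid a = if a == nn then qC else 1.
Proof. by rewrite /row_weight mid_n ltnn eqxx. Qed.

Lemma zsE s a al : z a al = if s then zs s al a else zs s a al.
Proof. by case: s. Qed.

Lemma qmat_ind_zs s (P : A -> Prop) :
  P 1 -> (forall f a b, P f -> P (f * zs s a b)) ->
  (forall f g, P f -> P g -> P (f + g)) -> (forall (c : C) f, P f -> P (c *: f)) ->
  forall f, P f.
Proof.
move=> P1 Pz PD PZ; elim/qmat_ind => // f a al Pf.
by rewrite (zsE s); case: ifP => _; apply: Pz.
Qed.

Lemma eps_zs s a b : eps (zs s a b) = (a == b)%:R.
Proof. by case: s; rewrite /= eps_z // eq_sym. Qed.

Let subZ (x : A) (c : C) : x - c *: x = (1 - c) *: x.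
Proof. by rewrite scalerBl scale1r. Qed.

(** Both sides are skew derivations with respect to K, so only generators have to be
    compared, and there z_n^n commutes up to powers of q and one cross term. *)
Lemma E_midE g :
  Eop mid g = - (h / (1 - qC ^+ 2)) *: (z nn nn * g - Kop mid g * z nn nn).
Proof.
have q2 := q2_neq1; have q0 := qC_neq0; have h0 := h_neq0; have hq := hh.
elim/qmat_ind: g => [|f a al IH|f g IHf IHg|c f IH].
- by rewrite E_1 K_1 mulr1 mul1r subrr scaler0.
- rewrite E_mul IH K_mul; set x := Kop mid f.
  suff -> : Eop mid (z a al) =
      - (h / (1 - qC ^+ 2)) *: (z nn nn * z a al - Kop mid (z a al) * z nn nn).
    rewrite -scalerAl -scalerAr -scalerDr mulrBl mulrBr !mulrA; congr (_ *: _).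
    by rewrite addrA subrK.
  rewrite (initial_E_n act_initial _ _ mid_n) qpowN K_z rev_mid !K_mid_rw.
  have le_nn (b : 'I_n) : b != nn -> (b < nn)%N.
    by move=> bn; have := ltn_ord b; have : b != nn :> nat by []; rewrite /=; lia.
  have [->|an] := eqVneq a nn; have [->|aln] := eqVneq al nn.
  + rewrite /= -scalerAl subZ scalerA expr2; congr (_ *: _).
    by rewrite mulNr -expr2 divfK.
  + rewrite /= mulr1 -scalerAl (z_q q (or_introl (conj erefl (le_nn al aln)))).
    by rewrite scalerA subZ scalerA; congr (_ *: _); rewrite mulNr -expr2 divfK.
  + rewrite /= mul1r -scalerAl (z_q q (or_intror (conj (le_nn a an) erefl))).
    by rewrite scalerA subZ scalerA; congr (_ *: _); rewrite mulNr -expr2 divfK.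
  + rewrite /= mulr1 scale1r (z_cross q (le_nn a an) (le_nn al aln)).
    rewrite opprD addNKr scalerN scalerA -scaleNr; congr (_ *: _).
    by rewrite -hq; field; rewrite h0 hq q2.
- by rewrite !actD IHf IHg mulrDr mulrDl -scalerDr opprD addrACA.
- by rewrite !actZ IH -scalerAl -scalerAr -scalerBr !scalerA mulrC.
Qed.

(** * Evaluation at the identity *)

Lemma eps_K s c f : (c.+1 < n)%N ->
  eps (Kop (ix s c) f) = eps (Kop (ix (~~ s) c) f).
Proof.
move=> cn; elim/(@qmat_ind_zs s): f => [|f a b IH|f g IHf IHg|x f IH].
- by rewrite !K_1.
- rewrite !K_mul !epsM IH; congr (_ * _).
  rewrite K_zs // -[zs s a b]zsN K_zs // !epsZ eps_zs.
  by have [->|] := eqVneq b a; rewrite ?mulr0.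
- by rewrite !actD !epsD IHf IHg.
- by rewrite !actZ !epsZ IH.
Qed.

(** Row and column operators are transposes of each other at the identity matrix:
    both sides are skew derivations along eps and agree on generators. *)
Lemma eps_E s c f : (c.+1 < n)%N ->
  eps (Eop (ix s c) f) = qC ^- 2 * eps (Fop (ix (~~ s) c) (Kop (ix (~~ s) c) f)).
Proof.
have q0 := qC_neq0; have h0 := h_neq0; have hq := hh.
move=> cn; elim/(@qmat_ind_zs s): f => [|f a b IH|f g IHf IHg|x f IH].
- by rewrite E_1 K_1 F_1 !eps0 mulr0.
- rewrite E_mul K_mul F_mul KiK !epsD !epsM mulrDr mulrA -IH eps_K // mulrCA.
  congr (_ + _ * _).
  rewrite E_zs // -[zs s a b]zsN K_zs // actZ F_zs //.
  have [bc|bc] := eqVneq (b : nat) c.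
    have [ac|ac] := eqVneq (a : nat) c.+1.
      rewrite !epsZ !eps_zs.
      have -> : ord_pred a = b by apply: val_inj; rewrite [LHS](val_ord_pred ac) /= bc.
      have -> : ordS b = a by apply: val_inj; rewrite /= bc ac modn_small.
      by rewrite !eqxx !mulr1 -hq; field; rewrite h0.
    rewrite !epsZ eps_zs eps0 (_ : (ordS b == a) = false) ?mulr0 //.
    by apply/eqP => /(congr1 val) /=; rewrite bc modn_small // => e; rewrite e eqxx in ac.
  rewrite scaler0 eps0 mulr0; case: eqP => ac; last by rewrite eps0.
  rewrite epsZ eps_zs (_ : (ord_pred a == b) = false) ?mulr0 //.
  by apply/eqP => /(congr1 val) e; move: bc; rewrite -e [val _](val_ord_pred ac) eqxx.
- by rewrite !actD !epsD IHf IHg mulrDr.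
- by rewrite !actZ !epsZ IH mulrCA.
Qed.

Lemma eps_F s c f : (c.+1 < n)%N ->
  eps (Fop (ix s c) f) = qC ^+ 2 * eps (Eop (ix (~~ s) c) (Kiop (ix s c) f)).
Proof.
by move=> cn; rewrite eps_E // negbK KKi mulrA divff ?mul1r // expf_neq0 ?qC_neq0.
Qed.

(** Both sides are skew derivations for the two characters eps o Kinv and eps; on
    the right the derivation is inner, the difference of the characters. *)
Lemma eps_F_mid f : eps (Fop mid f) = h / (qC ^- 2 - 1) * (eps (Kiop mid f) - eps f).
Proof.
have q0 := qC_neq0; have h0 := h_neq0; have hq := hh; have q2 := q2_neq1.
have q2' : qC ^- 2 - 1 != 0.
  by rewrite subr_eq0 -(inj_eq invr_inj) invrK invr1 eq_sym -subr_eq0.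
elim/qmat_ind: f => [|f a al IH|f g IHf IHg|x f IH].
- by rewrite F_1 Ki_1 subrr mulr0 eps0.
- rewrite F_mul Ki_mul epsD !epsM IH.
  have -> : eps (Fop mid (z a al)) = h / (qC ^- 2 - 1) * (eps (Kiop mid (z a al)) - eps (z a al)).
    rewrite F_mid_z Ki_z rev_mid !K_mid_rw epsZ eps_z.
    have [->|an] := eqVneq a nn; have [e|aln] := eqVneq al nn; rewrite /= ?eps0.
    + by rewrite mulr1 epsZ eps1 mulr1 -expr2 mulfVK.
    + by rewrite mulr0 subrr mulr0.
    + by rewrite e (negPf an) mulr0 subrr mulr0.
    + by rewrite mulr1 invr1 mul1r subrr mulr0.
  by ring.
- by rewrite !actD !epsD IHf IHg; ring.
- by rewrite !actZ !epsZ IH; ring.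
Qed.

(** * Degrees under the action *)

Lemma homog_zs s a b : homog 1 (zs s a b).
Proof. by case: s; apply: homog_gen. Qed.

Lemma K_homog i d f : homog d f -> homog d (Kop i f).
Proof.
elim=> [|{}d {}f a al _ IH|{}d|{}d f1 f2 _ IH1 _ IH2|{}d x {}f _ IH].
- by rewrite K_1; apply: homog1.
- by rewrite K_mul K_z -scalerAl; apply/homogZ/homog_z.
- by rewrite act0; apply: homog0.
- by rewrite actD; apply: homogD.
- by rewrite actZ; apply: homogZ.
Qed.

Lemma Ki_homog i d f : homog d f -> homog d (Kiop i f).
Proof.
elim=> [|{}d {}f a al _ IH|{}d|{}d f1 f2 _ IH1 _ IH2|{}d x {}f _ IH].
- by rewrite Ki_1; apply: homog1.
- by rewrite Ki_mul Ki_z -scalerAl; apply/homogZ/homog_z.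
- by rewrite act0; apply: homog0.
- by rewrite actD; apply: homogD.
- by rewrite actZ; apply: homogZ.
Qed.

Lemma E_homog s c d f : (c.+1 < n)%N -> homog d f -> homog d (Eop (ix s c) f).
Proof.
move=> cn; elim=> [|{}d {}f a al Hf IH|{}d|{}d f1 f2 _ IH1 _ IH2|{}d x {}f _ IH].
- by rewrite E_1; apply: homog0.
- rewrite E_mul K_z -scalerAl; apply: homogD; last exact/homogZ/homog_z.
  rewrite -[d.+1]add1n; apply: homogM => //.
  have [u [v ->]] : exists u v, z a al = zs s u v by case: (s); [exists al, a|exists a, al].
  by rewrite E_zs //; case: ifP => _; [apply/homogZ/homog_zs|apply: homog0].
- by rewrite act0; apply: homog0.
- by rewrite actD; apply: homogD.
- by rewrite actZ; apply: homogZ.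
Qed.

Lemma F_homog s c d f : (c.+1 < n)%N -> homog d f -> homog d (Fop (ix s c) f).
Proof.
move=> cn; elim=> [|{}d {}f a al Hf IH|{}d|{}d f1 f2 _ IH1 _ IH2|{}d x {}f _ IH].
- by rewrite F_1; apply: homog0.
- rewrite F_mul; apply: homogD; last exact/homog_z.
  rewrite -[d.+1]add1n; apply: homogM; last exact: Ki_homog.
  have [u [v ->]] : exists u v, z a al = zs s u v by case: (s); [exists al, a|exists a, al].
  by rewrite F_zs //; case: ifP => _; [apply/homogZ/homog_zs|apply: homog0].
- by rewrite act0; apply: homog0.
- by rewrite actD; apply: homogD.
- by rewrite actZ; apply: homogZ.
Qed.

Lemma F_mid_homog d f : homog d.+1 f -> homog d (Fop mid f).
Proof.
move: {-1}d.+1 (erefl d.+1) => e ed Hf.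
suff : homog e.-1 (Fop mid f) by rewrite -ed.
elim: Hf => {d ed f} [|d f a al Hf IH|d|d f1 f2 _ IH1 _ IH2|d x f _ IH].
- by rewrite F_1; apply: homog0.
- rewrite F_mul; apply: homogD => /=.
    rewrite F_mid_z; case: ifP => _; last by rewrite mul0r; apply: homog0.
    by rewrite mulr_algl; apply/homogZ/Ki_homog.
  case: d Hf IH => [|d] Hf IH; last exact: homog_z.
  suff -> : Fop mid f = 0 by rewrite mulr0; apply: homog0.
  have : inspan (homog_words n q 0) f by exact: homog_inspan.
  move=> [c] /= /eqP; rewrite subr_eq0 => /eqP ->.
  by rewrite actZ F_1 scaler0.
- by rewrite act0; apply: homog0.
- by rewrite actD; apply: homogD.
- by rewrite actZ; apply: homogZ.
Qed.

Lemma compact_homog x d f : Uq_compact x -> homog d f -> homog d (act x f).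
Proof.
move=> Hx; elim: Hx f => {x} [i /ixP [s [c [cn ->]]]|i /ixP [s [c [cn ->]]]|i|i|
  |x y _ IHx _ IHy|c x _ IHx|x y _ IHx _ IHy] f Hf.
- exact: E_homog.
- exact: F_homog.
- exact: K_homog.
- exact: Ki_homog.
- by rewrite act1.
- by rewrite actDx; apply: homogD; [apply: IHx|apply: IHy].
- by rewrite actZx; apply/homogZ/IHx.
- by rewrite actM; apply/IHx/IHy.
Qed.

(** * Orbits on which the evaluation vanishes *)

(** S is a subspace stable under one half X of the compact generators and under
    all K. Applying the other half Y builds up layers over S. *)
Section CounitVanishing.
Variables (t : bool) (S : A -> Prop).
Hypothesis SK : forall i f, S f -> S (Kop i f).
Hypothesis SKi : forall i f, S f -> S (Kiop i f).
Let X i : U := if t then E q i else F q i.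
Let Y i : U := if t then F q i else E q i.
Hypothesis SX : forall i f, i.+1 <> n -> S f -> S (act (X i) f).
Hypothesis S_eps : forall f, S f -> eps f = 0.

Inductive layer : nat -> A -> Prop :=
| layer0 f : S f -> layer 0 f
| layerY m i f : i.+1 <> n -> layer m f -> layer m.+1 (act (Y i) f)
| layerS m f : layer m f -> layer m.+1 f
| layerD m f g : layer m f -> layer m g -> layer m (f + g)
| layerZ m (c : C) f : layer m f -> layer m (c *: f).

Lemma layer_le m m' f : (m <= m')%N -> layer m f -> layer m' f.
Proof. by move=> /subnKC <- Hf; elim: (m' - m)%N => [|k IH]; rewrite ?addn0 ?addnS //; apply: layerS. Qed.

Lemma layerK m i f : layer m f -> layer m (Kop i f) /\ layer m (Kiop i f).
Proof.
elim=> {m f} [f Sf|m j f jn Hf [IH1 IH2]|m f _ [IH1 IH2]|m f g _ [IHf1 IHf2] _ [IHg1 IHg2]|m c f _ [IH1 IH2]].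
- by split; apply: layer0; [apply: SK|apply: SKi].
- have [[c ->] [c' ->]] : (exists c, Kop i (act (Y j) f) = c *: act (Y j) (Kop i f)) /\
      (exists c, Kiop i (act (Y j) f) = c *: act (Y j) (Kiop i f)).
    by rewrite /Y; case: (t) => /=; rewrite ?(K_E, K_F, Ki_E, Ki_F); split; eexists.
  by split; apply: layerZ; apply: layerY.
- by split; apply: layerS.
- by rewrite !actD; split; apply: layerD.
- by rewrite !actZ; split; apply: layerZ.
Qed.

(** Moving X past Y leaves only K terms, which lie in the previous layer. *)
Lemma layerX m i f : i.+1 <> n -> layer m f -> layer m (act (X i) f).
Proof.
move=> ni; elim=> {m f} [f Sf|m j f jn Hf IH|m f _ IH|m f g _ IHf _ IHg|m c f _ IH].
- by apply: layer0; apply: SX.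
- have [c ->] : exists c, act (X i) (act (Y j) f) = act (Y j) (act (X i) f) + c *: (Kop i f - Kiop i f).
    rewrite /X /Y; case: (t).
      by exists ((i == j)%:R / (qC - qC^-1)); rewrite E_F.
    eexists (- ((i == j)%:R / (qC - qC^-1))); rewrite E_F scaleNr.
    by have [->|ij] := eqVneq i j; [rewrite addrK|rewrite mul0r !scale0r subr0 addr0].
  apply: layerD; first exact: layerY.
  have [H1 H2] := layerK i Hf.
  by apply: layerZ; apply: layerS; apply: layerD => //; rewrite -scaleN1r; apply: layerZ.
- exact: layerS.
- by rewrite actD; apply: layerD.
- by rewrite actZ; apply: layerZ.
Qed.

(** Evaluation turns the outermost Y into an X for the mirrored root, and X does not
    raise the layer; so the layers can be peeled off. *)
Lemma layer_eps m f : layer m f -> eps f = 0.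
Proof.
elim/ltn_ind: m f => m IHm f Hf; elim: Hf IHm => {m f} [f Sf|m j f jn Hf _|m f Hf _
  |m f g _ IHf _ IHg|m c f _ IH] IHm.
- exact: S_eps.
- have [s [c [cn ej]]] := ixP jn; rewrite {1}ej /Y.
  have lX g : layer m g -> eps (act (X (ix (~~ s) c)) g) = 0.
    by move=> Hg; apply: (IHm m) => //; apply: layerX => //; apply: ix_neq.
  move: lX; rewrite /X; case: (t) => lX.
    by rewrite eps_F // lX ?mulr0 //; case: (layerK (ix s c) Hf).
  by rewrite eps_E // lX ?mulr0 //; case: (layerK (ix (~~ s) c) Hf).
- exact: (IHm m).
- by rewrite epsD IHf // IHg // addr0.
- by rewrite epsZ IH // mulr0.
Qed.

Lemma compact_eps x f : Uq_compact x -> S f -> eps (act x f) = 0.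
Proof.
move=> Hx Sf; suff [m /layer_eps] : exists m, layer m (act x f) by [].
have : exists m, layer m f by exists 0%N; apply: layer0.
have XY i : i.+1 <> n -> forall g, (exists m, layer m g) ->
    (exists m, layer m (Eop i g)) /\ (exists m, layer m (Fop i g)).
  move=> ni g [m Hg]; have := layerX ni Hg; have := layerY ni Hg; rewrite /X /Y.
  by case: (t) => H1 H2; split; [exists m|exists m.+1|exists m.+1|exists m].
elim: Hx f {Sf} => {x} [i ni|i ni|i|i||x y _ IHx _ IHy|c x _ IHx|x y _ IHx _ IHy] f Hf.
- by case: (XY i ni f Hf).
- by case: (XY i ni f Hf).
- by case: Hf => m Hf; exists m; case: (layerK i Hf).
- by case: Hf => m Hf; exists m; case: (layerK i Hf).
- by rewrite act1.
- have [m1 H1] := IHx _ Hf; have [m2 H2] := IHy _ Hf.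
  exists (maxn m1 m2); rewrite actDx.
  by apply: layerD; [apply: layer_le H1|apply: layer_le H2]; rewrite ?leq_maxl ?leq_maxr.
- by have [m H] := IHx _ Hf; exists m; rewrite actZx; apply: layerZ.
- by rewrite actM; apply/IHx/IHy.
Qed.

End CounitVanishing.

(** * The involution *)

Lemma conj_qC : Num.conj qC = qC. Proof. exact: conj_real. Qed.
Lemma conj_qCV : Num.conj qC^-1 = qC^-1.
Proof. by rewrite -fmorphV conj_real. Qed.
Lemma conj_hV : Num.conj h^-1 = h^-1.
Proof. by rewrite -fmorphV conj_real. Qed.

Lemma conj_rw i a : Num.conj (rw i a) = rw i a.
Proof. by rewrite /rw; repeat case: ifP => _; rewrite ?conj_qC ?conj_qCV ?rmorph1. Qed.

Lemma starE i : i.+1 <> n -> star (E q i) = K q i * F q i :> U.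
Proof. by move=> /eqP/negPf ni; rewrite [LHS]star_agen // /star_gen ni. Qed.

Lemma starF i : i.+1 <> n -> star (F q i) = E q i * Kinv q i :> U.
Proof. by move=> /eqP/negPf ni; rewrite [LHS]star_agen // /star_gen ni. Qed.

Lemma starK i : star (K q i) = K q i :> U.
Proof. by rewrite [LHS]star_agen. Qed.

Lemma starKinv i : star (Kinv q i) = Kinv q i :> U.
Proof. by rewrite [LHS]star_agen. Qed.

(** * Setting rows or columns to zero *)

(** The endomorphism that sends to zero the generators in the rows (columns if s
    holds) of index less than t. *)
Definition rowkill (s : bool) (t : nat) : A -> A :=
  if s then scale_hom (fun=> 1) (fun a => (t <= a)%N%:R)
  else scale_hom (fun a => (t <= a)%N%:R) (fun=> 1).

Section RowKill.
Variables (s : bool) (t : nat).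

Lemma rowkill_zs a b : rowkill s t (zs s a b) = (t <= a)%N%:R *: zs s a b.
Proof. by rewrite /rowkill /zs; case: (s); rewrite scale_hom_z ?mul1r ?mulr1. Qed.

Lemma rowkill1 : rowkill s t 1 = 1.
Proof. by rewrite /rowkill; case: (s); rewrite scale_hom1. Qed.

Lemma rowkillM f g : rowkill s t (f * g) = rowkill s t f * rowkill s t g.
Proof. by rewrite /rowkill; case: (s); rewrite scale_homM. Qed.

Lemma rowkillD f g : rowkill s t (f + g) = rowkill s t f + rowkill s t g.
Proof. by rewrite /rowkill; case: (s); rewrite scale_homD. Qed.

Lemma rowkillZ c f : rowkill s t (c *: f) = c *: rowkill s t f.
Proof. by rewrite /rowkill; case: (s); rewrite scale_homZ. Qed.

Lemma rowkill0 : rowkill s t 0 = 0.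
Proof. by have := rowkillZ 0 0; rewrite !scale0r. Qed.

Lemma rowkill_K i f : Kop i (rowkill s t f) = rowkill s t (Kop i f).
Proof.
elim/qmat_ind: f => [|f a al IH|f g IHf IHg|x f IH].
- by rewrite K_1 rowkill1 K_1.
- rewrite rowkillM !K_mul rowkillM IH; congr (_ * _).
  have [c e] : exists c, rowkill s t (z a al) = c *: z a al.
    by rewrite /rowkill; case: (s); rewrite scale_hom_z; eexists.
  by rewrite e actZ K_z rowkillZ e !scalerA mulrC.
- by rewrite rowkillD !actD rowkillD IHf IHg.
- by rewrite rowkillZ !actZ rowkillZ IH.
Qed.

Lemma rowkill_Ki i f : Kiop i (rowkill s t f) = rowkill s t (Kiop i f).
Proof. by rewrite -{1}(KKi i f) -rowkill_K KiK. Qed.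

(** E carries the index c + 1 to c, and so commutes with the truncation when it acts
    on the other side. *)
Lemma rowkill_E_other c f : (c.+1 < n)%N ->
  Eop (ix (~~ s) c) (rowkill s t f) = rowkill s t (Eop (ix (~~ s) c) f).
Proof.
move=> cn; elim/(@qmat_ind_zs s): f => [|f a b IH|f g IHf IHg|x f IH].
- by rewrite rowkill1 E_1 rowkill0.
- rewrite rowkillM !E_mul rowkillD !rowkillM IH rowkill_K; congr (_ + _ * _).
  rewrite rowkill_zs actZ -zsN E_zs //; case: ifP => _; last by rewrite scaler0 rowkill0.
  by rewrite rowkillZ zsN rowkill_zs !scalerA mulrC.
- by rewrite rowkillD !actD rowkillD IHf IHg.
- by rewrite rowkillZ !actZ rowkillZ IH.
Qed.

Lemma rowkill_E_same c f : (c.+1 < n)%N -> (c.+1 < t)%N ->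
  Eop (ix s c) (rowkill s t f) = 0.
Proof.
move=> cn ct; elim/(@qmat_ind_zs s): f => [|f a b IH|f g IHf IHg|x f IH].
- by rewrite rowkill1 E_1.
- rewrite rowkillM !E_mul IH mul0r add0r rowkill_zs actZ E_zs //.
  case: eqP => [->|_]; last by rewrite scaler0 mulr0.
  by rewrite leqNgt ct scale0r mulr0.
- by rewrite rowkillD actD IHf IHg addr0.
- by rewrite rowkillZ actZ IH scaler0.
Qed.

End RowKill.

(** * Adjoints in an invariant form *)

Lemma compact_star x : Uq_compact x -> Uq_compact (star x : U).
Proof.
elim=> {x} [i ni|i ni|i|i||x y _ IHx _ IHy|c x _ IHx|x y _ IHx _ IHy].
- by rewrite starE //; do 2!constructor.
- by rewrite starF //; do 2!constructor.
- by rewrite starK; constructor.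
- by rewrite starKinv; constructor.
- by rewrite star1 //; constructor.
- by rewrite starD //; constructor.
- by rewrite starZ //; constructor.
- by rewrite starM //; constructor.
Qed.

Section InvariantForm.
Variable form : {dot A for (Num.conj : C -> C)}.
Hypothesis form_inv : invariant_form (@Uq_compact R n q) act form.

Lemma adjF i f g : i.+1 <> n -> form (Fop i f) g = form f (Eop i (Kiop i g)).
Proof. by move=> ni; rewrite form_inv ?starF ?actM //; constructor. Qed.

Lemma adjE i f g : i.+1 <> n -> form (Eop i f) g = form f (Kop i (Fop i g)).
Proof. by move=> ni; rewrite form_inv ?starE ?actM //; constructor. Qed.

Lemma adjK i f g : form (Kop i f) g = form f (Kop i g).
Proof. by rewrite form_inv ?starK //; constructor. Qed.

Lemma adjF_r i f g : i.+1 <> n -> form f (Fop i g) = form (Eop i (Kiop i f)) g.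
Proof. by move=> ni; rewrite formC adjF // -formC. Qed.

Lemma adjE_r i f g : i.+1 <> n -> form f (Eop i g) = form (Kop i (Fop i f)) g.
Proof. by move=> ni; rewrite formC adjE // -formC. Qed.

End InvariantForm.

(** * A coefficient of one-forms *)

(** The coefficient of dz_s^s, taken after the generators in rows and columns before
    s have been set to zero. The R-matrix is triangular: modulo those generators,
    moving f across some dz produces dz_s^s from dz_s^s only, and then f is
    rescaled in row and column s. So the coefficient is well defined, and it turns
    left and right multiplication by f into multiplication by corner f and by
    corner_twist f. *)
Section CornerCoefficient.
Variable s : 'I_n.

Definition corner : A -> A := scale_hom (fun a => (s <= a)%N%:R) (fun a => (s <= a)%N%:R).
Let cq (a : 'I_n) : C := (s <= a)%N%:R * (if a == s then qC else 1).
Definition corner_twist : A -> A := scale_hom cq cq.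

Fixpoint bterm_coef (u : bterm A ('I_n * 'I_n)) : A :=
  match u with
  | BZero => 0
  | BVar p => ((p.1 == s) && (p.2 == s))%:R
  | BAdd u v => bterm_coef u + bterm_coef v
  | BLmul f u => corner f * bterm_coef u
  | BRmul u f => bterm_coef u * corner_twist f
  end.

Let Rmat_s (b a : 'I_n) : Rmat q b a b s * cq b = (a == s)%:R * (s <= b)%N%:R.
Proof.
rewrite /Rmat /cq; have [->|ba] := eqVneq b a; rewrite ?eqxx ?andbT ?andbF ?ltnn /=.
  by case: (a == s); rewrite ?mul0r // mul1r mulrCA mulVf ?qC_neq0 // mulr1.
have [as_|] := eqVneq a s; rewrite /= ?mul0r //.
by move: ba; rewrite as_ => /negPf ->; rewrite mulr1.
Qed.

Let Rmat_s0 (b a b' : 'I_n) : b' != b -> Rmat q b a b' s * cq b' = 0.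
Proof.
move=> bb'; rewrite /Rmat /cq [b == b']eq_sym (negPf bb') !andbF.
case: ifP => [/and3P [ab /eqP <- /eqP bs]|_]; last by rewrite mul0r.
by rewrite leqNgt -bs ab mul0r mulr0.
Qed.

Let bterm_coef_rel u v : Omega1_rel (q := q) u v -> bterm_coef u = bterm_coef v.
Proof.
case=> a b al be.
rewrite (big_morph bterm_coef (id1 := 0) (op1 := +%R)) //=.
pose T (p : ('I_n * 'I_n) * ('I_n * 'I_n)) : A :=
  (Rmat q be al p.2.2 p.1.2 * Rmat q b a p.2.1 p.1.1) *:
    (((p.1.1 == s) && (p.1.2 == s))%:R * corner_twist (z p.2.1 p.2.2)).
rewrite (eq_bigr T); last first.
  move=> [[a' al'] [b' be']] _; rewrite /T /= /corner scale_homZ scale_hom1.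
  by rewrite mulr_algl.
rewrite (bigD1 ((s, s), (b, be))) //= big1 ?addr0.
  rewrite /T /= !eqxx mul1r /corner_twist /corner !scale_hom_z scalerA.
  rewrite [cq b * _]mulrC mulrACA !Rmat_s.
  rewrite mulr_natr -scaler_nat scalerA; congr (_ *: _).
  by case: (a == s); case: (al == s); rewrite /= ?mul1r ?mul0r ?mulr0 // mulrC.
move=> [[a' al'] [b' be']] /=; rewrite /T /= !xpair_eqE.
have [->|] := eqVneq a' s; last by rewrite mul0r scaler0.
have [->|] := eqVneq al' s; last by rewrite mul0r scaler0.
rewrite /= mul1r /corner_twist scale_hom_z scalerA [cq b' * _]mulrC mulrACA => ne.
have [bb'|bb'] := eqVneq b' b; last by rewrite (Rmat_s0 _ bb') mulr0 scale0r.
have [cc'|cc'] := eqVneq be' be; last by rewrite (Rmat_s0 _ cc') mul0r scale0r.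
by rewrite bb' cc' !eqxx in ne.
Qed.

Lemma bterm_coef_cong u v : bcong (@Omega1_rel R n q) u v -> bterm_coef u = bterm_coef v.
Proof.
have corner_scalar (c : C) x : corner c%:A * x = x * corner_twist c%:A.
  by rewrite /corner /corner_twist !scale_homZ !scale_hom1 mulr_algl mulr_algr.
elim=> //= {u v}.
- by move=> u v w _ -> _ ->.
- by move=> u u' v v' _ -> _ ->.
- by move=> f u u' _ ->.
- by move=> f u u' _ ->.
- by move=> u v w; rewrite addrA.
- by move=> u v; rewrite addrC.
- by move=> u; rewrite add0r.
- move=> u; rewrite -[-1]scaleN1r /corner scale_homZ scale_hom1 mulr_algl scaleN1r.
  by rewrite addNr.
- by move=> f g u; rewrite /corner scale_homM mulrA.
- by move=> u; rewrite /corner scale_hom1 mul1r.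
- by move=> f u v; rewrite mulrDr.
- by move=> f g u; rewrite /corner scale_homD mulrDl.
- by move=> f g u; rewrite /corner_twist scale_homM mulrA.
- by move=> u; rewrite /corner_twist scale_hom1 mulr1.
- by move=> f u v; rewrite mulrDl.
- by move=> f g u; rewrite /corner_twist scale_homD mulrDr.
- by move=> f g u; rewrite mulrA.
Qed.

Definition coef (x : Omega1 n q) : A := bterm_coef (repr (x : presBimod (@Omega1_rel R n q))).

Lemma coef_to u : coef (toBimod (@Omega1_rel R n q) u) = bterm_coef u.
Proof. exact: (bterm_coef_cong (repr_toBimod _ u)). Qed.

Let reprE (x : Omega1 n q) : x = toBimod (@Omega1_rel R n q) (repr (x : presBimod (@Omega1_rel R n q))).
Proof. by rewrite toBimod_repr. Qed.

Lemma coefD x y : coef (x + y) = coef x + coef y.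
Proof. by rewrite {1}(reprE x) {1}(reprE y) -toBimodD coef_to. Qed.

Lemma coefZ f x : coef (f *: x) = corner f * coef x.
Proof. by rewrite {1}(reprE x) -toBimodZ coef_to. Qed.

Lemma coef_rmul x f : coef (rmul x f) = coef x * corner_twist f.
Proof. by rewrite {1}(reprE x) rmulE coef_to. Qed.

Lemma coef_dz a al : coef (dz q a al) = ((a == s) && (al == s))%:R.
Proof. exact: coef_to. Qed.

End CornerCoefficient.

(** * Lowest vectors *)

Lemma Ki_zs s c a b : (c.+1 < n)%N -> Kiop (ix s c) (zs s a b) =
  (if a == c :> nat then qC else if a == c.+1 :> nat then qC^-1 else 1)^-1 *: zs s a b.
Proof.
move=> cn; rewrite -{2}[zs s a b](KiK (ix s c)) K_zs // actZ scalerA mulVf ?scale1r //.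
by repeat case: ifP => _; rewrite ?invr_eq0 ?qC_neq0 ?oner_eq0.
Qed.

Lemma cartan_ix_mid s a : (a.+1 < n)%N ->
  rw mid (ordS a) = qC ^ (- cartan_A (ix s a) mid) * rw mid a.
Proof.
move=> an; rewrite /cartan_A (negPf (ix_neq_mid s an)) !K_mid_rw /adjacent val_ix //.
have -> : (a == nn) = false by apply/eqP => /(congr1 val) /=; lia.
have -> : (ordS a == nn) = (a.+2 == n).
  by apply/eqP/eqP => [/(congr1 val)|e] /=; [|apply: val_inj]; rewrite /= modn_small //; lia.
rewrite mulr1; have -> : (((if s then (2 * n).-2 - a else a).+1 == n.-1)
  || (n.-1.+1 == (if s then (2 * n).-2 - a else a)))%N = (a.+2 == n)%N.
  by case: s; apply/orP/eqP => [[]/eqP|]; lia.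
by case: ifP => _; rewrite ?opprK ?oppr0.
Qed.

Record lowest (m : nat) (chi : 'I_(2 * n).-1 -> C) (v : A) : Prop := {
  lowest_homog : homog m v;
  lowest_F : forall i, i.+1 <> n -> Fop i v = 0;
  lowest_K : forall i, Kop i v = chi i *: v }.

(** * Lowering operators on minors *)

Lemma prodZ m (c : 'I_m -> C) (x : 'I_m -> A) :
  \prod_(t < m) (c t *: x t) = (\prod_(t < m) c t) *: \prod_(t < m) x t.
Proof.
elim: m c x => [|m IH] c x; first by rewrite !big_ord0 scale1r.
by rewrite !big_ord_recl IH -scalerAl -scalerAr scalerA.
Qed.

Lemma scale_hom_prod c c' m (x : 'I_m -> A) :
  scale_hom c c' (\prod_(t < m) x t) = \prod_(t < m) scale_hom c c' (x t).
Proof. by apply: big_morph; [exact: scale_homM|exact: scale_hom1]. Qed.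

Lemma Ki_prod i m (x : 'I_m -> A) :
  Kiop i (\prod_(t < m) x t) = \prod_(t < m) Kiop i (x t).
Proof. by apply: big_morph; [exact: Ki_mul|exact: Ki_1]. Qed.

Lemma F_prod0 i m (x : 'I_m -> A) : (forall t, Fop i (x t) = 0) ->
  Fop i (\prod_(t < m) x t) = 0.
Proof.
elim: m x => [|m IH] x H; first by rewrite big_ord0 F_1.
by rewrite big_ord_recl F_mul H mul0r IH // mulr0 addr0.
Qed.

Let lift0E m (t t' : 'I_m) : (lift ord0 t == lift ord0 t') = (t == t').
Proof. by apply: inj_eq; exact: lift_inj. Qed.

(** F kills every factor but the one at P; the factors to the right of P meet the
    inverse of K. *)
Lemma F_prod i m (x : 'I_m -> A) (P : 'I_m) (y : A) (c : 'I_m -> C) :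
  (forall t, t != P -> Fop i (x t) = 0) -> Fop i (x P) = y ->
  (forall t : 'I_m, (P < t)%N -> Kiop i (x t) = c t *: x t) ->
  Fop i (\prod_(t < m) x t) = (\prod_(t < m) (if (P < t)%N then c t else 1)) *:
     \prod_(t < m) (if t == P then y else x t).
Proof.
elim: m x P c => [|m IH] x P c; first by case: P.
move=> H0 HP Hc; rewrite big_ord_recl F_mul [in RHS]big_ord_recl ltn0 mul1r.
rewrite [X in _ = _ *: X]big_ord_recl.
case: (unliftP ord0 P) H0 HP Hc => [P' ->|->] H0 HP Hc.
  rewrite (H0 ord0) // mul0r add0r (IH _ P' (fun t => c (lift ord0 t))).
  - rewrite -scalerAr; by congr (_ *: (_ * _)); apply: eq_bigr => t _.
  - by move=> t tP; rewrite H0 // lift0E.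
  - exact: HP.
  - by move=> t tP; rewrite Hc.
rewrite (F_prod0 (x := fun t => x (lift ord0 t))) ?mulr0 ?addr0; last by move=> t; rewrite H0.
rewrite eqxx HP Ki_prod scalerAr -prodZ; congr (_ * _); apply: eq_bigr => t _.
by rewrite Hc.
Qed.

(** The factors to the right of P that already carry the new index c + 1 contribute
    powers of q. *)
Lemma F_prod_zs s c m (u v : 'I_m -> 'I_n) (P : 'I_m) : (c.+1 < n)%N ->
  u P = c :> nat -> (forall t, t != P -> u t <> c :> nat) ->
  Fop (ix s c) (\prod_(t < m) zs s (u t) (v t)) =
  (h * \prod_(t < m) (if (P < t)%N && (u t == c.+1 :> nat) then qC else 1)) *:
    \prod_(t < m) zs s (if t == P then ordS (u t) else u t) (v t).
Proof.
move=> cn uP uO.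
rewrite (F_prod (P := P) (y := h *: zs s (ordS (u P)) (v P))
  (c := fun t => if u t == c.+1 :> nat then qC else 1)).
- pose e (t : 'I_m) := if t == P then h else 1.
  rewrite (eq_bigr (fun t => e t *: zs s (if t == P then ordS (u t) else u t) (v t))); last first.
    by move=> t _; rewrite /e; case: eqP => [->|]; rewrite ?scale1r.
  rewrite prodZ scalerA mulrC; congr ((_ * _) *: _).
    by rewrite (bigD1 P) //= big1 ?mulr1 /e ?eqxx // => t /negPf ->.
  by apply: eq_bigr => t _; case: ifP.
- by move=> t tP; rewrite F_zs // ifF //; apply/eqP/uO.
- by rewrite F_zs // uP eqxx.
- move=> t Pt; rewrite Ki_zs // ifF; last by apply/eqP/uO/eqP => tP; rewrite tP ltnn in Pt.
  by case: ifP; rewrite ?invrK ?invr1.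
Qed.

Lemma F_prod_zs0 s c m (u v : 'I_m -> 'I_n) : (c.+1 < n)%N ->
  (forall t, u t <> c :> nat) -> Fop (ix s c) (\prod_(t < m) zs s (u t) (v t)) = 0.
Proof. by move=> cn uO; apply: F_prod0 => t; rewrite F_zs // ifF //; apply/eqP/uO. Qed.

Lemma eq_qminor m (a a' b b' : 'I_m -> 'I_n) : a =1 a' -> b =1 b' ->
  qminor q a b = qminor q a' b'.
Proof.
move=> aa bb; apply: eq_bigr => s _; congr (_ *: _); apply: eq_bigr => t _.
by rewrite aa bb.
Qed.

Lemma qminor_homog m (a b : 'I_m -> 'I_n) : homog m (qminor q a b).
Proof.
apply: homog_sum => s _; apply: homogZ.
have := @homog_prod_ord _ _ _ m (fun t => z (a t) (b (s t))) (fun=> 1%N).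
by rewrite sum1_card card_ord; apply=> t; apply: homog_gen.
Qed.

Lemma scale_hom_qminor c c' m (a b : 'I_m -> 'I_n) :
  scale_hom c c' (qminor q a b) = (\prod_(t < m) c (a t) * \prod_(t < m) c' (b t)) *: qminor q a b.
Proof.
rewrite /qminor (big_morph _ (scale_homD (q := q) c c') (scale_hom0 q c c')) scaler_sumr.
apply: eq_bigr => s _; rewrite scale_homZ scale_hom_prod.
rewrite (eq_bigr (fun t => (c (a t) * c' (b (s t))) *: z (a t) (b (s t)))); last first.
  by move=> t _; rewrite scale_hom_z.
rewrite prodZ !scalerA mulrC; congr ((_ * _) *: _).
by rewrite big_split /=; congr (_ * _); rewrite [RHS](reindex_perm s).
Qed.

Lemma K_qminor i m (a : 'I_m -> 'I_n) :
  Kop i (qminor q a a) = (\prod_(t < m) (rw i (a t) * cw i (a t))) *: qminor q a a.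
Proof. by rewrite K_scale scale_hom_qminor big_split. Qed.

Lemma eps_qminor m (a : 'I_m -> 'I_n) : injective a -> eps (qminor q a a) = 1.
Proof.
move=> a_inj; rewrite /qminor (big_morph _ (epsD (q := q)) (eps0 n q)) (bigD1 (1%g : 'S_m)) //=.
have eps_prod (x : 'I_m -> A) : eps (\prod_(t < m) x t) = \prod_(t < m) eps (x t).
  by apply: big_morph; [exact: epsM|exact: eps1].
rewrite epsZ inversions1 expr0 mul1r eps_prod big1 => [|t _]; last by rewrite perm1 eps_z eqxx.
rewrite big1 ?addr0 // => s s1; rewrite epsZ eps_prod.
have [t st] : exists t, s t != t.
  apply/existsP; rewrite -negb_forall; apply: contra s1 => /forallP H.
  by apply/eqP/permP => t; rewrite perm1; apply/eqP.
by rewrite (bigD1 t) //= eps_z (inj_eq a_inj) eq_sym (negPf st) mul0r mulr0.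
Qed.

Lemma F_qminor0_row c m (a b : 'I_m -> 'I_n) : (c.+1 < n)%N ->
  (forall t, a t <> c :> nat) -> Fop (ix false c) (qminor q a b) = 0.
Proof.
move=> cn aO; rewrite /qminor (big_morph _ (actD _) (act0 _)) big1 // => s _.
by rewrite actZ (@F_prod_zs0 false) ?scaler0.
Qed.

Lemma F_qminor0_col c m (a b : 'I_m -> 'I_n) : (c.+1 < n)%N ->
  (forall t, b t <> c :> nat) -> Fop (ix true c) (qminor q a b) = 0.
Proof.
move=> cn bO; rewrite /qminor (big_morph _ (actD _) (act0 _)) big1 // => s _.
by rewrite actZ (@F_prod_zs0 true c m (fun t => b (s t)) a) ?scaler0.
Qed.

Lemma F_qminor_row c m (a b : 'I_m -> 'I_n) (P : 'I_m) : (c.+1 < n)%N ->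
  a P = c :> nat -> (forall t, t != P -> a t <> c :> nat) ->
  Fop (ix false c) (qminor q a b) =
  (h * \prod_(t < m) (if (P < t)%N && (a t == c.+1 :> nat) then qC else 1)) *:
  qminor q (fun t => if t == P then ordS (a t) else a t) b.
Proof.
move=> cn aP aO; rewrite /qminor (big_morph _ (actD _) (act0 _)) scaler_sumr.
apply: eq_bigr => s _; rewrite actZ.
by rewrite (@F_prod_zs false c m a (fun t => b (s t)) P) // !scalerA mulrC.
Qed.

Lemma F_qminor_col c m (a b : 'I_m -> 'I_n) (P : 'I_m) : (c.+1 < n)%N ->
  b P = c :> nat -> (forall t, t != P -> b t <> c :> nat) ->
  Fop (ix true c) (qminor q a b) =
  \sum_(s : 'S_m) (- qC) ^+ inversions s *:
    ((h * \prod_(t < m) (if ((s^-1)%g P < t)%N && (b (s t) == c.+1 :> nat) then qC else 1)) *: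
     \prod_(t < m) z (a t) (if s t == P then ordS (b (s t)) else b (s t))).
Proof.
move=> cn bP bO; rewrite /qminor (big_morph _ (actD _) (act0 _)).
apply: eq_bigr => s _; rewrite actZ; congr (_ *: _).
have sE t : (t == (s^-1)%g P) = (s t == P) by rewrite -{2}(permKV s P) (inj_eq perm_inj).
rewrite (@F_prod_zs true c m (fun t => b (s t)) a ((s^-1)%g P)) //.
- by congr (_ *: _); apply: eq_bigr => t _; rewrite sE.
- by rewrite permKV.
- by move=> t; rewrite sE; apply: bO.
Qed.

Lemma F_qminor_shift_row c m (a b : 'I_m -> 'I_n) (P : 'I_m) : (c.+1 < n)%N ->
  a P = c :> nat -> (forall t, t != P -> a t <> c :> nat /\ a t <> c.+1 :> nat) ->
  Fop (ix false c) (qminor q a b) = h *: qminor q (fun t => if t == P then ordS (a t) else a t) b.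
Proof.
move=> cn aP aO; rewrite (F_qminor_row b cn aP) => [|t /aO[]//].
rewrite big1 ?mulr1 // => t _; case: ifP => // /andP[Pt /eqP at1].
have tP : t != P by apply/eqP => e; rewrite e ltnn in Pt.
by case: (aO t tP).
Qed.

Lemma F_qminor_shift_col c m (a b : 'I_m -> 'I_n) (P : 'I_m) : (c.+1 < n)%N ->
  b P = c :> nat -> (forall t, t != P -> b t <> c :> nat /\ b t <> c.+1 :> nat) ->
  Fop (ix true c) (qminor q a b) = h *: qminor q a (fun t => if t == P then ordS (b t) else b t).
Proof.
move=> cn bP bO; rewrite (F_qminor_col a cn bP) => [|t /bO[]//].
rewrite scaler_sumr; apply: eq_bigr => s _.
rewrite big1 ?mulr1 ?scalerA 1?mulrC // => t _; case: ifP => // /andP[Pt /eqP at1].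
have tP : s t != P.
  by apply/eqP => e; move: Pt; rewrite -e permK ltnn.
by case: (bO (s t) tP).
Qed.

Lemma prod_split2 m (x : 'I_m -> A) (P P' : 'I_m) : P' = P.+1 :> nat ->
  \prod_(t < m) x t = \prod_(0 <= k < P) x (insubd P k) * (x P * x P') *
    \prod_(P'.+1 <= k < m) x (insubd P k).
Proof.
move=> PP'; have Pm := ltn_ord P; have Pm' := ltn_ord P'.
rewrite (eq_bigr (fun t : 'I_m => x (insubd P (t : nat)))); last first.
  by move=> t _; rewrite valKd.
rewrite -(big_mkord xpredT (fun k => x (insubd P k))).
rewrite (@big_cat_nat _ _ _ P) //=; last exact: ltnW.
rewrite (@big_ltn _ _ _ P) // -PP' (@big_ltn _ _ _ P') //.
by rewrite !valKd !mulrA.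
Qed.

Lemma prod_swap_rows m (a b b' : 'I_m -> 'I_n) (P P' : 'I_m) : P' = P.+1 :> nat ->
  a P = a P' -> (b P < b P')%N -> b' P = b P' -> b' P' = b P ->
  (forall t, t != P -> t != P' -> b' t = b t) ->
  \prod_(t < m) z (a t) (b t) = qC *: \prod_(t < m) z (a t) (b' t).
Proof.
move=> PP' aP bP b'P b'P' b'b; rewrite !(prod_split2 _ PP') b'P b'P' -aP.
rewrite (z_q q (or_introl (conj erefl bP))) -!(scalerAl, scalerAr).
have Pm := ltn_ord P; have Pm' := ltn_ord P'.
congr (_ *: (_ * _ * _)); apply: eq_big_nat => k kP; rewrite b'b // -val_eqE /= val_insubd;
  by rewrite ifT; move: kP; lia.
Qed.

(** Exchanging the factors in the two equal rows costs a factor q, which cancels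
    against the sign -q of the adjacent transposition. *)
Lemma qminor_eq_rows m (a b : 'I_m -> 'I_n) (P P' : 'I_m) : P' = P.+1 :> nat ->
  a P = a P' -> {homo b : t t' / (t < t')%N} -> qminor q a b = 0.
Proof.
move=> PP' aP b_mono; have PnP' : P != P' by apply/eqP => e; move: PP'; rewrite e; lia.
apply: (sum_pairing (sigma := fun s => (tperm P P' * s)%g) (p := fun s : 'S_m => (s P < s P')%N)).
- by move=> s; rewrite mulgA tperm2 mul1g.
- move=> s; rewrite !permM tpermL tpermR -leqNgt ltn_neqAle andb_idl // => _.
  by rewrite (inj_eq val_inj) (inj_eq perm_inj) eq_sym.
move=> s sP; rewrite inversions_tperm // exprS.
rewrite (@prod_swap_rows m a (fun t => b (s t)) (fun t => b ((tperm P P' * s)%g t)) P P') //.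
- by rewrite scalerA -scalerDl mulNr mulrC subrr scale0r.
- exact: b_mono.
- by rewrite permM tpermL.
- by rewrite permM tpermR.
- by move=> t tP tP'; rewrite permM tpermD // eq_sym.
Qed.

Lemma F_qminor_vanish_row c m (a b : 'I_m -> 'I_n) (P P' : 'I_m) : (c.+1 < n)%N ->
  P' = P.+1 :> nat -> a P = c :> nat -> a P' = c.+1 :> nat ->
  (forall t, t != P -> a t <> c :> nat) ->
  {homo b : t t' / (t < t')%N} -> Fop (ix false c) (qminor q a b) = 0.
Proof.
move=> cn PP' aP aP' aO b_mono; rewrite (F_qminor_row b cn aP aO).
rewrite (@qminor_eq_rows _ _ _ P P') ?scaler0 //.
rewrite eqxx ifF; last by apply/eqP => e; move: PP'; rewrite e; lia.
by apply: val_inj; rewrite /= aP aP' modn_small.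
Qed.

(** Lowering would repeat a column. The terms of s and of s followed by the exchange
    of P and P' then involve the same monomial, and the power of q coming from K
    offsets the one coming from the length. *)
Lemma F_qminor_vanish_col c m (a b : 'I_m -> 'I_n) (P P' : 'I_m) : (c.+1 < n)%N ->
  P' = P.+1 :> nat -> b P = c :> nat -> b P' = c.+1 :> nat ->
  (forall t, t != P -> b t <> c :> nat) -> (forall t, t != P' -> b t <> c.+1 :> nat) ->
  Fop (ix true c) (qminor q a b) = 0.
Proof.
move=> cn PP' bP bP' bO bO'; rewrite (F_qminor_col a cn bP bO).
have PnP' : P != P' by apply/eqP => e; move: PP'; rewrite e; lia.
apply: (sum_pairing (sigma := fun s => (s * tperm P P')%g)
  (p := fun s : 'S_m => ((s^-1)%g P < (s^-1)%g P')%N)).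
- by move=> s; rewrite -mulgA tperm2 mulg1.
- move=> s; rewrite !invMg tpermV !permM tpermL tpermR -leqNgt ltn_neqAle andb_idl // => _.
  by rewrite (inj_eq val_inj) (inj_eq perm_inj) eq_sym.
move=> s sP; rewrite inversions_tperm_r // exprS.
have prodE (s' : 'S_m) : \prod_(t < m) (if ((s'^-1)%g P < t)%N && (b (s' t) == c.+1 :> nat) then qC else 1) =
    if ((s'^-1)%g P < (s'^-1)%g P')%N then qC else 1.
  rewrite (bigD1 ((s'^-1)%g P')) //= permKV bP' eqxx andbT big1 ?mulr1 // => t tP'.
  rewrite ifF //; apply/negP => /andP[_ /eqP]; apply: bO'.
  by apply: contra tP' => /eqP <-; rewrite permK.
rewrite !prodE sP invMg tpermV !permM tpermL tpermR ltnNge (ltnW sP) /= mulr1.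
set X := \prod_(t < m) _; set Y := \prod_(t < m) _; have -> : Y = X.
  apply: eq_bigr => t _; congr (z _ _); rewrite permM.
  have bS : ordS (b P) = b P' by apply: val_inj; rewrite /= bP bP' modn_small.
  case: tpermP => [->|->|/eqP/negPf -> _] //.
    by rewrite eqxx eq_sym (negPf PnP') bS.
  by rewrite eqxx eq_sym (negPf PnP') bS.
rewrite !scalerA -scalerDl (_ : _ + _ = 0) ?scale0r //; ring.
Qed.

Lemma lowest_ext m chi chi' v : chi =1 chi' -> lowest m chi v -> lowest m chi' v.
Proof. by move=> e [H F_ K_]; split=> // i; rewrite -e. Qed.

Lemma lowest1 : lowest 0 (fun=> 1) 1.
Proof.
by split=> [|i _|i]; [exact: homog1|exact: F_1|rewrite K_1 scale1r].
Qed.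

Lemma lowestM m m' chi chi' f g : lowest m chi f -> lowest m' chi' g ->
  lowest (m + m') (fun i => chi i * chi' i) (f * g).
Proof.
move=> [Hf fF fK] [Hg gF gK]; split=> [|i ni|i]; first exact: homogM.
  by rewrite F_mul fF // gF // mul0r mulr0 addr0.
by rewrite K_mul fK gK -scalerAl -scalerAr scalerA.
Qed.

Lemma lowestX m chi f p : lowest m chi f -> lowest (p * m) (fun i => chi i ^+ p) (f ^+ p).
Proof.
move=> lf; elim: p => [|p IH].
  by rewrite expr0; apply: lowest_ext lowest1 => i; rewrite expr0.
by rewrite exprS mulSn; apply: lowest_ext (lowestM lf IH) => i; rewrite exprS.
Qed.

Lemma lowest_Ki m chi f i : lowest m chi f -> chi i != 0 -> Kiop i f = (chi i)^-1 *: f.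
Proof.
by move=> [_ _ fK] ci; rewrite -{2}(KiK i f) fK actZ scalerA mulVf // scale1r.
Qed.

(** Only the terms containing the last generator survive, and these are the
    permutations fixing the last position. *)
Lemma F_mid_qminor m (a b : 'I_m.+1 -> 'I_n) : a ord_max = nn -> b ord_max = nn ->
  (forall t, t != ord_max -> a t != nn) -> (forall t, t != ord_max -> b t != nn) ->
  Fop mid (qminor q a b) =
  h *: qminor q (fun t => a (lift ord_max t)) (fun t => b (lift ord_max t)).
Proof.
move=> an bn aO bO; rewrite /qminor (big_morph _ (actD _) (act0 _)).
rewrite (bigID (fun s : 'S_m.+1 => s ord_max == ord_max)) /= [X in _ + X]big1 ?addr0.
  rewrite sum_perm_fix scaler_sumr; apply: eq_bigr => s _; rewrite actZ.
  rewrite inversions_lift ?eqxx ?orbT // scalerA mulrC -scalerA; congr (_ *: _).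
  rewrite (F_prod (P := ord_max) (y := h%:A) (c := fun=> 1)).
  - rewrite big1 => [|t _]; last by rewrite if_same.
    rewrite scale1r big_ord_recr /= eqxx mulr_algr; congr (_ *: _).
    apply: eq_bigr => t _; have -> : widen_ord (leqnSn m) t = lift ord_max t.
      by apply: val_inj; rewrite /= /bump leqNgt ltn_ord.
    by rewrite eq_sym (negPf (neq_lift _ _)) lift_perm_lift.
  - by move=> t tm; rewrite F_mid_z (negPf (aO t tm)).
  - by rewrite F_mid_z lift_perm_id an bn eqxx.
  - by move=> t; rewrite ltnNge -ltnS ltn_ord.
move=> s sm; rewrite actZ F_prod0 ?scaler0 // => t; rewrite F_mid_z.
have [->|tm] := eqVneq t ord_max; last by rewrite (negPf (aO t tm)).
by rewrite (negPf (bO _ sm)) andbF.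
Qed.

(** * Lowering words *)

Definition lower_word (l : seq 'I_(2 * n).-1) (f : A) : A :=
  foldr (fun i g => Fop i g) f l.

Lemma lower_word_cat l l' f : lower_word (l ++ l') f = lower_word l (lower_word l' f).
Proof. exact: foldr_cat. Qed.

Lemma lower_wordZ l c f : lower_word l (c *: f) = c *: lower_word l f.
Proof. by elim: l => //= i l ->; rewrite actZ. Qed.

Lemma lower_word0 l : lower_word l 0 = 0.
Proof. by elim: l => //= i l ->; rewrite act0. Qed.

Lemma shift_cols w k (a : 'I_k -> 'I_n) e : (w + k < n)%N -> (e <= k)%N ->
  lower_word [seq ix true c | c <- iota w e] (qminor q a (gap_index w e)) =
  h ^+ e *: qminor q a (gap_index w 0).
Proof.
move=> jk; elim: e => [|e IH] ek; first by rewrite scale1r.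
rewrite -[X in iota _ X]addn1 iotaD map_cat lower_word_cat /=.
pose P := Ordinal ek.
rewrite (@F_qminor_shift_col _ _ _ _ P); last 1 first.
- by move=> t tP; rewrite val_gap //; move: tP; rewrite -val_eqE /=; lia.
- rewrite lower_wordZ (_ : qminor _ _ _ = qminor q a (gap_index w e)).
    by rewrite IH ?(ltnW ek) // scalerA exprS.
  by apply: eq_qminor => // t; rewrite -val_eqE /= gap_indexS.
- by lia.
- by rewrite val_gap //= ltnn addn0.
Qed.

Lemma shift_rows w k (b : 'I_k -> 'I_n) e : (w + k < n)%N -> (e <= k)%N ->
  lower_word [seq ix false c | c <- iota w e] (qminor q (gap_index w e) b) =
  h ^+ e *: qminor q (gap_index w 0) b.
Proof.
move=> jk; elim: e => [|e IH] ek; first by rewrite scale1r.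
rewrite -[X in iota _ X]addn1 iotaD map_cat lower_word_cat /=.
pose P := Ordinal ek.
rewrite (@F_qminor_shift_row _ _ _ _ P); last 1 first.
- by move=> t tP; rewrite val_gap //; move: tP; rewrite -val_eqE /=; lia.
- rewrite lower_wordZ (_ : qminor _ _ _ = qminor q (gap_index w e) b).
    by rewrite IH ?(ltnW ek) // scalerA exprS.
  by apply: eq_qminor => // t; rewrite -val_eqE /= gap_indexS.
- by lia.
- by rewrite val_gap //= ltnn addn0.
Qed.

(** The lower right minor of size m; these are the factors of the lowest vectors. *)
Definition cminor m : A := qminor q (@low_index m) (@low_index m).

Definition cminor_weight m (i : 'I_(2 * n).-1) : C :=
  \prod_(t < m) (rw i (low_index t) * cw i (low_index t)).

Lemma cminor_weight_neq0 m i : cminor_weight m i != 0.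
Proof. by apply/prodf_neq0 => t _; rewrite mulf_neq0 ?rw_neq0. Qed.

(** The lowering operator at c kills every factor if c is before the block, and
    otherwise repeats the row or column c + 1, which is in the block as well. *)
Lemma lowest_cminor m : (m <= n)%N -> lowest m (cminor_weight m) (cminor m).
Proof.
move=> mn; split=> [|i ni|i]; [exact: qminor_homog| |exact: K_qminor].
have [s [c [cn ->]]] := ixP ni.
have low_mono : {homo @low_index m : t t' / (t < t')%N} by move=> t t' tt'; rewrite !val_low // ltn_add2l.
have [cm|mc] := ltnP c (n - m).
  case: s; [apply: F_qminor0_col|apply: F_qminor0_row] => // t; rewrite val_low //; lia.
have Pm : (c - (n - m) < m)%N by lia.
have Pm' : (c.+1 - (n - m) < m)%N by lia.
have PP' : Ordinal Pm' = (Ordinal Pm).+1 :> nat by rewrite /=; lia.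
have vP : low_index (Ordinal Pm) = c :> nat by rewrite val_low //=; lia.
have vP' : low_index (Ordinal Pm') = c.+1 :> nat by rewrite val_low //=; lia.
have tP t : t != Ordinal Pm -> low_index t <> c :> nat.
  by rewrite -val_eqE val_low //=; lia.
have tP' t : t != Ordinal Pm' -> low_index t <> c.+1 :> nat.
  by rewrite -val_eqE val_low //=; lia.
by case: s; [apply: F_qminor_vanish_col PP' vP vP' tP tP'|apply: F_qminor_vanish_row PP' vP vP' tP low_mono].
Qed.

Lemma eps_cminor m : (m <= n)%N -> eps (cminor m) = 1.
Proof. by move=> mn; apply/eps_qminor/low_inj. Qed.

Lemma cminor0 : cminor 0 = 1.
Proof.
rewrite /cminor /qminor (bigD1 (1%g : 'S_0)) //= inversions1 big_ord0 scale1r.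
by rewrite big1 ?addr0 // => s /eqP []; apply/permP => -[].
Qed.

Lemma wt_ix s c a : (c.+1 < n)%N -> rw (ix s c) a * cw (ix s c) a =
  if a == c :> nat then qC else if a == c.+1 :> nat then qC^-1 else 1.
Proof.
move=> cn; have H1 s' : ((ix s' c).+1 < n)%N = ~~ s'.
  by rewrite val_ix //; case: s' => /=; lia.
have H2 s' : ((ix s' c).+1 == n)%N = false by apply/eqP; exact: ix_neq.
have H3 : ix false c = c :> nat by rewrite val_ix.
by rewrite rev_ix // /row_weight !H1 !H2 /=; case: s; rewrite /= H3 ?mulr1 ?mul1r.
Qed.

(** A root inside the block meets the two indices c and c + 1 with inverse weights. *)
Lemma cminor_weight_ix m s c : (m <= n)%N -> (c.+1 < n)%N -> (n - m <= c)%N ->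
  cminor_weight m (ix s c) = 1.
Proof.
move=> mn cn mc; rewrite /cminor_weight (eq_bigr _ (fun t _ => wt_ix s (low_index t) cn)).
have Pm : (c - (n - m) < m)%N by lia.
have Pm' : (c.+1 - (n - m) < m)%N by lia.
rewrite (bigD1 (Ordinal Pm)) //= (bigD1 (Ordinal Pm')) /=; last first.
  by rewrite -val_eqE /=; lia.
rewrite !val_low //= [X in _ * (_ * X)]big1 => [|t /andP[]].
  rewrite ifT; last by lia.
  rewrite ifF; last by lia.
  by rewrite ifT ?mulr1 ?divff ?qC_neq0 //; lia.
rewrite -!val_eqE /= val_low // => H1 H2; rewrite ifF; last by lia.
by rewrite ifF //; lia.
Qed.

Lemma cminor_weight_mid m : (m < n)%N -> cminor_weight m.+1 mid = qC ^+ 2.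
Proof.
move=> mn; rewrite /cminor_weight (bigD1 ord_max) //= rev_mid !K_mid_rw.
have -> : low_index (@ord_max m) = nn by apply: val_inj; rewrite /= val_low //=; lia.
rewrite eqxx big1 ?mulr1 ?expr2 // => t; rewrite -val_eqE /= !K_mid_rw => tm.
by rewrite ifF ?mulr1 //; apply/eqP => /(congr1 val) /=; rewrite val_low //; have := ltn_ord t; lia.
Qed.

(** After F_n has removed the last row and column of a minor of size n - w, this word
    moves the remaining indices w, ..., n - 2 up by one, rows and columns alike. *)
Definition path_word (w : nat) : seq 'I_(2 * n).-1 :=
  [seq ix false c | c <- iota w (n.-1 - w)] ++ [seq ix true c | c <- iota w (n.-1 - w)].

Lemma path_word_neq w i : i \in path_word w -> i.+1 <> n.
Proof.
by rewrite mem_cat => /orP[] /mapP [c]; rewrite mem_iota => cw ->; apply: ix_neq; lia.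
Qed.

Lemma F_mid_cminor m : (m < n)%N ->
  Fop mid (cminor m.+1) = h *: qminor q (gap_index (n - m.+1) m) (gap_index (n - m.+1) m : 'I_m -> _).
Proof.
move=> mn; have max_nn : low_index (@ord_max m) = nn by apply: val_inj; rewrite /= val_low //=; lia.
have lt_nn (t : 'I_m.+1) : t != ord_max -> low_index t != nn.
  by rewrite -!val_eqE /= val_low //; have := ltn_ord t; lia.
rewrite /cminor F_mid_qminor //; congr (_ *: _).
have e (t : 'I_m) : low_index (lift ord_max t) = gap_index (n - m.+1) m t.
  apply: val_inj; rewrite /= val_low // val_gap; last by lia.
  by rewrite /= /bump (_ : (m <= t)%N = false) ?addn0 // leqNgt ltn_ord.
by rewrite (eq_qminor e e).
Qed.

Lemma path_cminor m w : (m.+1 + w)%N = n ->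
  lower_word (path_word w) (Fop mid (cminor m.+1)) = h ^+ (2 * m).+1 *: cminor m.
Proof.
move=> mw; rewrite F_mid_cminor; last by lia.
have -> : (n - m.+1 = w)%N by lia.
rewrite /path_word lower_wordZ lower_word_cat; have -> : (n.-1 - w = m)%N by lia.
rewrite shift_cols //; last by lia.
rewrite lower_wordZ shift_rows //; last by lia.
rewrite !scalerA -?mulrA -exprD -exprS (_ : (m + m).+1 = (2 * m).+1); last by lia.
congr (_ *: _); rewrite /cminor.
have e (t : 'I_m) : gap_index w 0 t = low_index t.
  apply: val_inj; rewrite /= val_low ?val_gap //=; lia.
by rewrite (eq_qminor e e).
Qed.

(** A smaller minor has no row or column w: the word reaches an operator whose index
    is absent. *)
Lemma path_cminor0 m w : (m + w < n)%N ->
  lower_word (path_word w) (Fop mid (cminor m)) = 0.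
Proof.
case: m => [|m] mw; first by rewrite cminor0 F_1 lower_word0.
rewrite F_mid_cminor; last by lia.
rewrite /path_word lower_wordZ lower_word_cat.
set rows := [seq ix false _ | _ <- _]; move: rows => rows.
have [e ne] : exists e, (n.-1 - w = e + 1 + m)%N by exists (n.-1 - w - 1 - m)%N; lia.
rewrite ne iotaD map_cat lower_word_cat; have -> : (w + (e + 1) = n - m.+1)%N by lia.
rewrite shift_cols //; last by lia.
rewrite lower_wordZ iotaD map_cat lower_word_cat /= F_qminor0_col ?lower_word0; last 2 first.
- by lia.
- by move=> t; rewrite val_gap; lia.
by rewrite !scaler0 lower_word0 scaler0.
Qed.

(** Compact lowering operators kill lowest vectors, so in the product rule each of
    them acts on the factor that F has already changed. *)
Lemma lower_word_mul l m m' chi chi' f g : (forall i, i \in l -> i.+1 <> n) ->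
  lowest m chi f -> lowest m' chi' g -> (forall i, chi' i != 0) ->
  lower_word l (Fop mid (f * g)) =
  (chi' mid * \prod_(i <- l) chi' i)^-1 *: (lower_word l (Fop mid f) * g)
  + f * lower_word l (Fop mid g).
Proof.
move=> ln lf lg c0; elim: l ln => [|i l IH] ln.
  by rewrite big_nil mulr1 /= F_mul (lowest_Ki lg) // -scalerAr.
rewrite /= IH => [|j jl]; last by apply: ln; rewrite inE jl orbT.
have ni : i.+1 <> n by apply: ln; rewrite mem_head.
rewrite actD actZ !F_mul (lowest_F lf ni) (lowest_F lg ni) mulr0 addr0 mul0r add0r.
rewrite (lowest_Ki lg) // -scalerAr scalerA big_cons; congr (_ *: _ + _).
by rewrite mulrCA [RHS]invfM mulrC.
Qed.

(** The adjoint of a lowering word in any invariant form: the letters are E K^-1,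
    applied in the opposite order. *)
Definition raise_word (l : seq 'I_(2 * n).-1) (g : A) : A :=
  foldl (fun g i => Eop i (Kiop i g)) g l.

Lemma raise_word_homog l N g : (forall i, i \in l -> i.+1 <> n) -> homog N g ->
  homog N (raise_word l g).
Proof.
elim: l g => //= i l IH g ln Hg; apply: IH => [j jl|]; first by apply: ln; rewrite inE jl orbT.
have [s [c [cn ->]]] := ixP (ln i (mem_head _ _)).
by apply: E_homog => //; apply: Ki_homog.
Qed.

Section RaiseWord.
Variable form : {dot A for (Num.conj : C -> C)}.
Hypothesis form_inv : invariant_form (@Uq_compact R n q) act form.

Lemma adj_lower_word l f g : (forall i, i \in l -> i.+1 <> n) ->
  form (lower_word l f) g = form f (raise_word l g).
Proof.
elim: l g => //= i l IH g ln; rewrite (adjF form_inv) ?IH //.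
  by move=> j jl; apply: ln; rewrite inE jl orbT.
by apply: ln; rewrite mem_head.
Qed.

(** A lowest vector is orthogonal to the image of E, so E can be moved from x to the
    generator on its right, where it shifts the index by one. *)
Lemma lowest_form_raise N chi v s c b (a a' : 'I_n) x : lowest N chi v -> (c.+1 < n)%N ->
  a = c.+1 :> nat -> a' = c :> nat ->
  form v (Eop (ix s c) (Kiop (ix s c) x) * zs s a b) = - h^-1 * form v (x * zs s a' b).
Proof.
move=> lv cn ac a'c; have ni : (ix s c).+1 <> n by exact: ix_neq.
have -> : Eop (ix s c) (Kiop (ix s c) x) * zs s a b =
    Eop (ix s c) (Kiop (ix s c) x * zs s a b) - h^-1 *: (x * zs s a' b).
  rewrite E_mul KKi E_zs // ac eqxx.
  have -> : ord_pred a = a' by apply: val_inj; rewrite [LHS](val_ord_pred ac) -a'c.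
  by rewrite -scalerAr addrK.
rewrite formBr formZr conj_hV (adjE_r form_inv) // (lowest_F lv) // act0 form0l sub0r.
by rewrite mulNr.
Qed.

Lemma lowest_form_raise_word N chi v s w e b (a a' : 'I_n) x : lowest N chi v ->
  a = (w + e)%N :> nat -> a' = w :> nat ->
  form v (raise_word [seq ix s c | c <- iota w e] x * zs s a b) =
  (- h^-1) ^+ e * form v (x * zs s a' b).
Proof.
move=> lv; elim: e a => [|e IH] a ae a'w.
  by rewrite expr0 mul1r; congr (form v (_ * zs s _ _)); apply: val_inj; rewrite /= ae a'w addn0.
rewrite -[X in iota _ X]addn1 iotaD map_cat /raise_word foldl_cat /=.
have an := ltn_ord a; have bn : (w + e < n)%N by lia.
rewrite (@lowest_form_raise _ _ _ s (w + e)%N b a (Ordinal bn) _ lv) //=; last 2 first.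
- by lia.
- by rewrite ae addnS.
by rewrite -/(raise_word _ _) (IH (Ordinal bn)) //= exprS mulrA.
Qed.

(** The generator travels with the word from the last entry to the diagonal entry
    w. *)
Lemma lowest_form_path N chi v w (o : 'I_n) x : lowest N chi v -> o = w :> nat ->
  form v (raise_word (path_word w) x * z nn nn) = qC ^- (n.-1 - w) * form v (x * z o o).
Proof.
move=> lv ow; have wn := ltn_ord o.
rewrite /path_word /raise_word foldl_cat -/(raise_word _ _) -/(raise_word _ _).
rewrite (@lowest_form_raise_word _ _ _ true w (n.-1 - w) nn nn o _ lv) //=; last by lia.
rewrite (@lowest_form_raise_word _ _ _ false w (n.-1 - w) o nn o _ lv) //=; last by lia.
by rewrite mulrA -exprMn mulrNN -invfM hh exprVn.
Qed.

End RaiseWord.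

(** * The q-derivatives and the Fock form *)

Section QDerivatives.
Variable d : A -> Omega1 n q.
Hypothesis d_diff : is_differential d.
Variable partial : 'I_n -> 'I_n -> A -> A.
Hypothesis partialP : are_q_derivatives d partial.
Variable form : {dot A for (Num.conj : C -> C)}.
Hypothesis formP : is_Fock_product act partial form.
Let form_inv := Fock_inv formP.

Let fadj a al f g : form (partial a al f) g = form f (g * z a al).
Proof. exact: (Fock_partial formP). Qed.

Lemma partialD a al f g : partial a al (f + g) = partial a al f + partial a al g.
Proof. by apply: (form_inj (form := form)) => x; rewrite !(formDl, fadj). Qed.

Lemma partialZ a al c f : partial a al (c *: f) = c *: partial a al f.
Proof. by apply: (form_inj (form := form)) => x; rewrite !(formZl, fadj). Qed.

Lemma partial0 a al : partial a al 0 = 0.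
Proof. by have := partialZ a al 0 0; rewrite !scale0r. Qed.

Lemma coef_d s f : coef s (d f) = corner s (partial s s f).
Proof.
have coef0 : coef s (0 : Omega1 n q) = 0.
  by have := coefZ s 0 0; rewrite scale0r /corner scale_hom0 mul0r.
have coef_sum (I : finType) (G : I -> Omega1 n q) : coef s (\sum_i G i) = \sum_i coef s (G i).
  by apply: big_morph => // x y; exact: coefD.
rewrite partialP coef_sum (bigD1 s) //= [X in _ + X]big1 ?addr0; last first.
  by move=> a /negPf as_; rewrite coef_sum big1 // => al _; rewrite coefZ coef_dz as_ mulr0.
rewrite coef_sum (bigD1 s) //= [X in _ + X]big1 ?addr0; last first.
  by move=> al /negPf als; rewrite coefZ coef_dz als andbF mulr0.
by rewrite coefZ coef_dz !eqxx mulr1.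
Qed.

Lemma corner_partialM s f g : corner s (partial s s (f * g)) =
  corner s (partial s s f) * corner_twist s g + corner s f * corner s (partial s s g).
Proof. by rewrite -!coef_d (differentialM d_diff) coefD coef_rmul coefZ. Qed.

Lemma corner_partial_z s a al :
  corner s (partial s s (z a al)) = ((a == s) && (al == s))%:R.
Proof. by rewrite -coef_d (differential_z d_diff) coef_dz. Qed.

Lemma corner_partial1 s : corner s (partial s s 1) = 0.
Proof.
have := corner_partialM s 1 1; rewrite mulr1 /corner_twist /corner !scale_hom1 mulr1 mul1r.
by move=> /eqP; rewrite -subr_eq subrr => /eqP.
Qed.

Lemma corner0 (o : 'I_n) f : o = 0%N :> nat -> corner o f = f.
Proof.
move=> o0; elim/qmat_ind: f => [|f a al IH|f g IHf IHg|x f IH].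
- exact: scale_hom1.
- by rewrite {1}/corner scale_homM [X in X * _]IH scale_hom_z o0 /= mulr1 scale1r.
- by rewrite /corner scale_homD [X in X + _]IHf [X in _ + X]IHg.
- by rewrite /corner scale_homZ [X in _ *: X]IH.
Qed.

Definition pds s a b := if s then partial b a else partial a b.

Lemma adj_pds s a b f g : form (pds s a b f) g = form f (g * zs s a b).
Proof. by case: s; apply: fadj. Qed.

Lemma pdsN s a b : pds (~~ s) a b = pds s b a.
Proof. by case: s. Qed.

(** The adjoint of the fact that right multiplication by the next generator is a
    q-commutator of F with right multiplication by the given one. *)
Lemma pds_step s a b x : (a.+1 < n)%N ->
  pds s (ordS a) b x = h^-1 *:
   (pds s a b (Eop (ix s a) (Kiop (ix s a) x)) -
    qC^-1 *: Eop (ix s a) (Kiop (ix s a) (pds s a b x))).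
Proof.
move=> an; apply: (form_inj (form := form)) => g.
have ni : (ix s a).+1 <> n by exact: ix_neq.
rewrite adj_pds formZl formBl formZl adj_pds -!(adjF_r form_inv) // adj_pds.
have -> : g * zs s (ordS a) b = h^-1 *: (Fop (ix s a) (g * zs s a b)
    - qC^-1 *: (Fop (ix s a) g * zs s a b)).
  rewrite F_mul F_zs // eqxx.
  have -> : Kiop (ix s a) (zs s a b) = qC^-1 *: zs s a b.
    rewrite -{2}[zs s a b](KiK (ix s a)) K_zs // eqxx actZ scalerA mulVf ?scale1r //.
    exact: qC_neq0.
  rewrite -!scalerAr [_ *: _ + _]addrC addrK scalerA mulVf ?scale1r //; exact: h_neq0.
by rewrite formZr formBr formZr conj_hV conj_qCV.
Qed.

Definition wz a b : C := rw mid a * rw mid b.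

(** The properties that pass from a derivative to its neighbours through pds_step,
    starting from the first row and column, where no generator is truncated. *)
Record partial_props a b : Prop := {
  pp1 : partial a b 1 = 0;
  ppz : forall c e, partial a b (z c e) = ((c == a) && (e == b))%:R;
  ppF : forall x, Fop mid (partial a b x) = wz a b *: partial a b (Fop mid x);
  pph : forall m x, homog m.+1 x -> homog m (partial a b x) }.

Lemma partial_props_step s a b : (a.+1 < n)%N ->
  (if s then partial_props b a else partial_props a b) ->
  (if s then partial_props b (ordS a) else partial_props (ordS a) b).
Proof.
move=> an H.
have ni : (ix s a).+1 <> n by exact: ix_neq.
have p1 : pds s a b 1 = 0 by case: (s) H => -[].
have pz c e : pds s a b (zs s c e) = ((c == a) && (e == b))%:R.
  by case: (s) H => -[_ Hz _ _]; rewrite /pds /= Hz // andbC.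
have pF x : Fop mid (pds s a b x) = wz a b *: pds s a b (Fop mid x).
  by case: (s) H => -[_ _ HF _]; rewrite /pds /= HF // /wz mulrC.
have ph m x : homog m.+1 x -> homog m (pds s a b x).
  by case: (s) H => -[_ _ _ Hh]; apply: Hh.
suff [q1 qz qF qh] : [/\ pds s (ordS a) b 1 = 0,
   forall c e, pds s (ordS a) b (zs s c e) = ((c == ordS a) && (e == b))%:R,
   forall x, Fop mid (pds s (ordS a) b x) = wz (ordS a) b *: pds s (ordS a) b (Fop mid x)
   & forall m x, homog m.+1 x -> homog m (pds s (ordS a) b x)].
  case: (s) q1 qz qF qh => /= q1 qz qF qh; split=> //.
    by move=> c e; rewrite qz andbC.
  by move=> x; rewrite qF /wz mulrC.
have pdsZ c x : pds s a b (c *: x) = c *: pds s a b x by rewrite /pds; case: ifP => _; rewrite partialZ.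
have pds0 : pds s a b 0 = 0 by have := pdsZ 0 0; rewrite !scale0r.
split.
- by rewrite pds_step // Ki_1 E_1 pds0 p1 !act0 scaler0 subr0 scaler0.
- move=> c e; rewrite pds_step // pz.
  have -> : Eop (ix s a) (Kiop (ix s a) (((c == a) && (e == b))%:R)) = 0.
    by case: (_ && _); rewrite ?act0 // Ki_1 E_1.
  rewrite scaler0 subr0.
  have -> : Eop (ix s a) (Kiop (ix s a) (zs s c e)) =
      if c == ordS a then h *: zs s a e else 0.
    rewrite Ki_zs // actZ E_zs //.
    have -> : (c == ordS a) = (c == a.+1 :> nat).
      by apply/eqP/eqP => [->|e1] /=; [|apply: val_inj]; rewrite /= modn_small.
    have [ca|_] := eqVneq (c : nat) a.+1; last by rewrite scaler0.
    rewrite ca ifF; last by apply/eqP; lia.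
    rewrite invrK scalerA; congr (_ *: zs s _ _).
      by rewrite -hh mulfK ?h_neq0.
    by apply: val_inj; exact: val_ord_pred.
  case: (c == ordS a); rewrite ?pds0 ?scaler0 //= pdsZ scalerA mulVf ?h_neq0 // scale1r.
  by rewrite pz eqxx.
- move=> x; rewrite !pds_step //; set i := ix s a; have im : i != mid by exact: ix_neq_mid.
  have FKi y : Fop mid (Kiop i y) = qC ^ (- cartan_A i mid) *: Kiop i (Fop mid y).
    by rewrite Ki_F scalerA -expfzDr ?qC_neq0 // addNr expr0z scale1r.
  have FEKi y : Fop mid (Eop i (Kiop i y)) = qC ^ (- cartan_A i mid) *: Eop i (Kiop i (Fop mid y)).
    by rewrite -E_F_neq // FKi actZ.
  have -> : wz (ordS a) b = qC ^ (- cartan_A i mid) * wz a b.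
    by rewrite /wz (cartan_ix_mid s) // mulrA.
  rewrite actZ actB actZ pF !FEKi pF !(actZ, pdsZ, scalerBr, scalerA).
  by congr (_ *: _ - _ *: _); ring.
- move=> m x Hx; rewrite pds_step //; apply: homogZ; apply: homogD.
    by apply: ph; apply: E_homog => //; apply: Ki_homog.
  by rewrite -scaleN1r; do 2!apply: homogZ; apply: E_homog => //; apply: Ki_homog; apply: ph.
Qed.

Lemma wz_neq0 a b : wz a b != 0.
Proof. by rewrite mulf_neq0 ?rw_neq0. Qed.

Lemma conj_wzV a b : Num.conj (wz a b)^-1 = (wz a b)^-1.
Proof. by rewrite fmorphV rmorphM /= !conj_rw. Qed.

Lemma Ki_mid_z a b : Kiop mid (z a b) = (wz a b)^-1 *: z a b.
Proof. by rewrite Ki_z rev_mid. Qed.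

Lemma F_mid_mulz f a b : Fop mid (f * z a b) =
  (wz a b)^-1 *: (Fop mid f * z a b) + (h * ((a == nn) && (b == nn))%:R) *: f.
Proof.
rewrite F_mul Ki_mid_z -scalerAr; congr (_ + _).
by rewrite F_mid_z; case: ifP => _; rewrite ?mulr1 ?mulr_algr // !mulr0 scale0r.
Qed.

Lemma scale_hom_homog c c' m f : homog m f -> homog m (scale_hom c c' f : A).
Proof.
elim=> [|{}m {}f a al _ IH|{}m|{}m f1 f2 _ IH1 _ IH2|{}m x {}f _ IH].
- by rewrite scale_hom1; apply: homog1.
- by rewrite scale_homM scale_hom_z -scalerAl; apply/homogZ/homog_z.
- by rewrite scale_hom0; apply: homog0.
- by rewrite scale_homD; apply: homogD.
- by rewrite scale_homZ; apply: homogZ.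
Qed.

Lemma homog0P f : homog 0 f -> exists c : C, f = c%:A.
Proof. by move=> /homog_inspan [c] /= /eqP; rewrite subr_eq0 => /eqP ->; exists c. Qed.

(** For the first row and column corner is the identity, so the derivative satisfies
    a twisted product rule on the whole algebra. *)
Lemma partial_props_corner (o : 'I_n) : o = 0%N :> nat -> partial_props o o.
Proof.
move=> o0; have cid f : corner o f = f by exact: corner0.
pose cc (a : 'I_n) : C := if a == o then qC else 1.
have twz a b : corner_twist o (z a b) = (cc a * cc b) *: z a b.
  by rewrite /corner_twist scale_hom_z o0 /= !mul1r.
have pM f g : partial o o (f * g) = partial o o f * corner_twist o g + f * partial o o g.
  by have := corner_partialM o f g; rewrite !cid.
have p1 : partial o o 1 = 0 by have := corner_partial1 o; rewrite cid.
have pz a b : partial o o (z a b) = ((a == o) && (b == o))%:R.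
  by have := corner_partial_z o a b; rewrite cid.
have pMz f a b : partial o o (f * z a b) =
    (cc a * cc b) *: (partial o o f * z a b) + ((a == o) && (b == o))%:R *: f.
  by rewrite pM twz pz -scalerAr mulr_natr scaler_nat.
split=> //.
- elim/qmat_ind => [|f a al IH|f g IHf IHg|x f IH].
  + by rewrite p1 F_1 partial0 act0 scaler0.
  + rewrite pMz F_mid_mulz !(actD, actZ, partialD, partialZ) F_mid_mulz pMz IH.
    have e1 : cc a * cc al * ((a == nn) && (al == nn))%:R = wz o o * ((a == nn) && (al == nn))%:R.
      have [->|] := eqVneq a nn; rewrite ?mulr0 //; have [->|] := eqVneq al nn; rewrite ?mulr0 //.
      by rewrite /cc /wz K_mid_rw eq_sym.
    have e2 : ((a == o) && (al == o))%:R = wz o o / wz a al * ((a == o) && (al == o))%:R :> C.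
      have [->|] := eqVneq a o; rewrite ?mulr0 //; have [->|] := eqVneq al o; rewrite ?mulr0 //.
      by rewrite mulr1 divff ?wz_neq0.
    rewrite !scalerDr -!scalerAl !scalerA.
    rewrite -!addrA; congr (_ *: _ + _); first by ring.
    rewrite addrC; congr (_ *: _ + _ *: _); first by rewrite {1}e2; ring.
    transitivity (h * (cc a * cc al * ((a == nn) && (al == nn))%:R)); first by ring.
    by rewrite e1; ring.
  + by rewrite !(actD, partialD) IHf IHg scalerDr.
  + by rewrite !(actZ, partialZ) IH !scalerA mulrC.
- move=> m x; move: {-1}m.+1 (erefl m.+1) => e em Hx.
  suff : homog e.-1 (partial o o x) by rewrite -em.
  elim: Hx => {m em x} [|m f a al Hf IH|m|m f1 f2 _ IH1 _ IH2|m c f _ IH].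
  + by rewrite p1; apply: homog0.
  + rewrite pM pz; apply: homogD.
      case: (_ && _); last by rewrite mul0r; apply: homog0.
      by rewrite mul1r; apply: scale_hom_homog.
    case: m Hf IH => [|m] Hf IH; last exact: homog_z.
    have [c ->] := homog0P Hf.
    by rewrite partialZ p1 scaler0 mulr0; apply: homog0.
  + by rewrite partial0; apply: homog0.
  + by rewrite partialD; apply: homogD.
  + by rewrite partialZ; apply: homogZ.
Qed.

Lemma partial_propsP a b : partial_props a b.
Proof.
apply: (grid_ind n_gt0) => [o o0|{}a {}b an|{}a {}b bn]; first exact: partial_props_corner.
  exact: (@partial_props_step false).
exact: (@partial_props_step true).
Qed.

Lemma form_1_mulz f a b : form 1 (f * z a b) = 0.
Proof. by rewrite -fadj (pp1 (partial_propsP a b)) form0l. Qed.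

(** Induction on f: right multiplication of f by a generator becomes a derivative of
    v, which commutes with F up to the weight that K gives to the generator. This
    leaves f = 1, where both sides single out the last generator. *)
Lemma Fock_F v f : form (Fop mid v) f = h * form v (z nn nn * Kiop mid f).
Proof.
elim/qmat_ind: f v => [|f a b IH|f g IHf IHg|x f IH] v.
- rewrite Ki_1 mulr1; elim/qmat_ind: v => [|f a b IH|f g IHf IHg|x f IH].
  + by rewrite F_1 form0l -[z nn nn]mul1r form_1_mulz mulr0.
  + rewrite F_mid_mulz formDl !formZl [form (_ * _) 1]formC form_1_mulz rmorph0 mulr0 add0r.
    rewrite [form (_ * _) _]formC -fadj (ppz (partial_propsP a b)) -formC.
    have -> : ((nn == a) && (nn == b))%:R = ((a == nn) && (b == nn))%:R *: 1 :> A.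
      by rewrite scaler_nat ![nn == _]eq_sym.
    by rewrite formZr conjC_nat mulrA.
  + by rewrite actD !formDl IHf IHg mulrDr.
  + by rewrite actZ !formZl IH mulrCA.
- rewrite -fadj.
  have -> : partial a b (Fop mid v) = (wz a b)^-1 *: Fop mid (partial a b v).
    by rewrite (ppF (partial_propsP a b)) scalerA mulVf ?scale1r ?wz_neq0.
  rewrite formZl IH fadj Ki_mul Ki_mid_z -!scalerAr formZr conj_wzV !mulrA.
  by rewrite [_ * h]mulrC.
- by rewrite actD mulrDr !formDr IHf IHg mulrDr.
- by rewrite actZ -scalerAr !formZr IH mulrCA.
Qed.

(** * Multiplicity one *)

Definition eps_null g := forall x, Uq_compact x -> eps (act x g) = 0.

Lemma eps_null_act y g : Uq_compact y -> eps_null g -> eps_null (act y g).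
Proof. by move=> Hy Hg x Hx; rewrite -actM; apply: Hg; constructor. Qed.

(** F_n commutes with the compact E, and its value at the identity is a difference
    of values of the compact orbit; so the images under F_n form a subspace to which
    the layer argument applies. *)
Lemma eps_null_F_mid g : eps_null g -> eps_null (Fop mid g).
Proof.
move=> Hg x Hx; apply: (@compact_eps true (fun f => exists2 k, eps_null k & f = Fop mid k)) => //.
- move=> i _ [k Hk ->]; rewrite K_F -actZ; eexists; last reflexivity.
  by move=> y Hy; rewrite actZ epsZ eps_null_act ?mulr0 //; constructor.
- move=> i _ [k Hk ->]; rewrite Ki_F -actZ; eexists; last reflexivity.
  by move=> y Hy; rewrite actZ epsZ eps_null_act ?mulr0 //; constructor.
- move=> i _ ni [k Hk ->]; exists (Eop i k); first by apply: eps_null_act => //; constructor.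
  by rewrite E_F_neq //; apply/eqP => im; apply: ni; rewrite im mid_n.
- move=> _ [k Hk ->]; rewrite eps_F_mid Hk; last by constructor.
  by have := Hk _ (compact_1 _ _); rewrite act1 => ->; rewrite subrr mulr0.
- by exists g.
Qed.

(** By induction on the degree F_n kills the whole compact orbit of g. By Fock_F the
    orbit is then orthogonal to the left multiples of z_n^n, and by invariance to
    those of every generator, that is, to everything of positive degree. *)
Lemma eps_null_eq0 m g : homog m g -> eps_null g -> g = 0.
Proof.
elim: m g => [|m IHm] g Hg Ng.
  have [c gc] := homog0P Hg.
  have := Ng _ (compact_1 _ _); rewrite act1 gc epsZ eps1 mulr1 => ->.
  by rewrite scale0r.
have orth_step s a b (an : (a.+1 < n)%N) :
    (forall x f, Uq_compact x -> form (act x g) (zs s (ordS a) b * f) = 0) ->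
    forall x f, Uq_compact x -> form (act x g) (zs s a b * f) = 0.
  move=> IH x f Hx; have ni : (ix s a).+1 <> n by exact: ix_neq.
  have va : ordS a = a.+1 :> nat by rewrite /= modn_small.
  have -> : zs s a b * f = h *: (Eop (ix s a) (zs s (ordS a) b * f) -
      qC^-1 *: (zs s (ordS a) b * Eop (ix s a) f)).
    rewrite E_mul E_zs // K_zs // va eqxx ifF; last by apply/eqP; lia.
    rewrite -!scalerAl addrK scalerA divff ?h_neq0 // scale1r; congr (zs s _ _ * _).
    by apply: val_inj; rewrite [RHS](val_ord_pred va).
  rewrite formZr formBr formZr IH // mulr0 subr0 (adjE_r form_inv) // -!actM IH ?mulr0 //.
  by do ![constructor].
have orth a b x f : Uq_compact x -> form (act x g) (z a b * f) = 0.
  move: a b x f; apply: grid_ind_rev => [x f Hx|a b an IH x f Hx|a b bn IH x f Hx].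
  - have := Fock_F (act x g) (Kop mid f); rewrite KiK.
    rewrite (IHm (Fop mid (act x g))) ?form0l.
    + by move/esym/eqP; rewrite mulf_eq0 (negPf h_neq0) => /eqP.
    + by apply/F_mid_homog/compact_homog.
    + exact/eps_null_F_mid/eps_null_act.
  - exact: (orth_step false).
  - exact: (orth_step true).
have orthP e f : homog e f -> e = m.+1 -> form g f = 0.
  elim=> [|{}e {}f a al Hf IH|{}e|{}e f1 f2 _ IH1 _ IH2|{}e c {}f _ IH] // em.
  - by rewrite -[g]act1 orth //; constructor.
  - by rewrite form0r.
  - by rewrite formDr IH1 // IH2 // addr0.
  - by rewrite formZr IH // mulr0.
by apply: (form_eq0 (form := form)); apply: orthP Hg erefl.
Qed.

Lemma lowest_eps_eq0 m chi g : lowest m chi g -> eps g = 0 -> g = 0.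
Proof.
move=> [Hg gF gK] g0; apply: (eps_null_eq0 Hg) => x Hx.
apply: (@compact_eps false (fun f => exists c, f = c *: g)) => //.
- by move=> i _ [c ->]; exists (c * chi i); rewrite actZ gK scalerA.
- move=> i _ [c ->]; exists (c * (chi i)^-1); rewrite actZ -scalerA; congr (_ *: _).
  rewrite -{2}(KiK i g) gK actZ scalerA; have [e|nz] := eqVneq (chi i) 0.
    by rewrite -(KiK i g) gK e scale0r !act0 scaler0.
  by rewrite mulVf // scale1r.
- by move=> i _ ni [c ->]; exists 0; rewrite actZ gF // scaler0 scale0r.
- by move=> _ [c ->]; rewrite epsZ g0 mulr0.
- by exists 1; rewrite scale1r.
Qed.

(** The form in which multiplicity one of the isotypic components is used. *)
Lemma lowest_inj m chi f g : lowest m chi f -> lowest m chi g -> eps f = eps g -> f = g.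
Proof.
move=> [Hf fF fK] [Hg gF gK] fg; apply/eqP; rewrite -subr_eq0; apply/eqP.
apply: (@lowest_eps_eq0 m chi); last by rewrite -scaleN1r epsD epsZ fg mulN1r subrr.
split=> [|i ni|i].
- by rewrite -scaleN1r; apply: homogD => //; apply: homogZ.
- by rewrite actB fF // gF // subrr.
- by rewrite actB fK gK scalerBr.
Qed.

(** For the first row this follows from the product rule, for the others from
    pds_step. *)
Lemma pds_rowkill s t a b f : (a < t)%N -> pds s a b (rowkill s t f) = 0.
Proof.
move: a b f; apply: (grid_ind n_gt0) => [o o0|a b an IH|a b bn IH] f ta.
- elim/(@qmat_ind_zs s): f => [|f a b IH|f g IHf IHg|x f IH].
  + by rewrite rowkill1 /pds if_same (pp1 (partial_propsP o o)).
  + move: IH; rewrite /pds !if_same => IH; rewrite rowkillM.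
    have := corner_partialM o (rowkill s t f) (rowkill s t (zs s a b)).
    rewrite !corner0 // IH mul0r add0r => ->; rewrite rowkill_zs partialZ.
    case: leqP => [ta'|_]; last by rewrite scale0r mulr0.
    have ao : (a == o) = false by apply/eqP => ao; move: ta'; rewrite ao leqNgt ta.
    by rewrite /zs; case: (s); rewrite (ppz (partial_propsP o o)) ao ?andbF scaler0 mulr0.
  + by move: IHf IHg; rewrite /pds !if_same rowkillD partialD => -> ->; rewrite addr0.
  + by move: IH; rewrite /pds !if_same rowkillZ partialZ => ->; rewrite scaler0.
- have at' : (a.+1 < t)%N by move: ta; rewrite /= modn_small.
  rewrite pds_step // rowkill_Ki rowkill_E_same // IH ?(ltnW at') // !act0 scaler0 subr0.
  by rewrite /pds; case: ifP => _; rewrite partial0 scaler0.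
- rewrite -pdsN pds_step // rowkill_Ki rowkill_E_other // !pdsN !IH //.
  by rewrite !act0 scaler0 subr0 scaler0.
Qed.

Lemma lowest_form_E m chi v i x : lowest m chi v -> i.+1 <> n -> form v (Eop i x) = 0.
Proof. by move=> [_ vF _] ni; rewrite (adjE_r form_inv) // vF // act0 form0l. Qed.

Definition wt i a b : C := rw i a * cw i b.

Lemma wt_neq0 i a b : wt i a b != 0.
Proof. by rewrite mulf_neq0 ?rw_neq0. Qed.

Lemma conj_wtV i a b : Num.conj (wt i a b)^-1 = (wt i a b)^-1.
Proof. by rewrite fmorphV rmorphM /= !conj_rw. Qed.

(** The commutator of F with the derivative at (o, o) involves derivatives in the row
    or column before o, which vanish on v. *)
Lemma lowest_partial m chi v (o : 'I_n) : lowest m.+1 chi v ->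
  (forall s, rowkill s o v = v) ->
  lowest m (fun i => (wt i o o)^-1 * chi i) (partial o o v).
Proof.
move=> lv vo; have [Hv vF vK] := lv; split=> [|i ni|i].
- exact: (pph (partial_propsP o o)).
- have [s [c [cn ei]]] := ixP ni.
  apply: (form_inj (form := form)) => x; rewrite form0l (adjF form_inv) // fadj.
  have -> : Eop i (Kiop i x) * z o o = Eop i (Kiop i x * z o o) - x * Eop i (z o o).
    by rewrite E_mul KKi addrK.
  rewrite formBr (lowest_form_E _ lv) // sub0r ei.
  have -> : z o o = zs s o o by rewrite /zs if_same.
  rewrite E_zs //; case: eqP => [oc|_]; last by rewrite mulr0 form0r oppr0.
  rewrite -scalerAr formZr -adj_pds -(vo s) pds_rowkill ?form0l ?mulr0 ?oppr0 //.
  by rewrite (val_ord_pred oc) oc.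
- apply: (form_inj (form := form)) => x; rewrite (adjK form_inv) fadj formZl fadj.
  have -> : Kop i x * z o o = (wt i o o)^-1 *: Kop i (x * z o o).
    by rewrite K_mul K_z -scalerAr scalerA mulVf ?scale1r // wt_neq0.
  by rewrite formZr conj_wtV -(adjK form_inv) vK formZl mulrA.
Qed.

Definition qnum (p : nat) : C := (1 - qC ^+ (2 * p)) / (1 - qC ^+ 2).

Lemma qnum1 : qnum 1 = 1. Proof. by rewrite /qnum muln1 divff ?q2_neq1. Qed.

Lemma qnumS p : qnum p.+1 = qC ^+ 2 * qnum p + 1.
Proof.
have q2 := q2_neq1; rewrite /qnum mulnS exprD; field.
by [].
Qed.

Lemma qnumSr p : qnum p.+1 = qnum p + qC ^+ (2 * p).
Proof. by have q2 := q2_neq1; rewrite /qnum mulnS exprD; field. Qed.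

Lemma corner_prod0 (o : 'I_n) m (a b : 'I_m -> 'I_n) :
  (forall t, ~~ ((a t == o) && (b t == o))) ->
  corner o (partial o o (\prod_(t < m) z (a t) (b t))) = 0.
Proof.
elim: m a b => [|m IH] a b H; first by rewrite big_ord0 corner_partial1.
rewrite big_ord_recl corner_partialM corner_partial_z (negPf (H _)) mul0r add0r.
by rewrite IH ?mulr0 // => t; apply: H.
Qed.

(** * The two operators that remove a box *)

(** The block of D = cminor m.+1 consists of the rows and columns from w on, and o
    is its first index. *)
Section CornerStep.
Variables (m w : nat).
Hypothesis mw : (m.+1 + w)%N = n.
Let o : 'I_n := low_index (ord0 : 'I_m.+1).
Let D := cminor m.+1.
Let D' := cminor m.
Let W f := lower_word (path_word w) (Fop mid f).
Let dd f := corner o (partial o o f).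

Let o_w : o = w :> nat. Proof. by rewrite val_low //=; lia. Qed.

Let dd0 : dd 0 = 0.
Proof. by rewrite /dd partial0 /corner scale_hom0. Qed.
Let ddD f g : dd (f + g) = dd f + dd g.
Proof. by rewrite /dd partialD /corner scale_homD. Qed.
Let ddZ c f : dd (c *: f) = c *: dd f.
Proof. by rewrite /dd partialZ /corner scale_homZ. Qed.
Let ddM f g : dd (f * g) = dd f * corner_twist o g + corner o f * dd g.
Proof. exact: corner_partialM. Qed.

Lemma rowkill_cminor s k : (k + w <= n)%N -> rowkill s w (cminor k) = cminor k.
Proof.
move=> kw; have H (t : 'I_k) : (w <= low_index t)%N by rewrite val_low //; lia.
by rewrite /rowkill; case: s; rewrite scale_hom_qminor !big1 ?mulr1 ?scale1r // => t _; rewrite H.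
Qed.

Lemma corner_cminor k : (k + w <= n)%N -> corner o (cminor k) = cminor k.
Proof.
move=> kw; have H (t : 'I_k) : (o <= low_index t)%N by rewrite o_w val_low //; lia.
by rewrite /corner scale_hom_qminor !big1 ?mulr1 ?scale1r // => t _; rewrite H.
Qed.

Lemma dd_cminor0 k : (k + w < n)%N -> dd (cminor k) = 0.
Proof.
move=> kw; rewrite /cminor /qminor (big_morph _ ddD dd0) big1 // => s _; rewrite ddZ.
rewrite /dd corner_prod0 ?scaler0 // => t.
rewrite -val_eqE /= val_low; last by lia.
rewrite -/o o_w; lia.
Qed.

Lemma twist_D : corner_twist o D = qC ^+ 2 *: D.
Proof.
rewrite /corner_twist scale_hom_qminor; congr (_ *: _).
suff -> : \prod_(t < m.+1) ((o <= low_index t)%N%:R * (if low_index t == o then qC else 1)) = qC :> C.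
  by rewrite expr2.
rewrite big_ord_recl leqnn eqxx mul1r big1 ?mulr1 // => t _.
have mn : (m.+1 <= n)%N by lia.
by rewrite -val_eqE /= o_w !val_low //= /bump ifF ?mulr1; [rewrite (_ : (_ <= _)%N = true) //|]; lia.
Qed.

Lemma corner_D k : corner o (D ^+ k) = D ^+ k.
Proof.
elim: k => [|k IHk]; first by rewrite /corner scale_hom1.
by rewrite exprS /corner scale_homM -/(corner o D) -/(corner o (D ^+ k)) IHk corner_cminor; last lia.
Qed.

(** Expansion along the first row: only the permutations fixing the first position
    contain the generator with both indices o. *)
Lemma dd_D : dd D = D'.
Proof.
have mn : (m.+1 <= n)%N by lia.
rewrite {1}/D /cminor /qminor (big_morph _ ddD dd0).
rewrite (bigID (fun s : 'S_m.+1 => s ord0 == ord0)) /= [X in _ + X]big1 ?addr0; last first.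
  move=> s s0; rewrite ddZ /dd corner_prod0 ?scaler0 // => t.
  rewrite !(inj_eq (low_inj mn)); apply/negP => /andP[/eqP -> st]; by rewrite st in s0.
rewrite sum_perm_fix; apply: eq_bigr => s _; rewrite ddZ inversions_lift ?eqxx //; congr (_ *: _).
rewrite big_ord_recl ddM lift_perm_id /dd corner_partial_z eqxx mul1r.
rewrite corner_prod0 ?mulr0 ?addr0; last first.
  by move=> t; rewrite (inj_eq (low_inj mn)).
rewrite /corner_twist scale_hom_prod; apply: eq_bigr => t _; rewrite lift_perm_lift scale_hom_z.
have e (u : 'I_m) : low_index (lift ord0 u) = low_index u.
  by apply: val_inj; rewrite /= !val_low //=; [rewrite /bump; lia|lia].
have e' (u : 'I_m) : ((o <= low_index u)%N%:R * (if low_index u == o then qC else 1)) = 1 :> C.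
  have H : (w < low_index u)%N by rewrite val_low; lia.
  by rewrite -val_eqE /= o_w ifF ?(ltnW H) ?mulr1 //; lia.
by rewrite !e !e' mulr1 scale1r.
Qed.

Let lD : lowest m.+1 (cminor_weight m.+1) D. Proof. by apply: lowest_cminor; lia. Qed.
Let lD' : lowest m (cminor_weight m) D'. Proof. by apply: lowest_cminor; lia. Qed.

Lemma epsX f p : eps (f ^+ p) = eps f ^+ p.
Proof. by elim: p => [|p IH]; rewrite ?expr0 ?eps1 // !exprS epsM IH. Qed.

(** Both products are lowest vectors of the same degree, weight and value at the
    identity. *)
Lemma D_comm p : D ^+ p * D' = D' * D ^+ p.
Proof.
apply: (lowest_inj (lowestM (lowestX p lD) lD')); last by rewrite !epsM mulrC.
rewrite addnC; apply: lowest_ext (lowestM lD' (lowestX p lD)) => i /=; exact: mulrC.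
Qed.

Lemma W_pow p : W (D ^+ p.+1) = (h ^+ (2 * m).+1 * qC ^- (2 * p) * qnum p.+1) *: (D' * D ^+ p).
Proof.
have mn : (m.+1 <= n)%N by lia.
have WD : W D = h ^+ (2 * m).+1 *: D' by exact: path_cminor.
have q0 := qC_neq0.
elim: p => [|p IH]; first by rewrite qnum1 expr1 WD muln0 invr1 !mulr1.
rewrite exprSr /W (lower_word_mul (@path_word_neq w) (lowestX p.+1 lD) lD (cminor_weight_neq0 _)).
rewrite -/(W (D ^+ p.+1)) IH -/(W D) WD.
rewrite cminor_weight_mid; last by lia.
rewrite big1_seq ?mulr1; last first.
  move=> i /andP[_]; rewrite mem_cat => /orP[] /mapP [c]; rewrite mem_iota => cw ->;
  apply: cminor_weight_ix; lia.
have E1 : D' * D ^+ p * D = D' * D ^+ p.+1 by rewrite -mulrA -exprSr.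
rewrite -scalerAl E1 scalerA -scalerAr D_comm -scalerDl; congr (_ *: _).
rewrite [in RHS]qnumSr mulnS exprD; field.
by rewrite q0 /= expf_neq0.
Qed.

Lemma dd_pow p : dd (D ^+ p.+1) = qnum p.+1 *: (D' * D ^+ p).
Proof.
elim: p => [|p IH]; first by rewrite qnum1 expr1 dd_D scale1r mulr1.
have E1 : D' * D ^+ p * D = D' * D ^+ p.+1 by rewrite -mulrA -exprSr.
rewrite exprSr ddM IH twist_D corner_D dd_D D_comm -scalerAr -scalerAl E1 scalerA.
by rewrite -[X in _ + X]scale1r -scalerDl -qnumS.
Qed.

(** What the product of the minors smaller than D satisfies: it involves neither row
    nor column o, so that both operators pass over it. *)
Record head_product N chi (v : A) : Prop := {
  hp_lowest : lowest N chi v;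
  hp_weight : forall i, chi i != 0;
  hp_eps : eps v = 1;
  hp_rowkill : forall s, rowkill s w v = v;
  hp_corner : corner o v = v;
  hp_dd : dd v = 0;
  hp_W : W v = 0 }.

Lemma head_product1 : head_product 0 (fun=> 1) 1.
Proof.
split; rewrite ?eps1 //; first exact: lowest1.
- by move=> i; rewrite oner_eq0.
- by move=> s; rewrite rowkill1.
- exact: scale_hom1.
- exact: corner_partial1.
- by rewrite /W F_1 lower_word0.
Qed.

Lemma head_productM N N' chi chi' v v' : head_product N chi v -> head_product N' chi' v' ->
  head_product (N + N') (fun i => chi i * chi' i) (v * v').
Proof.
move=> [l1 c1 e1 r1 k1 d1 W1] [l2 c2 e2 r2 k2 d2 W2]; split.
- exact: lowestM.
- by move=> i; rewrite mulf_neq0.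
- by rewrite epsM e1 e2 mulr1.
- by move=> s; rewrite rowkillM r1 r2.
- by rewrite /corner scale_homM -/(corner o v) -/(corner o v') k1 k2.
- by rewrite ddM d1 d2 mul0r mulr0 addr0.
- rewrite /W (lower_word_mul (@path_word_neq w) l1 l2 c2) -/(W v) -/(W v') W1 W2.
  by rewrite mul0r mulr0 scaler0 addr0.
Qed.

Lemma head_product_cminor k : (k + w < n)%N -> head_product k (cminor_weight k) (cminor k).
Proof.
move=> kw; have kn : (k <= n)%N by lia.
split.
- exact: lowest_cminor.
- exact: cminor_weight_neq0.
- exact: eps_cminor.
- by move=> s; apply: rowkill_cminor; lia.
- by apply: corner_cminor; lia.
- exact: dd_cminor0.
- exact: path_cminor0.
Qed.

Lemma head_productX N chi v e : head_product N chi v ->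
  head_product (e * N) (fun i => chi i ^+ e) (v ^+ e).
Proof.
move=> hv; elim: e => [|e IH].
  exact: head_product1.
have [l c ep r k d0 W0] := head_productM hv IH; rewrite -exprS -mulSn in l ep r k d0 W0.
split=> //; first by apply: lowest_ext l => i; rewrite exprS.
by move=> i; rewrite exprS.
Qed.

Section Step.
Variables (N : nat) (chi : 'I_(2 * n).-1 -> C) (v0 : A).
Hypothesis hp : head_product N chi v0.
Variable p : nat.
Let v := v0 * D ^+ p.+1.
Let v' := v0 * (D' * D ^+ p).
Let N' := (N + (m + p * m.+1))%N.
Let chi' i := chi i * (cminor_weight m i * cminor_weight m.+1 i ^+ p).

Lemma lowest_v : lowest N'.+1 (fun i => chi i * cminor_weight m.+1 i ^+ p.+1) v.
Proof.
have -> : N'.+1 = (N + p.+1 * m.+1)%N by rewrite /N'; lia.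
exact: (lowestM (hp_lowest hp) (lowestX p.+1 lD)).
Qed.

Lemma lowest_v' : lowest N' chi' v'.
Proof. exact: (lowestM (hp_lowest hp) (lowestM lD' (lowestX p lD))). Qed.

Lemma eps_v : eps v = 1.
Proof. by rewrite epsM (hp_eps hp) epsX eps_cminor ?expr1n ?mulr1 //; lia. Qed.

Lemma eps_v' : eps v' = 1.
Proof. by rewrite !epsM (hp_eps hp) epsX !eps_cminor ?expr1n ?mulr1 //; lia. Qed.

Lemma W_v : W v = (h ^+ (2 * m).+1 * qC ^- (2 * p) * qnum p.+1) *: v'.
Proof.
rewrite /v /W (lower_word_mul (@path_word_neq w) (hp_lowest hp) (lowestX p.+1 lD)).
  by rewrite -/(W v0) (hp_W hp) mul0r scaler0 add0r -/(W _) W_pow -scalerAr.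
by move=> i; rewrite expf_neq0 // cminor_weight_neq0.
Qed.

(** The derivative is a lowest vector with the weight of v', hence a multiple of v';
    the factor can be read off after truncation to the block. *)
Lemma partial_v : partial o o v = qnum p.+1 *: v'.
Proof.
have rk s : rowkill s o v = v.
  rewrite o_w rowkillM (hp_rowkill hp); congr (_ * _).
  have rD : rowkill s w D = D by apply: rowkill_cminor; lia.
  by elim: (p.+1) => [|k IH]; rewrite ?rowkill1 // exprS rowkillM IH rD.
have lu := lowest_partial lowest_v rk.
have lu' : lowest N' (fun i => (wt i o o)^-1 * (chi i * cminor_weight m.+1 i ^+ p.+1)) v'.
  apply: lowest_ext lowest_v' => i; rewrite /chi' exprS.
  have -> : cminor_weight m.+1 i = wt i o o * cminor_weight m i.
    rewrite /cminor_weight big_ord_recl; congr (_ * _); apply: eq_bigr => t _.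
    have -> // : low_index (lift ord0 t) = low_index t.
    by apply: val_inj; rewrite /= !val_low //=; [rewrite /bump; lia|lia|lia].
  by field; rewrite wt_neq0.
have ddv : dd v = qnum p.+1 *: v'.
  by rewrite /v ddM (hp_dd hp) mul0r add0r (hp_corner hp) dd_pow -scalerAr.
have uv : partial o o v = eps (partial o o v) *: v'.
  apply: (lowest_inj lu); last by rewrite epsZ eps_v' mulr1.
  have [H1 H2 H3] := lu'; split=> [|i ni|i]; first exact: homogZ.
    by rewrite actZ H2 // scaler0.
  by rewrite actZ H3 !scalerA mulrC.
have cv' : corner o v' = v'.
  rewrite /v' /corner !scale_homM -/(corner o v0) -/(corner o D') -/(corner o (D ^+ p)).
  by rewrite (hp_corner hp) corner_D corner_cminor //; lia.
move: ddv; rewrite /dd uv {1}/corner scale_homZ -/(corner o v') cv' => /(congr1 (@eps R n q)).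
by rewrite !epsZ eps_v' !mulr1 => ->.
Qed.

End Step.

End CornerStep.

(** * Comparison of the two forms *)

Section TwoForms.
Variable formL : {dot A for (Num.conj : C -> C)}.
Hypothesis formL_inv : invariant_form (@Uq_compact R n q) act formL.

(** The vector u that represents form _ v through formL is again a lowest vector of
    the weight of v, hence a multiple of v. *)
Lemma form_proportional m chi v : lowest m chi v -> eps v = 1 ->
  exists c, forall x, homog m x -> form x v = c * formL x v.
Proof.
move=> lv v1; have [Hv vF vK] := lv.
have [u us uP] := riesz formL (homog_words n q m)
  (fun x y => formDl form x y v) (fun c x => formZl form c x v).
have Hu := inspan_homog us.
have {}uP x : homog m x -> form x v = formL x u by move=> /homog_inspan /uP.
have lu : lowest m chi u.
  split=> // [i ni|i].
  - have [s [c [cn ei]]] := ixP ni.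
    apply: (form_eq0 (form := formL)); rewrite [LHS](adjF_r formL_inv) //.
    rewrite -uP -?(adjF_r form_inv) ?vF ?form0r //.
    by rewrite ei; apply: E_homog => //; apply/Ki_homog/F_homog.
  - apply/eqP; rewrite -subr_eq0; apply/eqP/(form_eq0 (form := formL)).
    set w := (X in formL X _); have Hw : homog m w.
      by apply: homogD; [apply: K_homog|rewrite -scaleN1r; do 2!apply: homogZ].
    rewrite formBr formZr -(adjK formL_inv) -!uP //; last exact: K_homog.
    by rewrite (adjK form_inv) vK formZr subrr.
exists (Num.conj (eps u)) => x Hx; rewrite uP // -formZr; congr (formL x _).
apply: (lowest_inj lu); last by rewrite epsZ v1 mulr1.
split=> [|i ni|i]; first exact: homogZ.
  by rewrite actZ vF // scaler0.
by rewrite actZ vK !scalerA mulrC.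
Qed.

Variable t : C.
(** For the twisted action t will be q^(2 lambda). *)
Hypothesis formL_F : forall v f, formL (Fop mid v) f =
  h / (1 - qC ^+ 2) * (formL v (z nn nn * Kiop mid f) - t * formL v (f * z nn nn)).

Lemma proportional_real N v c : homog N v -> v != 0 ->
  (forall x, homog N x -> form x v = c * formL x v) -> Num.conj c = c /\ c != 0.
Proof.
move=> Hv v0 H; have Lv : formL v v != 0 by rewrite gt_eqF // dnorm_gt0.
have Fv : form v v != 0 by rewrite gt_eqF // dnorm_gt0.
have cE : c = form v v / formL v v by rewrite H // mulfK.
split; last by rewrite cE mulf_neq0 ?invr_eq0.
by rewrite cE fmorph_div /= -!formC.
Qed.

(** With f = raise_word (path_word w) v' and z the last generator, pairing
    W v = Cst v' with v' gives the pairing of v with z f in the first form, and a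
    combination of the pairings of v with z f and with f z in the second. The pairing
    with f z is carried to the corner o, where the derivative of v expresses it
    through (v', v'); the constants c and c' pass from one form to the other. *)
Lemma ratio_step m w N chi v0 p c c' :
  (m.+1 + w)%N = n -> head_product m w N chi v0 ->
  let v := v0 * cminor m.+1 ^+ p.+1 in
  let v' := v0 * (cminor m * cminor m.+1 ^+ p) in
  (forall x, homog (N + (m + p * m.+1)).+1 x -> form x v = c * formL x v) ->
  (forall x, homog (N + (m + p * m.+1)) x -> form x v' = c' * formL x v') ->
  c * (1 - qC ^+ 2) = c' * (1 - t * qC ^+ (2 * p) / qC ^+ (2 * m)).
Proof.
move=> mw hp v v' Hc Hc'.
have [q0 h0 q2 hq] := And4 qC_neq0 h_neq0 q2_neq1 hh.
pose o : 'I_n := low_index (ord0 : 'I_m.+1).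
have ow : o = w :> nat by rewrite val_low //=; lia.
have lv := lowest_v mw hp p; have lv' := lowest_v' mw hp p.
have v_neq0 : v != 0.
  by apply/eqP => e; have := eps_v mw hp p; rewrite -/v e eps0 => /esym/eqP; rewrite oner_eq0.
have v'_neq0 : v' != 0.
  by apply/eqP => e; have := eps_v' mw hp p; rewrite -/v' e eps0 => /esym/eqP; rewrite oner_eq0.
have [cr c0] := proportional_real (lowest_homog lv) v_neq0 Hc.
have cr' x : homog (N + (m + p * m.+1)).+1 x -> formL v x = c^-1 * form v x.
  move=> Hx; rewrite [form v x]formC Hc // rmorphM /= cr -formC mulKf //.
have path_ok := @path_word_neq w.
pose f := raise_word (path_word w) v'.
have Hf : homog (N + (m + p * m.+1)) f.
  by apply: raise_word_homog => //; exact: lowest_homog lv'.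
set k := qnum p.+1.
have k0 : k != 0.
  rewrite mulf_neq0 ?invr_eq0 // -rmorphXn -(rmorph1 (real_complex R)) -rmorphB eq_complex /= negb_and.
  by rewrite gt_eqF // subr_gt0 exprn_ilt1 // ?ltW.
(* W v = Cst *: v' by W_v. *)
set Cst := h ^+ (2 * m).+1 * qC ^- (2 * p) * k.
have hm : h ^+ (2 * m).+1 = h * qC ^+ m by rewrite exprS exprM expr2 hq.
have e1 : Cst * form v' v' = h * form v (z nn nn * Kiop mid f).
  by rewrite -formZl -(W_v mw hp p) (adj_lower_word form_inv) // Fock_F.
have e2 : Cst * formL v' v' = formL (Fop mid v) f.
  by rewrite -formZl -(W_v mw hp p) (adj_lower_word formL_inv).
have e3 : formL v (z nn nn * Kiop mid f) = c^-1 * (h^-1 * (Cst * form v' v')).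
  rewrite cr'; last by apply/homog_z/Ki_homog.
  by rewrite e1 mulKf.
have e4 : formL v (f * z nn nn) = qC ^- m * (c^-1 * (k * form v' v')).
  rewrite (lowest_form_path formL_inv _ lv ow) (_ : (n.-1 - w)%N = m); last by lia.
  rewrite cr'; last first.
    by rewrite -addn1; apply: homogM; [exact: lowest_homog lv'|exact: homog_gen].
  by rewrite -formZl -(partial_v mw hp p) fadj.
have L0 : formL v' v' != 0 by rewrite gt_eqF // dnorm_gt0.
move: e2; rewrite formL_F e3 e4 (Hc' v'); last exact: lowest_homog lv'.
move=> e2.
apply: (mulfI (mulf_neq0 k0 L0)).
have : Cst * formL v' v' * c * (1 - qC ^+ 2) * h^-1 * qC ^+ (2 * p) * qC ^- m =
  k * formL v' v' * (c * (1 - qC ^+ 2)).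
  by rewrite /Cst hm; field; rewrite h0 !expf_neq0.
have -> : qC ^+ (2 * m) = qC ^+ m * qC ^+ m by rewrite -exprD addnn mul2n.
move=> <-; rewrite e2 /Cst hm; field.
by rewrite !expf_neq0 //= c0 h0 q2.
Qed.

Hypothesis formL_1 : formL 1 1 = 1.

Definition cproduct (a b : nat) (e : nat -> nat) : A := \prod_(a <= i < b) cminor i.+1 ^+ e i.
Definition cdegree (a b : nat) (e : nat -> nat) : nat := \sum_(a <= i < b) e i * i.+1.

Lemma head_cproduct m w e l : (m.+1 + w)%N = n -> (l <= m)%N ->
  exists chi, head_product m w (cdegree 0 l e) chi (cproduct 0 l e).
Proof.
move=> mw; elim: l => [|l IH] lm.
  by rewrite /cdegree /cproduct !big_geq //; exists (fun=> 1); exact: head_product1.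
have [chi hp] := IH (ltnW lm).
rewrite /cdegree /cproduct !big_nat_recr //=.
have lw : (l.+1 + w < n)%N by lia.
eexists; apply: (head_productM hp); exact: (head_productX _ (head_product_cminor mw lw)).
Qed.

Definition box_ratio (i u : nat) : C := (1 - t * qC ^+ (2 * u) / qC ^+ (2 * i)) / (1 - qC ^+ 2).

Definition shape_ratio (k : nat -> nat) : C := \prod_(i < n) \prod_(u < k i) box_ratio i u.

Definition shape_exponents (k : nat -> nat) (i : nat) : nat := (k i - k i.+1)%N.

(** Induction on the number of boxes; m is the last nonzero row and k' the shape with
    one box of this row removed. *)
Lemma ratio_shape k : (forall i : nat, (k i.+1 <= k i)%N) -> (forall i : nat, (n <= i)%N -> k i = 0%N) ->
  forall x, homog (cdegree 0 n (shape_exponents k)) x ->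
  form x (cproduct 0 n (shape_exponents k)) =
  shape_ratio k * formL x (cproduct 0 n (shape_exponents k)).
Proof.
have q2 := q2_neq1.
move sz : (\sum_(i < n) k i)%N => N; elim: N k sz => [|N IHN] k sz k_mono k_n x.
  have k0 (i : nat) : k i = 0%N.
    have [ni|ni] := leqP n i; first exact: k_n.
    by apply/eqP; move/eqP: sz; rewrite sum_nat_eq0 => /forallP /(_ (Ordinal ni)).
  have -> : cproduct 0 n (shape_exponents k) = 1.
    by rewrite /cproduct big1 // => i _; rewrite /shape_exponents !k0 expr0.
  have -> : cdegree 0 n (shape_exponents k) = 0%N.
    by rewrite /cdegree big1 // => i _; rewrite /shape_exponents !k0.
  have -> : shape_ratio k = 1.
    by rewrite /shape_ratio big1 // => i _; rewrite k0 big_ord0.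
  move=> /homog0P [c ->]; rewrite !formZl formL_1 (Fock_1 formP); ring.
have [m [mn km kz]] : exists m, [/\ (m < n)%N, (0 < k m)%N & forall i : nat, (m < i)%N -> k i = 0%N].
  have ex : exists i : nat, (0 < k i)%N.
    have [i ki] : exists i : 'I_n, k i != 0%N.
      apply/existsP; rewrite -negb_forall; apply/negP => /forallP H.
      by move: sz; rewrite big1 // => i _; apply/eqP; exact: H.
    by exists i; rewrite lt0n.
  have bd (i : nat) : (0 < k i)%N -> (i <= n)%N.
    by move=> ki; rewrite leqNgt; apply/negP => ni; rewrite k_n // ltnW in ki.
  have [m km mmax] := ex_maxnP ex bd.
  exists m; split=> //.
    by rewrite ltnNge; apply/negP => nm; rewrite k_n in km.
  by move=> i mi; apply/eqP; rewrite -leqn0 leqNgt; apply/negP => /mmax; lia.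
have [p kp] : exists p, k m = p.+1 by exists (k m).-1; rewrite prednK.
pose k' (i : nat) := if i == m then p else k i.
have k'_mono (i : nat) : (k' i.+1 <= k' i)%N.
  have := k_mono i; have kzi := kz i.+1.
  rewrite /k'; case: eqP => [im|im1]; case: eqP => [im'|im'] //.
  - by rewrite im kp => /ltnW.
  - by move=> _; rewrite kzi //; lia.
have k'_n (i : nat) : (n <= i)%N -> k' i = 0%N.
  by move=> ni; rewrite /k' ifF ?k_n //; apply/eqP; lia.
have sz' : (\sum_(i < n) k' i)%N = N.
  move: sz; rewrite (bigD1 (Ordinal mn)) //= kp addSn => -[<-].
  rewrite (bigD1 (Ordinal mn)) //= /k' eqxx; congr (_ + _)%N.
  by apply: eq_bigr => i; rewrite -val_eqE /= => /negPf ->.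
have [w mw] : exists w, (m.+1 + w)%N = n by exists (n - m.+1)%N; lia.
have [chi hp] := head_cproduct (shape_exponents k) mw (leqnn m).
have tail0 (e : nat -> nat) : (forall i : nat, (m < i)%N -> e i = 0%N) ->
    cproduct 0 n e = cproduct 0 m e * cminor m.+1 ^+ e m /\
    (cdegree 0 n e = cdegree 0 m e + e m * m.+1)%N.
  move=> e0; rewrite /cproduct /cdegree.
  rewrite !(@big_cat_nat _ _ _ m.+1 0 n) //= !big_nat_recr //=.
  have e0' (i : nat) : ((m.+1 <= i < n)%N && true) -> e i = 0%N by rewrite andbT => /andP[mi _]; apply: e0.
  split.
    by rewrite [X in _ * X = _]big_nat_cond [X in _ * X = _]big1 ?mulr1 // => i /e0' ->.
  by rewrite [X in (_ + X)%N = _]big_nat_cond [X in (_ + X)%N = _]big1 ?addn0 // => i /e0' ->.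
have [E1 E2] : cproduct 0 n (shape_exponents k) = cproduct 0 m (shape_exponents k) * cminor m.+1 ^+ p.+1 /\
    cdegree 0 n (shape_exponents k) = (cdegree 0 m (shape_exponents k) + (m + p * m.+1)).+1.
  have [|-> ->] := tail0 (shape_exponents k).
    by move=> i mi; rewrite /shape_exponents kz.
  by rewrite /shape_exponents kp kz // subn0; split=> //; lia.
have [E1' E2'] : cproduct 0 n (shape_exponents k') =
      cproduct 0 m (shape_exponents k) * (cminor m * cminor m.+1 ^+ p) /\
    cdegree 0 n (shape_exponents k') = (cdegree 0 m (shape_exponents k) + (m + p * m.+1))%N.
  have [|-> ->] := tail0 (shape_exponents k').
    by move=> i mi; rewrite /shape_exponents /k' !ifF ?kz //; apply/eqP; lia.
  have -> : shape_exponents k' m = p.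
    by rewrite /shape_exponents /k' eqxx ifF ?kz ?subn0 //; apply/eqP; lia.
  rewrite mulrA addnA; suff [-> ->] : cproduct 0 m (shape_exponents k') =
      cproduct 0 m (shape_exponents k) * cminor m /\
      (cdegree 0 m (shape_exponents k') = cdegree 0 m (shape_exponents k) + m)%N by [].
  case: (m) kp mn @k' {k'_mono k'_n sz' mw hp E1 E2 tail0 km kz} => [|m'] kp mn k'.
    by rewrite /cproduct /cdegree !big_geq // cminor0 mulr1.
  have e1 : shape_exponents k' m' = (shape_exponents k m').+1.
    rewrite /shape_exponents /k' eqxx ifF; last by apply/eqP; lia.
    by have := k_mono m'; rewrite kp => H; lia.
  have e2 (i : nat) : (i < m')%N -> shape_exponents k' i = shape_exponents k i.
    by move=> im; rewrite /shape_exponents /k' !ifF //; apply/eqP; lia.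
  have c1 : \prod_(0 <= i < m') cminor i.+1 ^+ shape_exponents k' i =
      \prod_(0 <= i < m') cminor i.+1 ^+ shape_exponents k i.
    by apply: eq_big_nat => i /andP[_ im]; rewrite e2.
  have d1 : (\sum_(0 <= i < m') shape_exponents k' i * i.+1 =
      \sum_(0 <= i < m') shape_exponents k i * i.+1)%N.
    by apply: eq_big_nat => i /andP[_ im]; rewrite e2.
  rewrite /cproduct /cdegree !big_nat_recr //= c1 d1 e1 exprSr mulrA mulSn.
  by split=> //; lia.
have IH := IHN k' sz' k'_mono k'_n; rewrite E1' E2' in IH.
have [c Hc] := form_proportional (lowest_v mw hp p) (eps_v mw hp p).
have cE := ratio_step mw hp Hc IH.
rewrite E1 E2 => Hx; rewrite Hc //; congr (_ * _).
apply: (mulIf q2); rewrite cE /shape_ratio.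
rewrite [in RHS](bigD1 (Ordinal mn)) //= [in LHS](bigD1 (Ordinal mn)) //=.
have k'm : k' m = p by rewrite /k' eqxx.
have k'e (i : nat) : i != m -> k' i = k i by rewrite /k' => /negPf ->.
rewrite kp big_ord_recr /= k'm.
rewrite (eq_bigr (fun i : 'I_n => \prod_(u < k i) box_ratio i u)); last first.
  by move=> i; rewrite -val_eqE /= => im; rewrite k'e.
move: (\prod_(u < p) _) (\prod_(i < n | _) _) => X Y.
rewrite /box_ratio; field.
by rewrite expf_neq0 ?qC_neq0 // q2.
Qed.

End TwoForms.

End QDerivatives.

(** * The twisted action *)

Section Twisted.
Variable lambda : R.
Variable pil : {bilinear U -> A -> A}.
Hypothesis pilP : is_twisted_action n_gt0 act lambda pil.
Variable formL : {dot A for (Num.conj : C -> C)}.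
Hypothesis formLP : is_invariant_product pil formL.

(** The twist only rescales K_n by a real factor, which the adjoint sees on both
    sides. *)
Lemma formL_compact : invariant_form (@Uq_compact R n q) act formL.
Proof.
have pil_inv x f g : formL (pil x f) g = formL f (pil (star x) g).
  exact: (invariant_product_inv formLP).
have pilM x y f : pil (x * y) f = pil x (pil y f) by case: (twisted_action pilP).
have starU (x y : U) : star (x * y) = star y * star x by exact: starM.
have qll : qpow q lambda * qpow q (- lambda) = 1.
  by rewrite qpowN divff // eq_complex /= gt_eqF // powR_gt0.
move=> x f g Hx; elim: Hx f g => {x} [i ni|i ni|i|i||x y _ IHx _ IHy|c x _ IHx|x y _ IHx _ IHy] f g.
- have [_ _ _ <-] := twisted_other pilP f ni.
  rewrite pil_inv starE // pilM actM; have [_ _ <- _] := twisted_other pilP g ni.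
  by have [<- _ _ _] := twisted_other pilP (pil (F q i) g) ni.
- have [_ _ <- _] := twisted_other pilP f ni.
  rewrite pil_inv starF // pilM actM; have [_ <- _ _] := twisted_other pilP g ni.
  by have [_ _ _ <-] := twisted_other pilP (pil (Kinv q i) g) ni.
- rewrite starK; have [ni|/eqP ni] := eqVneq i.+1 n; last first.
    have [<- _ _ _] := twisted_other pilP f ni; rewrite pil_inv starK.
    by have [<- _ _ _] := twisted_other pilP g ni.
  have actK y : act (K q i) y = qpow q (- lambda) *: pil (K q i) y.
    by rewrite (twisted_K_n pilP) // scalerA mulrC qll scale1r.
  by rewrite !actK formZl formZr pil_inv starK conj_real.
- rewrite starKinv; have [ni|/eqP ni] := eqVneq i.+1 n; last first.
    have [_ <- _ _] := twisted_other pilP f ni; rewrite pil_inv starKinv.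
    by have [_ <- _ _] := twisted_other pilP g ni.
  have actK y : act (Kinv q i) y = qpow q lambda *: pil (Kinv q i) y.
    by rewrite (twisted_Kinv_n pilP) // scalerA qll scale1r.
  by rewrite !actK formZl formZr pil_inv starKinv conj_real.
- by rewrite star1 // !act1.
- by rewrite starD // !actDx formDl formDr IHx IHy.
- by rewrite starZ // !actZx formZl formZr conjCK IHx.
- by rewrite starM // !actM IHx IHy.
Qed.

(** The adjoint of F_n is - E_n K_n^-1, and by E_midE the twist turns the inner skew
    derivation z g - (K_n g) z into z g - q^(2 lambda) (K_n g) z. *)
Lemma twisted_F v f : formL (Fop mid v) f =
  h / (1 - qC ^+ 2) * (formL v (z nn nn * Kiop mid f) - qpow q (2 * lambda) * formL v (f * z nn nn)).
Proof.
have q2 := q2_neq1.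
have pil_inv x f' g : formL (pil x f') g = formL f' (pil (star x) g).
  exact: (invariant_product_inv formLP).
have pilM x y f' : pil (x * y) f' = pil x (pil y f') by case: (twisted_action pilP).
have ql0 : qpow q (- lambda) != 0 by rewrite eq_complex /= gt_eqF // powR_gt0.
have starF_mid : star (F q mid) = (-1) *: (E q mid * Kinv q mid) :> U.
  by rewrite scaleN1r [LHS]star_agen // /star_gen mid_n eqxx.
have pilE g : pil (E q mid) g = - (h / (1 - qC ^+ 2)) *:
    (z nn nn * g - qpow q (2 * lambda) *: (Kop mid g * z nn nn)).
  rewrite (twisted_E_n pilP) ?mid_n // E_midE.
  rewrite !scalerBr !scalerA -!scaleNr -!addrA -!scalerDl; congr (_ + _ *: _).
  by field.
have : formL (pil (F q mid) v) f = formL v (pil (star (F q mid)) f) by [].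
rewrite starF_mid (twisted_F_n pilP) ?mid_n // formZl.
rewrite linearZl_LR pilM (twisted_Kinv_n pilP) ?mid_n // (linearZr_LR pil) pilE KKi.
have cr (x : R) : Num.conj (qpow q x) = qpow q x by exact: conj_real.
have ck : Num.conj (h / (1 - qC ^+ 2)) = h / (1 - qC ^+ 2).
  by rewrite rmorphM /= conj_h fmorphV rmorphB /= rmorph1 rmorphXn /= conj_qC.
rewrite !formZr !rmorphN rmorph1 /= ck cr formBr formZr cr => H.
by apply: (mulfI ql0); rewrite H; ring.
Qed.

End Twisted.

End InitialAction.

(** * The ratio on a component *)

Lemma lowest_vectorE (R : realType) (n : nat) (n_gt0 : (0 < n)%N) (q : R) (k : n.-tuple nat) :
  lowest_vector q k = cproduct n_gt0 q 0 n (shape_exponents (nth 0%N k)).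
Proof.
rewrite /cproduct big_mkord; apply: eq_bigr => j _; congr (_ ^+ _).
have e i : @last_indices n j i = low_index n_gt0 i.
  apply: val_inj; rewrite /= val_low //.
  by have := ltn_ord i; have := ltn_ord j; lia.
exact: (eq_qminor q e e).
Qed.

(** The Pochhammer symbol has the argument q^(2 lambda + 2 - 2 i) with i counted
    from 1, that is, q^(2 lambda) / q^(2 i) with i counted from 0. *)
Lemma shape_ratioE (R : realType) (n : nat) (q lambda : R) (k : n.-tuple nat) : 0 < q ->
  ((\prod_(i < n) qpochhammer (q `^ (2 * lambda + 2 - 2 * i.+1%:R)) (q ^+ 2) (tnth k i))
       / (1 - q ^+ 2) ^+ (\sum_(i < n) tnth k i))%:C%C =
  shape_ratio n q (qpow q (2 * lambda)) (nth 0%N k).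
Proof.
move=> q0; rewrite -prodrXr -prodfV -big_split rmorph_prod; apply: eq_bigr => i _ /=.
rewrite (tnth_nth 0%N) /qpochhammer /box_ratio.
have -> : q `^ (2 * lambda + 2 - 2 * i.+1%:R) = q `^ (2 * lambda) / q ^+ (2 * i).
  rewrite -powR_mulrn ?ltW // -powRN -powRD; last by rewrite (gt_eqF q0) implybT.
  by congr (_ `^ _); rewrite natrM -natr1; ring.
rewrite big_split /= prodr_const card_ord.
rewrite rmorphM rmorph_prod fmorphV rmorphXn rmorphB rmorph1 rmorphXn; congr (_ * _).
  apply: eq_bigr => u _; rewrite rmorphB rmorph1 !rmorphM fmorphV !rmorphXn /=.
  by rewrite (exprM _ 2 u) mulrAC.
by rewrite exprVn.
Qed.

Theorem proposition5p2 (R : realType) (q : R) (n : nat) (lambda : R)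
    (q_gt0 : 0 < q) (q_lt1 : q < 1) (n_gt0 : (0 < n)%N)
    (lambda_gt : 2 * n%:R - 1 < lambda)
    (act : {bilinear Uq (2 * n).-1 q -> qmat n q -> qmat n q})
    (act_initial : is_initial_action n_gt0 act)
    (pil : {bilinear Uq (2 * n).-1 q -> qmat n q -> qmat n q})
    (pil_twisted : is_twisted_action n_gt0 act lambda pil)
    (form_lambda : {dot qmat n q for (Num.conj : R[i] -> R[i])})
    (form_lambdaP : is_invariant_product pil form_lambda)
    (d : qmat n q -> Omega1 n q) (d_diff : is_differential d)
    (partial : 'I_n -> 'I_n -> qmat n q -> qmat n q)
    (partialP : are_q_derivatives d partial)
    (form_Fock : {dot qmat n q for (Num.conj : R[i] -> R[i])})
    (form_FockP : is_Fock_product act partial form_Fock)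
    (k : n.-tuple nat) (k_sorted : sorted geq k)
    (f1 f2 : qmat n q) :
  component act k f1 -> component act k f2 ->
  form_Fock f1 f2 =
    ((\prod_(i < n) qpochhammer (q `^ (2 * lambda + 2 - 2 * i.+1%:R)) (q ^+ 2) (tnth k i))
       / (1 - q ^+ 2) ^+ (\sum_(i < n) tnth k i))%:C%C
    * form_lambda f1 f2.
Proof.
move=> [x1 Hx1 ->] [x2 Hx2 ->].
have Fock_inv := Fock_inv form_FockP.
have lambda_inv := formL_compact q_gt0 act_initial pil_twisted form_lambdaP.
(* By invariance both arguments can be moved to the first slot. *)
have move_r (form : {dot qmat n q for (Num.conj : R[i] -> R[i])}) f g :
    invariant_form (@Uq_compact R n q) act form ->
    form f (act x2 g) = form (act (star x2) f) g.
  by move=> inv; rewrite formC inv // -formC.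
rewrite !move_r // shape_ratioE // (lowest_vectorE n_gt0).
have k_mono i : (nth 0%N k i.+1 <= nth 0%N k i)%N.
  have [ik|ki] := ltnP i.+1 (size k); last by rewrite nth_default.
  by move/(sortedP 0%N): k_sorted => /(_ i ik).
have k_n i : (n <= i)%N -> nth 0%N k i = 0%N by move=> ni; rewrite nth_default ?size_tuple.
apply: (ratio_shape q_gt0 q_lt1 act_initial d_diff partialP form_FockP lambda_inv
  (twisted_F q_gt0 q_lt1 act_initial pil_twisted form_lambdaP)
  (invariant_product_1 form_lambdaP) k_mono k_n).
apply: (compact_homog q_gt0 q_lt1 act_initial (compact_star q_gt0 Hx2)).
apply: (compact_homog q_gt0 q_lt1 act_initial Hx1).
rewrite /cproduct /cdegree !big_mkord; apply: homog_prod_ord => i.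
exact/homogX/qminor_homog.
Qed.
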